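(* $\mathfrak D$ (resp. $\mathfrak T$) is a fine moduli space for the set of all labeled, oriented, possibly-degenerate similarity classes of triangles (resp. labeled, oriented, possibly-degenerate triangles), i.e. it represents the functor $\mathscr F_{\mathfrak D}$ (resp. $\mathscr F_{\mathfrak T}$) of families. In particular, the family $\mathfrak D$ (resp. $\mathfrak T$), given by the identity of $\mathfrak D$ (resp. of $\mathfrak T$), is a universal family: every family over a base $B$ is its pullback along a unique morphism $B\to\mathfrak D$ (resp. $B\to\mathfrak T$).
   Context: Smooth $\mathbb R$-varieties include nonsingular affine and projective varieties over $\mathbb R$ and their blowups, considered through their real points, which are naturally smooth manifolds; they form a category $\mathbb R\text{-}\mathsf{Var}$. $\mathbb C_0$ is a copy of $\mathbb C$; $\mathbb X=\{(a,b,c)\in\mathbb C^3:a+b+c=0\}$; $\mathbb P(\mathbb X)\subset\mathbb P^2(\mathbb C)$ is its projectivization, regarded as a real surface. $\mathbb R/\pi$ means $\mathbb R/\pi\mathbb Z$, identified with $\mathbb P^1(\mathbb R)$ via $[x,y]\mapsto\mathrm{Arg}(x+yi)\bmod\pi$. $\mathbb T=\{(\alpha,\beta,\gamma)\in(\mathbb R/\pi)^3:\alpha+\beta+\gamma=0\}$. The set $\mathfrak T$ of labeled, oriented, possibly-degenerate triangles consists of all $(B_0;(a,b,c);[a_1,a_2,b_1,b_2,c_1,c_2];(\xi_a,\xi_b,\xi_c))\in\mathbb C_0\times\mathbb X\times\mathbb P^5(\mathbb R)\times(\mathbb R/\pi)^3$ such that: (i) if $(a,b,c)\ne(0,0,0)$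 then $[a_1,a_2,b_1,b_2,c_1,c_2]=[\mathrm{Re}\,a,\mathrm{Im}\,a,\mathrm{Re}\,b,\mathrm{Im}\,b,\mathrm{Re}\,c,\mathrm{Im}\,c]$; (ii) if $(a,b,c)=(0,0,0)$ then $a_1+b_1+c_1=a_2+b_2+c_2=0$; (iii) if $a_1+a_2i\neq0$ then $\xi_a=\mathrm{Arg}(a_1+a_2i)\bmod\pi$, and similarly for $\xi_b,\xi_c$; (iv) if $a_1+a_2i=0$ then $\xi_a\in\mathbb R/\pi$ is arbitrary, and similarly for $\xi_b,\xi_c$. The similarity class of such a triangle is $([a_1+a_2i,b_1+b_2i,c_1+c_2i];(\xi_b-\xi_c,\ \xi_c-\xi_a,\ \xi_a-\xi_b))\in\mathbb P(\mathbb X)\times\mathbb T$, and $\mathfrak D\subset\mathbb P(\mathbb X)\times\mathbb T$ is the set of all similarity classes of elements of $\mathfrak T$. Smooth $\mathbb R$-variety structures: $\mathfrak T$ equals the iterated real blowup of $\mathbb C_0\times\mathbb X$ along $\mathbb C_0\times\{\mathbf 0\}$ and then along the strict transform of $\{abc=0\}$; $\mathfrak D$ is identified with the real blowup of the surface $\mathbb P(\mathbb X)$ at the three points $[0,1,-1],[1,0,-1],[1,-1,0]$, the blowdown being the projection $\mathfrak D\to\mathbb P(\mathbb X)$. A family of triangle classes (resp. triangles) with base $B\in\mathbb R\text{-}\mathsf{Var}$ is a morphism $f:B\to\mathbb P(\mathbb X)\times\mathbb T$ (resp. $f:B\to\mathbb C_0\times\mathbb X\times\mathbb P^5(\mathbb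 R)\times(\mathbb R/\pi)^3$) whose image lies in $\mathfrak D$ (resp. $\mathfrak T$). The pullback of a family $f$ over $C$ along a morphism $m:B\to C$ is $f\circ m$. $\mathscr F_{\mathfrak D}$ (resp. $\mathscr F_{\mathfrak T}$) sends $B$ to the set of families of triangle classes (resp. triangles) with base $B$ and sends $m$ to pullback along $m$. *)

(* Defs.v *)
From HB Require Import structures.
From mathcomp Require Import all_boot all_order all_algebra ring_quotient.
From mathcomp Require Import complex.
From mathcomp Require Import boolp classical_sets reals trigo.
From mathcomp.multinomials Require mpoly.

Set Implicit Arguments.
Unset Strict Implicit.
Unset Printing Implicit Defensive.

Import Order.TTheory GRing.Theory Num.Theory.
Local Open Scope classical_set_scope.
Local Open Scope ring_scope.

(** * Spaces with functions

    Real algebraic varieties are treated through their real points, as in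
    Bochnak-Coste-Roy, "Real Algebraic Geometry", ch. 3: sets with a (Zariski)
    topology and a sheaf of R-valued regular functions.  A function on an open
    set U is represented by a total function whose values outside U are
    irrelevant ([regular_eq]). *)

Record rspace (R : realType) := RSpace {
  carrier :> Type;
  zopen : set (set carrier);
  regular : set carrier -> set (carrier -> R);
  zopenT : zopen setT;
  zopenI : forall U V, zopen U -> zopen V -> zopen (U `&` V);
  zopen_bigcup : forall (S : set (set carrier)),
    S `<=` zopen -> zopen (\bigcup_(U in S) U);
  regular_eq : forall U f g, zopen U ->
    (forall x, U x -> f x = g x) -> regular U f -> regular U g;
  regular_sub : forall U V f, zopen U -> zopen V ->
    V `<=` U -> regular U f -> regular V f;
  regular_glue : forall U f, zopen U ->
    (forall x, U x -> exists V, [/\ zopen V, V x & regular V f]) ->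
    regular U f;
  regular_cst : forall U (c : R), zopen U -> regular U (fun=> c);
  regularD : forall U f g, zopen U ->
    regular U f -> regular U g -> regular U (fun x => f x + g x);
  regularM : forall U f g, zopen U ->
    regular U f -> regular U g -> regular U (fun x => f x * g x);
  zopen_neq0 : forall U f, zopen U -> regular U f ->
    zopen [set x | U x /\ f x != 0];
  regularV : forall U f, zopen U -> regular U f ->
    regular [set x | U x /\ f x != 0] (fun x => (f x)^-1)
}.

Definition zclosed (R : realType) (X : rspace R) (A : set X) : Prop :=
  zopen (~` A).

Definition zclosure (R : realType) (X : rspace R) (A : set X) : set X :=
  [set x | forall U : set X, zopen U -> U x -> A `&` U !=set0].

Definition is_morphism (R : realType) (X Y : rspace R) (f : X -> Y) : Prop :=
  forall V : set Y, zopen V ->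
    zopen (f @^-1` V) /\
    forall g : Y -> R, regular V g -> regular (f @^-1` V) (g \o f).

Definition is_isomorphism (R : realType) (X Y : rspace R) (f : X -> Y) : Prop :=
  is_morphism f /\
  exists g : Y -> X, [/\ is_morphism g, cancel f g & cancel g f].

Record hom (R : realType) (X Y : rspace R) := Hom {
  hom_fun :> X -> Y;
  homP : is_morphism hom_fun
}.

Lemma id_is_morphism (R : realType) (X : rspace R) :
  is_morphism (fun x : X => x).
Proof. by []. Qed.

Lemma comp_is_morphism (R : realType) (X Y Z : rspace R)
  (g : Y -> Z) (f : X -> Y) :
  is_morphism g -> is_morphism f -> is_morphism (fun x => g (f x)).
Proof.
move=> mg mf V oV; have [oV' rV'] := mg V oV; have [oV2 rV2] := mf _ oV'.
by split=> // h rh; apply: (rV2 (h \o g)); apply: rV'.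
Qed.

Definition hom_id (R : realType) (X : rspace R) : hom X X :=
  Hom (@id_is_morphism R X).

Definition hom_comp (R : realType) (X Y Z : rspace R)
  (g : hom Y Z) (f : hom X Y) : hom X Z :=
  Hom (comp_is_morphism (homP g) (homP f)).

(** ** The structure generated by partially defined functions

    [G U f] declares [f] to be regular on [U].  [genring G] is the set of
    polynomial expressions in these functions, each on the intersection of the
    domains involved.  Open sets are the unions of the loci [q != 0], and
    regular functions are locally quotients p / q, for p, q in [genring G]. *)

Inductive genring (R : realType) (T : Type) (G : set T -> (T -> R) -> Prop) :
  set T -> (T -> R) -> Prop :=
| genring_base U f : G U f -> genring G U f
| genring_cst (c : R) : genring G setT (fun=> c)
| genring_add U V f g : genring G U f -> genring G V g ->
    genring G (U `&` V) (fun x => f x + g x)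
| genring_mul U V f g : genring G U f -> genring G V g ->
    genring G (U `&` V) (fun x => f x * g x).

Definition gen_open (R : realType) (T : Type) (G : set T -> (T -> R) -> Prop)
  (W : set T) : Prop :=
  forall x, W x -> exists (U : set T) (q : T -> R),
    [/\ genring G U q, U x, q x != 0 & forall y, U y -> q y != 0 -> W y].

Definition gen_regular (R : realType) (T : Type)
  (G : set T -> (T -> R) -> Prop) (W : set T) (f : T -> R) : Prop :=
  forall x, W x -> exists (U V : set T) (p q : T -> R),
    [/\ genring G U p, genring G V q, U x /\ V x, q x != 0 &
        forall y, W y -> U y -> V y -> q y != 0 -> f y = p y / q y].

Section Generated.
Variables (R : realType) (T : Type) (G : set T -> (T -> R) -> Prop).
Implicit Types (U V W : set T) (f g : T -> R).

Lemma gen_openT : gen_open G setT.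
Proof.
move=> x _; exists setT, (fun=> 1); split=> //; first exact: genring_cst.
exact: oner_neq0.
Qed.

Lemma gen_openI U V : gen_open G U -> gen_open G V -> gen_open G (U `&` V).
Proof.
move=> oU oV x [/oU[U1 [q1 [G1 U1x q1x H1]]] /oV[U2 [q2 [G2 U2x q2x H2]]]].
exists (U1 `&` U2), (fun x => q1 x * q2 x); split=> //.
- exact: genring_mul.
- by rewrite mulf_neq0.
- move=> y [U1y U2y]; rewrite mulf_eq0 negb_or => /andP[q1y q2y].
  by split; [apply: H1|apply: H2].
Qed.

Lemma gen_open_bigcup (S : set (set T)) :
  S `<=` gen_open G -> gen_open G (\bigcup_(U in S) U).
Proof.
move=> SG x [U SU Ux]; have [V [q [GV Vx qx H]]] := SG U SU x Ux.
by exists V, q; split=> // y Vy qy; exists U => //; apply: H.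
Qed.

Lemma gen_regular_eq U f g : gen_open G U ->
  (forall x, U x -> f x = g x) -> gen_regular G U f -> gen_regular G U g.
Proof.
move=> _ fg rf x Ux; have [V [W [p [q [Gp Gq VW qx H]]]]] := rf x Ux.
exists V, W, p, q; split=> // y Uy Vy Wy qy.
by rewrite -fg //; apply: H.
Qed.

Lemma gen_regular_sub U V f : gen_open G U -> gen_open G V ->
  V `<=` U -> gen_regular G U f -> gen_regular G V f.
Proof.
move=> _ _ VU rf x Vx; have [A [B [p [q [Gp Gq AB qx H]]]]] := rf x (VU x Vx).
by exists A, B, p, q; split=> // y Vy Ay By qy; apply: H => //; apply: VU.
Qed.

Lemma gen_regular_glue U f : gen_open G U ->
  (forall x, U x -> exists V, [/\ gen_open G V, V x & gen_regular G V f]) ->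
  gen_regular G U f.
Proof.
move=> _ H x Ux; have [V [oV Vx rV]] := H x Ux.
have [A [B [p [q [Gp Gq [Ax Bx] qx Hf]]]]] := rV x Vx.
have [C [r [Gr Cx rx Hr]]] := oV x Vx.
exists (A `&` C), (B `&` C), (fun x => p x * r x), (fun x => q x * r x).
split=> //; [exact: genring_mul|exact: genring_mul| |].
  by rewrite mulf_neq0.
move=> y Uy [Ay Cy] [By _]; rewrite mulf_eq0 negb_or => /andP[qy ry].
rewrite (Hf y) //; last exact: Hr.
by rewrite -mulf_div divff // mulr1.
Qed.

Lemma gen_regular_cst U (c : R) : gen_open G U -> gen_regular G U (fun=> c).
Proof.
move=> _ x _; exists setT, setT, (fun=> c), (fun=> 1).
split=> //; [exact: genring_cst|exact: genring_cst|exact: oner_neq0|].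
by move=> y *; rewrite divr1.
Qed.

Lemma gen_regularD U f g : gen_open G U -> gen_regular G U f ->
  gen_regular G U g -> gen_regular G U (fun x => f x + g x).
Proof.
move=> _ rf rg x Ux.
have [A [B [p [q [Gp Gq [Ax Bx] qx Hf]]]]] := rf x Ux.
have [C [D [r [s [Gr Gs [Cx Dx] sx Hg]]]]] := rg x Ux.
exists ((A `&` D) `&` (C `&` B)), (B `&` D),
  (fun x => p x * s x + r x * q x), (fun x => q x * s x); split=> //.
- by apply: genring_add; apply: genring_mul.
- exact: genring_mul.
- by rewrite mulf_neq0.
- move=> y Uy [[Ay Dy] [Cy By]] _; rewrite mulf_eq0 negb_or => /andP[qy sy].
  by rewrite Hf // Hg // addf_div.
Qed.

Lemma gen_regularM U f g : gen_open G U -> gen_regular G U f ->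
  gen_regular G U g -> gen_regular G U (fun x => f x * g x).
Proof.
move=> _ rf rg x Ux.
have [A [B [p [q [Gp Gq [Ax Bx] qx Hf]]]]] := rf x Ux.
have [C [D [r [s [Gr Gs [Cx Dx] sx Hg]]]]] := rg x Ux.
exists (A `&` C), (B `&` D),
  (fun x => p x * r x), (fun x => q x * s x); split=> //.
- exact: genring_mul.
- exact: genring_mul.
- by rewrite mulf_neq0.
- move=> y Uy [Ay Cy] [By Dy]; rewrite mulf_eq0 negb_or => /andP[qy sy].
  by rewrite Hf // Hg // mulf_div.
Qed.

Lemma gen_open_neq0 U f : gen_open G U -> gen_regular G U f ->
  gen_open G [set x | U x /\ f x != 0].
Proof.
move=> oU rf x [Ux fx].
have [A [B [p [q [Gp Gq [Ax Bx] qx Hf]]]]] := rf x Ux.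
have [C [r [Gr Cx rx Hr]]] := oU x Ux.
exists ((A `&` B) `&` C), (fun x => (p x * q x) * r x); split=> //.
- by apply: genring_mul => //; apply: genring_mul.
- rewrite !mulf_neq0 //.
  by apply: contraNneq fx => px0; rewrite Hf // px0 mul0r.
- move=> y [[Ay By] Cy]; rewrite !mulf_eq0 !negb_or => /andP[/andP[py qy] ry].
  have Uy := Hr y Cy ry; split=> //=.
  by rewrite Hf // mulf_neq0 // invr_eq0.
Qed.

Lemma gen_regularV U f : gen_open G U -> gen_regular G U f ->
  gen_regular G [set x | U x /\ f x != 0] (fun x => (f x)^-1).
Proof.
move=> oU rf x [Ux fx].
have [A [B [p [q [Gp Gq [Ax Bx] qx Hf]]]]] := rf x Ux.
exists (B `&` B), (A `&` B), (fun x => q x * q x), (fun x => p x * q x).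
split=> //; [exact: genring_mul|exact: genring_mul| |].
- rewrite mulf_neq0 //.
  by apply: contraNneq fx => px0; rewrite Hf // px0 mul0r.
- move=> y [Uy fy] [By _] [Ay _]; rewrite mulf_eq0 negb_or => /andP[py qy].
  by rewrite Hf // invf_div -mulf_div divff // mulr1.
Qed.

Definition generated : rspace R :=
  RSpace gen_openT gen_openI gen_open_bigcup gen_regular_eq gen_regular_sub
    gen_regular_glue gen_regular_cst gen_regularD gen_regularM
    gen_open_neq0 gen_regularV.

End Generated.

Definition pullback_gens (R : realType) (T : Type) (Y : rspace R) (phi : T -> Y)
  (U : set T) (f : T -> R) : Prop :=
  exists (V : set Y) (g : Y -> R),
    [/\ zopen V, regular V g, U = phi @^-1` V & f = g \o phi].

Definition subspace (R : realType) (X : rspace R) (A : set X) : rspace R :=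
  generated (pullback_gens (fun x : set_type A => \val x)).

Definition prod_space (R : realType) (X Y : rspace R) : rspace R :=
  generated (fun (U : set (X * Y)) f =>
    pullback_gens (fun z : X * Y => z.1) U f \/
    pullback_gens (fun z : X * Y => z.2) U f).

Definition power_space (R : realType) (n : nat) (X : rspace R) : rspace R :=
  generated (fun (U : set ('I_n -> X)) f =>
    exists j : 'I_n, pullback_gens (fun z : 'I_n -> X => z j) U f).

(* Only used along bijections: transport of the structure of X to T. *)
Section Pushforward.
Variables (R : realType) (X : rspace R) (T : Type) (phi : X -> T).

Let push_open (U : set T) : Prop := zopen (phi @^-1` U).
Let push_regular (U : set T) (f : T -> R) : Prop :=
  regular (phi @^-1` U) (f \o phi).

Lemma push_openT : push_open setT.
Proof. exact: zopenT. Qed.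

Lemma push_openI U V : push_open U -> push_open V -> push_open (U `&` V).
Proof. exact: zopenI. Qed.

Lemma push_open_bigcup (S : set (set T)) :
  S `<=` push_open -> push_open (\bigcup_(U in S) U).
Proof.
move=> SO; rewrite /push_open preimage_bigcup.
rewrite -(bigcup_image S (fun U => phi @^-1` U) id).
by apply: zopen_bigcup => _ [U SU <-]; apply: SO.
Qed.

Lemma push_regular_eq U f g : push_open U ->
  (forall x, U x -> f x = g x) -> push_regular U f -> push_regular U g.
Proof.
by move=> oU fg; apply: regular_eq => // x Ux; apply: fg.
Qed.

Lemma push_regular_sub U V f : push_open U -> push_open V ->
  V `<=` U -> push_regular U f -> push_regular V f.
Proof. by move=> oU oV VU; apply: regular_sub => // x; apply: VU. Qed.

Lemma push_regular_glue U f : push_open U ->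
  (forall x, U x -> exists V, [/\ push_open V, V x & push_regular V f]) ->
  push_regular U f.
Proof.
move=> oU H; apply: regular_glue => // x Ux.
by have [V [oV Vx rV]] := H _ Ux; exists (phi @^-1` V).
Qed.

Lemma push_regular_cst U (c : R) : push_open U -> push_regular U (fun=> c).
Proof. exact: regular_cst. Qed.

Lemma push_regularD U f g : push_open U -> push_regular U f ->
  push_regular U g -> push_regular U (fun x => f x + g x).
Proof. exact: regularD. Qed.

Lemma push_regularM U f g : push_open U -> push_regular U f ->
  push_regular U g -> push_regular U (fun x => f x * g x).
Proof. exact: regularM. Qed.

Lemma push_open_neq0 U f : push_open U -> push_regular U f ->
  push_open [set x | U x /\ f x != 0].
Proof. exact: zopen_neq0. Qed.

Lemma push_regularV U f : push_open U -> push_regular U f ->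
  push_regular [set x | U x /\ f x != 0] (fun x => (f x)^-1).
Proof. exact: regularV. Qed.

Definition pushforward : rspace R :=
  RSpace push_openT push_openI push_open_bigcup push_regular_eq
    push_regular_sub push_regular_glue push_regular_cst push_regularD
    push_regularM push_open_neq0 push_regularV.

End Pushforward.

(** ** Affine and projective spaces *)

Definition affine_space (R : realType) (n : nat) : rspace R :=
  generated (fun (U : set 'rV[R]_n) f =>
    exists i : 'I_n, U = setT /\ f = fun v => v 0 i).

Definition caffine_space (R : realType) (n : nat) : rspace R :=
  generated (fun (U : set 'rV[R[i]%C]_n) f =>
    exists i : 'I_n, U = setT /\
      (f = (fun v => complex.Re (v 0 i)) \/ f = (fun v => complex.Im (v 0 i)))).

Definition proj_pt (F : fieldType) (n : nat) : Type :=
  {L : {vspace 'rV[F]_n.+1} | \dim L == 1%N}.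

Definition pline (F : fieldType) (n : nat) (L : proj_pt F n) :
  {vspace 'rV[F]_n.+1} := \val L.

(* Some representative of the homogeneous coordinates of L. *)
Definition hrep (F : fieldType) (n : nat) (L : proj_pt F n) : 'rV[F]_n.+1 :=
  vpick (pline L).

(* L = [v_0, ..., v_n]. *)
Definition hcoord (F : fieldType) (n : nat) (L : proj_pt F n)
  (v : 'rV[F]_n.+1) : Prop :=
  v != 0 /\ pline L = <[v]>%VS.

Definition hnonzero (F : fieldType) (n : nat) (j : 'I_n.+1) :
  set (proj_pt F n) := [set L | hrep L 0 j != 0].

Definition hratio (F : fieldType) (n : nat) (i j : 'I_n.+1)
  (L : proj_pt F n) : F := hrep L 0 i / hrep L 0 j.

Definition RP (R : realType) (n : nat) : rspace R :=
  generated (fun (U : set (proj_pt R n)) f =>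
    exists i j, U = @hnonzero R n j /\ f = hratio i j).

(* Complex projective space as a real variety of dimension 2n. *)
Definition CP (R : realType) (n : nat) : rspace R :=
  generated (fun (U : set (proj_pt R[i]%C n)) f =>
    exists i j, U = @hnonzero R[i]%C n j /\
      (f = (fun L => complex.Re (hratio i j L)) \/
       f = (fun L => complex.Im (hratio i j L)))).

(** * The category of smooth R-varieties *)

Definition zero_set (R : realType) (n : nat) (S : set (mpoly.mpoly n R)) :
  set (affine_space R n) :=
  [set x : 'rV[R]_n | forall p, S p -> mpoly.meval (fun i => x 0 i) p = 0].

(* Near x, V is the zero set of c polynomials vanishing on V whose
   differentials at x are linearly independent. *)
Definition nonsingular_at (R : realType) (n : nat) (V : set (affine_space R n))
  (x : 'rV[R]_n) : Prop :=
  exists (c : nat) (F : 'I_c -> mpoly.mpoly n R) (g : mpoly.mpoly n R),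
    [/\ forall (y : 'rV[R]_n) i, V y -> mpoly.meval (fun k => y 0 k) (F i) = 0,
        \rank (\matrix_(i < c, j < n)
          mpoly.meval (fun k => x 0 k) (mpoly.mderiv j (F i))) = c,
        mpoly.meval (fun k => x 0 k) g != 0 &
        forall y : 'rV[R]_n, mpoly.meval (fun k => y 0 k) g != 0 ->
          (forall i, mpoly.meval (fun k => y 0 k) (F i) = 0) -> V y].

Definition smooth_affine_chart (R : realType) (X : rspace R) (U : set X) : Prop :=
  exists (n : nat) (S : set (mpoly.mpoly n R))
         (psi : subspace U -> subspace (zero_set S)),
    (forall x, zero_set S x -> nonsingular_at (zero_set S) x) /\
    is_isomorphism psi.

Definition separated (R : realType) (X : rspace R) : Prop :=
  @zclosed R (prod_space X X) [set z : X * X | z.1 = z.2].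

Definition smooth_variety (R : realType) (X : rspace R) : Prop :=
  separated X /\
  exists (m : nat) (U : 'I_m -> set X),
    (forall x, exists i, U i x) /\
    (forall i, zopen (U i) /\ smooth_affine_chart (U i)).

Record rvar (R : realType) := RVar {
  rvar_space :> rspace R;
  rvarP : smooth_variety rvar_space
}.

(** * Real blowups *)

(* The functions f i generate over U the ideal sheaf of Z. *)
Definition generate_ideal (R : realType) (X : rspace R) (Z U : set X)
  (k : nat) (f : 'I_k -> X -> R) : Prop :=
  [/\ forall i, regular U (f i),
      forall i x, U x -> Z x -> f i x = 0 &
      forall (W : set X) (g : X -> R), zopen W -> W `<=` U -> regular W g ->
        (forall x, W x -> Z x -> g x = 0) ->
        forall x, W x -> exists (W' : set X) (h : 'I_k -> X -> R),
          [/\ zopen W', W' x, W' `<=` W, forall i, regular W' (h i) &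
              forall y, W' y -> g y = \sum_i h i y * f i y]].

(* Closure in U x P^k of the graph of [f_0, ..., f_k] on U \ Z. *)
Definition blowup_model (R : realType) (X : rspace R) (Z U : set X)
  (k : nat) (f : 'I_k.+1 -> X -> R) : set (prod_space X (RP R k)) :=
  [set z : X * RP R k | U z.1 /\
    @zclosure R (prod_space X (RP R k))
      [set t : X * RP R k | [/\ U t.1, ~ Z t.1 &
         hcoord t.2 (\row_i f i t.1)]] z].

Definition is_blowup (R : realType) (Y X : rspace R) (pr : Y -> X) (Z : set X) :
  Prop :=
  [/\ zclosed Z, is_morphism pr &
    forall x : X, exists (U : set X) (k : nat) (f : 'I_k.+1 -> X -> R)
      (psi : subspace (pr @^-1` U) -> subspace (blowup_model Z U f)),
      [/\ zopen U, U x, generate_ideal Z U f, is_isomorphism psi &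
          forall y, (\val (psi y)).1 = pr (\val y)]].

Definition strict_transform (R : realType) (Y X : rspace R) (pr : Y -> X)
  (Z W : set X) : set Y :=
  zclosure (pr @^-1` (W `\` Z)).

(** * Moduli functors *)

Record presheaf (R : realType) := Presheaf {
  ps_obj :> rvar R -> Type;
  ps_map : forall B C : rvar R, hom B C -> ps_obj C -> ps_obj B;
  ps_map_id : forall (B : rvar R) (s : ps_obj B), ps_map (hom_id B) s = s;
  ps_map_comp : forall (A B C : rvar R) (g : hom B C) (f : hom A B)
    (s : ps_obj C), ps_map (hom_comp g f) s = ps_map f (ps_map g s)
}.

Record family (R : realType) (A : rspace R) (S : set A) (B : rvar R) := Family {
  family_hom : hom B A;
  family_in : forall b, S (family_hom b)
}.

Definition family_pullback (R : realType) (A : rspace R) (S : set A)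
  (B C : rvar R) (m : hom B C) (f : family S C) : family S B :=
  @Family R A S B (hom_comp (family_hom f) m) (fun b => family_in f (m b)).

Lemma hom_ext (R : realType) (X Y : rspace R) (f g : hom X Y) :
  (forall x, f x = g x) -> f = g.
Proof.
case: f g => [f hf] [g hg] /= /funext fg; rewrite -fg in hg *.
by rewrite (Prop_irrelevance hf hg).
Qed.

Lemma family_ext (R : realType) (A : rspace R) (S : set A) (B : rvar R)
  (f g : family S B) :
  (forall b, family_hom f b = family_hom g b) -> f = g.
Proof.
case: f g => [f hf] [g hg] /= /hom_ext fg; rewrite -fg in hg *.
by rewrite (Prop_irrelevance hf hg).
Qed.

Lemma family_pullback_id (R : realType) (A : rspace R) (S : set A)
  (B : rvar R) (f : family S B) : family_pullback (hom_id B) f = f.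
Proof. exact: family_ext. Qed.

Lemma family_pullback_comp (R : realType) (A : rspace R) (S : set A)
  (B C D : rvar R) (g : hom C D) (m : hom B C) (f : family S D) :
  family_pullback (hom_comp g m) f = family_pullback m (family_pullback g f).
Proof. exact: family_ext. Qed.

(* B |-> { morphisms B -> A with image in S }, with pullback by composition. *)
Definition families (R : realType) (A : rspace R) (S : set A) : presheaf R :=
  @Presheaf R (@family R A S) (@family_pullback R A S)
    (@family_pullback_id R A S) (@family_pullback_comp R A S).

Lemma val_is_morphism (R : realType) (A : rspace R) (S : set A) :
  @is_morphism R (subspace S) A (fun x => \val x).
Proof.
move=> V oV; split.
  move=> x Vx; exists ((fun x : set_type S => \val x) @^-1` V), (fun=> 1).
  split=> //; last exact: oner_neq0.
  apply: genring_base; exists V, (fun=> 1); split=> //; exact: regular_cst.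
move=> g rg x Vx; exists ((fun x : set_type S => \val x) @^-1` V), setT.
exists (g \o (fun x : set_type S => \val x)), (fun=> 1); split=> //.
- by apply: genring_base; exists V, g.
- exact: genring_cst.
- exact: oner_neq0.
- by move=> y *; rewrite divr1.
Qed.

Lemma val_in (R : realType) (A : rspace R) (S : set A) (x : subspace S) :
  S (\val x).
Proof. exact: set_mem (valP x). Qed.

(* The family over S itself whose classifying map is the identity of S. *)
Definition tautological_family (R : realType) (A : rspace R) (S : set A)
  (hS : smooth_variety (subspace S)) : families S (RVar hS) :=
  @Family R A S (RVar hS) (Hom (@val_is_morphism R A S)) (@val_in R A S).

(* M represents F, by a natural bijection under which u corresponds to the
   identity of M. *)
Definition represents (R : realType) (M : rvar R) (F : presheaf R) (u : F M) :
  Prop :=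
  exists eta : forall B : rvar R, hom B M -> F B,
    [/\ forall B, bijective (eta B),
        forall (B C : rvar R) (m : hom B C) (h : hom C M),
          eta B (hom_comp h m) = ps_map m (eta C h) &
        eta M (hom_id M) = u].

Definition universal_family (R : realType) (M : rvar R) (F : presheaf R)
  (u : F M) : Prop :=
  forall (B : rvar R) (f : F B), exists! m : hom B M, f = ps_map m u.

Definition fine_moduli_space (R : realType) (M : rvar R) (F : presheaf R)
  (u : F M) : Prop :=
  represents u /\ universal_family u.

(** * R/pi *)

Definition piZ (R : realType) : {pred R} :=
  fun x => `[< exists k : int, x = pi *~ k >].

Lemma piZ_zmod_closed (R : realType) : zmod_closed (@piZ R).
Proof.
split; first by apply/asboolP; exists 0; rewrite mulr0z.
move=> x y /asboolP[k ->] /asboolP[l ->]; apply/asboolP.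
by exists (k - l); rewrite mulrzBr.
Qed.

HB.instance Definition _ (R : realType) :=
  GRing.isZmodClosed.Build R (@piZ R) (@piZ_zmod_closed R).

Definition Rpi (R : realType) : zmodType := Quotient.quot (@piZ R).

(* The argument of x + yi in ]-pi, pi], for (x, y) != (0, 0). *)
Definition Arg (R : realType) (x y : R) : R :=
  let t := acos (x / Num.sqrt (x ^+ 2 + y ^+ 2)) in
  if 0 <= y then t else - t.

Definition Arg_pi (R : realType) (x y : R) : Rpi R :=
  (\pi_(Quotient.quot (@piZ R)) (Arg x y))%qT.

(* [x, y] |-> Arg (x + yi) mod pi; independent of the representative. *)
Definition P1_to_Rpi (R : realType) (L : RP R 1) : Rpi R :=
  let v := hrep L in Arg_pi (v 0 ord0) (v 0 ord_max).

Definition Rpi_space (R : realType) : rspace R := pushforward (@P1_to_Rpi R).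

(** * Triangles *)

Definition C0 (R : realType) : rspace R :=
  generated (fun (U : set R[i]%C) f => U = setT /\
    (f = (fun z => complex.Re z) \/ f = (fun z => complex.Im z))).

Definition XX (R : realType) : rspace R :=
  @subspace R (caffine_space R 3) [set v : 'rV[R[i]%C]_3 | \sum_j v 0 j = 0].

Definition PX (R : realType) : rspace R :=
  @subspace R (CP R 2) [set L : proj_pt R[i]%C 2 |
    forall v : 'rV[R[i]%C]_3, v \in pline L -> \sum_j v 0 j = 0].

Definition TT (R : realType) : rspace R :=
  @subspace R (power_space 3 (Rpi_space R))
    [set tau : 'I_3 -> Rpi R | \sum_j tau j = 0].

(* Positions of the real and imaginary parts of the j-th side in
   [a_1, a_2, b_1, b_2, c_1, c_2]. *)
Definition re_pos (j : 'I_3) : 'I_6 := inord j.*2.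
Definition im_pos (j : 'I_3) : 'I_6 := inord j.*2.+1.

Definition realify (R : realType) (v : 'rV[R[i]%C]_3) : 'rV[R]_6 :=
  \row_(k < 6) (let z := v 0 (inord k./2) in
                if odd k then complex.Im z else complex.Re z).

Definition complexify (R : realType) (w : 'rV[R]_6) : 'rV[R[i]%C]_3 :=
  \row_(j < 3) (w 0 (re_pos j) +i* w 0 (im_pos j))%C.

Definition triangle_ambient (R : realType) : rspace R :=
  prod_space (prod_space (prod_space (C0 R) (XX R)) (RP R 5))
    (power_space 3 (Rpi_space R)).

(* The conditions on w are invariant under scaling, so it does not matter which
   representative of p is taken. *)
Definition triangles (R : realType) : set (triangle_ambient R) :=
  [set t : C0 R * XX R * RP R 5 * ('I_3 -> Rpi R) |
    let: (_, abc, p, xi) := t in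
    exists w : 'rV[R]_6,
      [/\ hcoord p w,
          \val abc != 0 -> hcoord p (realify (\val abc)),
          \val abc = 0 -> \sum_j w 0 (re_pos j) = 0 /\ \sum_j w 0 (im_pos j) = 0 &
          forall j : 'I_3, complexify w 0 j != 0 ->
            xi j = Arg_pi (w 0 (re_pos j)) (w 0 (im_pos j))]].

Definition class_ambient (R : realType) : rspace R :=
  prod_space (PX R) (TT R).

(* Indices are modulo 3: the angles are
   (xi_b - xi_c, xi_c - xi_a, xi_a - xi_b). *)
Definition similarity_class (R : realType) (t : triangle_ambient R)
  (c : class_ambient R) : Prop :=
  let: (_, _, p, xi) := t in
  (exists w : 'rV[R]_6, hcoord p w /\ hcoord (\val c.1) (complexify w)) /\
  forall j : 'I_3, \val c.2 j = xi (j + 1) - xi (j + 2%:R).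

Definition triangle_classes (R : realType) : set (class_ambient R) :=
  [set c | exists t : triangle_ambient R, triangles t /\ similarity_class t c].

Definition triangle_space (R : realType) : rspace R := subspace (@triangles R).

Definition class_space (R : realType) : rspace R :=
  subspace (@triangle_classes R).

(** ** The blowup structures *)

Definition row3 (R : realType) (a b c : R[i]%C) : 'rV[R[i]%C]_3 :=
  \row_(j < 3) nth 0 [:: a; b; c] j.

Definition class_centers (R : realType) : set (PX R) :=
  [set L | [\/ hcoord (\val L) (row3 0 1 (-1)),
               hcoord (\val L) (row3 1 0 (-1)) |
               hcoord (\val L) (row3 1 (-1) 0)]].

Definition class_blowdown (R : realType) (d : class_space R) : PX R :=
  (\val d).1.

Definition class_space_is_blowup (R : realType) : Prop :=
  is_blowup (@class_blowdown R) (@class_centers R).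

Definition triangle_center (R : realType) : set (prod_space (C0 R) (XX R)) :=
  [set z : C0 R * XX R | \val z.2 = 0].

Definition triangle_abc0 (R : realType) : set (prod_space (C0 R) (XX R)) :=
  [set z : C0 R * XX R | \prod_j \val z.2 0 j = 0].

Definition triangle_blowdown (R : realType) (t : triangle_space R) :
  prod_space (C0 R) (XX R) := (\val t).1.1.

Definition triangle_space_is_iterated_blowup (R : realType) : Prop :=
  exists (Y : rvar R) (pr1 : Y -> prod_space (C0 R) (XX R))
         (pr2 : triangle_space R -> Y),
    [/\ is_blowup pr1 (@triangle_center R),
        is_blowup pr2 (strict_transform pr1 (@triangle_center R)
                         (@triangle_abc0 R)) &
        forall t, pr1 (pr2 t) = triangle_blowdown t].

Definition class_families (R : realType) : presheaf R :=
  families (@triangle_classes R).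

Definition triangle_families (R : realType) : presheaf R :=
  families (@triangles R).

(* Main.v *)
Require Import Defs.
From mathcomp Require Import all_boot all_order all_algebra reals.
From mathcomp Require Import ring_quotient complex boolp classical_sets trigo.
From mathcomp Require Import ring lra.
From mathcomp.multinomials Require mpoly.
Import Defs.
Import (canonicals) mpoly.

(** Both moduli statements are formal: a morphism into the ambient space with
    image in [S] is the same thing as a morphism into the subspace [S].  The
    content is that [class_space] and [triangle_space] are smooth varieties and
    have the stated blowup structures.

    Angles mod pi are handled through [e2 : R/pi -> C], [t |-> exp (2 i t)], so
    that [e2 (Arg z)] is [dir z = z / conj z].  All spaces involved then carry
    global regular functions, the real and imaginary parts of rational
    expressions in complex coordinates and their conjugates, which generate the
    structure and separate points.

    The real blowup of C at 0 is the surface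
    [M = {(z, t) in C x R/pi | conj z * e2 t = z}], covered by two copies of
    R^2, namely [(u, n) |-> k u (1 + i n)] for [k = 1, i].  Where the sides j+1
    and j+2 of a triangle do not vanish, let z be the ratio of the sides j and
    j+1, so that the sides are proportional to [(z, 1, -1-z)] and [z != -1].  On
    this locus similarity classes are the points of M with [z != -1]; the first
    blowup of [C0 x X] is C x M x {z != -1}, where M records the side j+1 and its
    direction; and triangles are C x M x {(z, t) in M | z != -1}.  The three
    loci, for j = 0, 1, 2, cover everything, the center of the blowup is
    [z = 0], and its ideal is generated by [Re z] and [Im z] because setting
    [z = 0] is a retraction onto it. *)

Set Implicit Arguments.
Unset Strict Implicit.
Unset Printing Implicit Defensive.

Import Order.TTheory GRing.Theory Num.Theory.
Local Open Scope classical_set_scope.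
Local Open Scope ring_scope.

(** * Morphisms and regular functions *)

Section Spaces.
Variable R : realType.
Implicit Types X Y Z : rspace R.

(** Over the reals a sum of squares vanishes only when all its terms do, so projective spaces behave
    like affine ones: the entries of the orthogonal projector onto a line are regular everywhere and
    determine the line. This is why globally defined functions suffice and why morphisms into each
    space are recognized by finitely many of them.

    A blowup is defined through a Zariski closure, where no limits are available. Points are kept
    out of the closure by closed equations; they are shown to lie in it by polynomial curves leaving
    the center in every direction, because a Zariski neighbourhood of 0 on the line contains nonzero
    points.

    Generating an ideal sheaf is a statement about all regular functions, known only as local
    quotients. The retraction reduces it to generators: differing from one's pullback by an element
    of the ideal is a property that survives sums and products.

    A line in C has no regular choice of unit vector, only one up to sign. Expressions of even
    degree in such a vector are regular, whence the doubled angle and the two families of products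
    of sides, plain and Hermitian. *)

Lemma zopen_local X (W : set X) :
  (forall x, W x -> exists V, [/\ zopen V, V x & V `<=` W]) -> zopen W.
Proof.
move=> H; have -> : W = \bigcup_(U in [set U | zopen U /\ U `<=` W]) U.
  apply/seteqP; split=> [x /H[V [oV Vx VW]]|x [V [_ VW] Vx]]; last exact: VW.
  by exists V.
by apply: zopen_bigcup => U [].
Qed.

Lemma zclosure_closed X (A : set X) : zclosed (zclosure A).
Proof.
apply: zopen_local => x nAx.
have /existsNP[U /not_implyP[oU /not_implyP[Ux nU]]] := nAx.
by exists U; split=> // y Uy Ay; apply: nU; apply: Ay.
Qed.

Lemma sub_zclosure X (A : set X) : A `<=` zclosure A.
Proof. by move=> x Ax U _ Ux; exists x. Qed.

Lemma zclosure_min X (A B : set X) : zclosed B -> A `<=` B -> zclosure A `<=` B.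
Proof.
move=> cB AB x Ax; apply: contrapT => nBx.
by have [y [/AB By nBy]] := Ax _ cB nBx.
Qed.

Lemma genring_pull X (T : Type) (G : set T -> (T -> R) -> Prop) (f : X -> T) :
  (forall U g, G U g -> zopen (f @^-1` U) /\ regular (f @^-1` U) (g \o f)) ->
  forall U g, genring G U g -> zopen (f @^-1` U) /\ regular (f @^-1` U) (g \o f).
Proof.
move=> H U g; elim=> {U g} [U g /H //|c|U V p q _ [oU rp] _ [oV rq]|
  U V p q _ [oU rp] _ [oV rq]].
- by split; [exact: zopenT|apply: regular_cst; exact: zopenT].
- have oUV : zopen (f @^-1` (U `&` V)) by exact: zopenI.
  split=> //; apply: regularD => //.
  + by apply: (regular_sub oU oUV _ rp) => x [].
  + by apply: (regular_sub oV oUV _ rq) => x [].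
- have oUV : zopen (f @^-1` (U `&` V)) by exact: zopenI.
  split=> //; apply: regularM => //.
  + by apply: (regular_sub oU oUV _ rp) => x [].
  + by apply: (regular_sub oV oUV _ rq) => x [].
Qed.

(** Open sets and regular functions of a generated structure are described locally by polynomial
    expressions in the generators, and pullback commutes with these, so a morphism is tested on
    generators alone. *)
Lemma morph_generated X (T : Type) (G : set T -> (T -> R) -> Prop) (f : X -> T) :
  (forall U g, G U g -> zopen (f @^-1` U) /\ regular (f @^-1` U) (g \o f)) ->
  @is_morphism R X (generated G) f.
Proof.
move=> /genring_pull H V oV.
have oV' : zopen (f @^-1` V).
  apply: zopen_local => x Vx; have [U [q [Gq Ux qx UV]]] := oV _ Vx.
  have [oU rq] := H _ _ Gq.
  exists [set x | (f @^-1` U) x /\ (q \o f) x != 0].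
  by split=> //; [exact: zopen_neq0|move=> y [Uy qy]; apply: UV].
split=> // g rg; apply: regular_glue => // x Vx.
have [A [B [p [q [Gp Gq [Ax Bx] qx E]]]]] := rg _ Vx.
have [oA rp] := H _ _ Gp; have [oB rq] := H _ _ Gq.
pose C := [set x | (f @^-1` B) x /\ (q \o f) x != 0].
have oC : zopen C by exact: zopen_neq0.
have oAC : zopen ((f @^-1` A) `&` C) by exact: zopenI.
have oN : zopen ((f @^-1` V) `&` ((f @^-1` A) `&` C)) by exact: zopenI.
exists ((f @^-1` V) `&` ((f @^-1` A) `&` C)); split=> //.
apply: (@regular_eq _ _ _ (fun x => (p \o f) x * ((q \o f) x)^-1)) => //.
  by move=> y [Vy [Ay [By qy]]]; rewrite /= E.
apply: regularM => //.
- by apply: (regular_sub oA oN _ rp) => y [_ []].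
- by apply: (regular_sub oC oN) (regularV oB rq) => y [_ []].
Qed.

Lemma gen_regularG (T : Type) (G : set T -> (T -> R) -> Prop) U g :
  G U g -> zopen (U : set (generated G)) /\ regular (U : set (generated G)) g.
Proof.
move=> GUg; split.
  (* Constants are generated only on [setT]; adding [0 * g] gives the constant 1 with domain U, and
     its nonvanishing locus is U. *)
  move=> x Ux; exists (U `&` setT), (fun x => 0 * g x + 1); split=> //.
  - have -> : U `&` setT = (setT `&` U) `&` setT by rewrite setTI.
    apply: genring_add; last exact: genring_cst.
    apply: genring_mul; [exact: genring_cst|exact: genring_base].
  - by rewrite mul0r add0r oner_eq0.
  - by move=> y [].
move=> x Ux; exists U, setT, g, (fun=> 1).
split=> //; [exact: genring_base|exact: genring_cst|exact: oner_neq0|].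
by move=> y *; rewrite divr1.
Qed.

Lemma morph_comp X Y Z (g : Y -> Z) (f : X -> Y) :
  is_morphism g -> is_morphism f -> is_morphism (fun x => g (f x)).
Proof. exact: comp_is_morphism. Qed.

Lemma morph_eq X Y (f g : X -> Y) :
  f =1 g -> is_morphism f -> is_morphism g.
Proof. by move=> /funext ->. Qed.

Lemma morph_cst X Y (y : Y) : is_morphism (fun _ : X => y).
Proof.
move=> V oV; have oV' : zopen ((fun _ : X => y) @^-1` V).
  apply: zopen_local => x Vy; exists setT; split=> //; exact: zopenT.
by split=> // g _; exact: regular_cst.
Qed.

Lemma morph_pullback X Y (T : Type) (phi : T -> Y) (f : X -> T) U g :
  is_morphism (fun x => phi (f x)) -> pullback_gens phi U g ->
  zopen (f @^-1` U) /\ regular (f @^-1` U) (g \o f).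
Proof. by move=> mf [V [h [oV rh -> ->]]]; have [? /(_ _ rh)] := mf _ oV. Qed.

Lemma morph_sub X Y (S : set Y) (f : X -> subspace S) :
  is_morphism (fun x => \val (f x) : Y) -> is_morphism f.
Proof. by move=> mf; apply: morph_generated => U g; apply: morph_pullback. Qed.

Lemma morph_prod X Y Z (f : X -> prod_space Y Z) :
  is_morphism (fun x => (f x).1 : Y) -> is_morphism (fun x => (f x).2 : Z) ->
  is_morphism f.
Proof.
by move=> m1 m2; apply: morph_generated => U g []; apply: morph_pullback.
Qed.

Lemma morph_power X Y n (f : X -> power_space n Y) :
  (forall j, is_morphism (fun x => f x j : Y)) -> is_morphism f.
Proof.
by move=> mf; apply: morph_generated => U g [j]; apply: morph_pullback.
Qed.

Lemma morph_gen_proj Y (T : Type) (phi : T -> Y) (G : set T -> (T -> R) -> Prop) :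
  (forall U g, pullback_gens phi U g -> G U g) ->
  @is_morphism R (generated G) Y phi.
Proof.
move=> H V oV; split.
  apply: (@gen_regularG _ G _ ((fun=> 1) \o phi) _).1; apply: H.
  by exists V, (fun=> 1); split=> //; exact: regular_cst.
by move=> g rg; apply: (@gen_regularG _ G _ _ _).2; apply: H; exists V, g.
Qed.

Lemma morph_val X (S : set X) : @is_morphism R (subspace S) X (fun x => \val x).
Proof. exact: morph_gen_proj. Qed.

Lemma morph_fst X Y : @is_morphism R (prod_space X Y) X (fun z => z.1).
Proof. by apply: morph_gen_proj => U g; left. Qed.

Lemma morph_snd X Y : @is_morphism R (prod_space X Y) Y (fun z => z.2).
Proof. by apply: morph_gen_proj => U g; right. Qed.

Lemma morph_proj n X (j : 'I_n) :
  @is_morphism R (power_space n X) X (fun z => z j).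
Proof. by apply: morph_gen_proj => U g; exists j. Qed.

Definition insp X (A : set X) (x : X) (Ax : A x) : subspace A :=
  SigSub (mem_set Ax).

Lemma insp_inj X (A : set X) (x y : subspace A) : \val x = \val y :> X -> x = y.
Proof. exact: val_inj. Qed.

End Spaces.

(** * Rings of real functions and their complex-valued functions *)

Section FunRing.
Variables (R : realType) (T : Type) (A : (T -> R) -> Prop).
Notation C := (R[i]%C).

(** Abstract, so that complex arithmetic is checked once and serves both for regular functions on a
    space and for polynomial functions on R^n. *)
Definition fun_ring := [/\ forall c, A (fun=> c),
  forall f g, A f -> A g -> A (fun x => f x + g x) &
  forall f g, A f -> A g -> A (fun x => f x * g x)].

Definition cfun (f : T -> C) :=
  A (fun x => complex.Re (f x)) /\ A (fun x => complex.Im (f x)).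

Hypothesis Aring : fun_ring.

Let A_eq f g : f =1 g -> A f -> A g. Proof. by move=> /funext ->. Qed.

Lemma funN f : A f -> A (fun x => - f x).
Proof.
move=> Af; have [Ac _ AM] := Aring.
by apply: A_eq (AM _ _ (Ac (-1)) Af) => x; rewrite mulN1r.
Qed.

Lemma cfun_cst c : cfun (fun=> c).
Proof. by have [Ac _ _] := Aring; split; apply: Ac. Qed.

Lemma cfunD f g : cfun f -> cfun g -> cfun (fun x => f x + g x).
Proof.
have [_ AD _] := Aring; move=> [f1 f2] [g1 g2]; split.
- by apply: A_eq (AD _ _ f1 g1) => x; case: (f x) => ? ?; case: (g x).
- by apply: A_eq (AD _ _ f2 g2) => x; case: (f x) => ? ?; case: (g x).
Qed.

Lemma cfunN f : cfun f -> cfun (fun x => - f x).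
Proof.
by move=> [f1 f2]; split; [apply: A_eq (funN f1)|apply: A_eq (funN f2)] => x;
  case: (f x).
Qed.

Lemma cfunM f g : cfun f -> cfun g -> cfun (fun x => f x * g x).
Proof.
have [_ AD AM] := Aring; move=> [f1 f2] [g1 g2]; split.
- apply: A_eq (AD _ _ (AM _ _ f1 g1) (funN (AM _ _ f2 g2))) => x.
  by case: (f x) => ? ?; case: (g x).
- apply: A_eq (AD _ _ (AM _ _ f1 g2) (AM _ _ f2 g1)) => x.
  by case: (f x) => ? ?; case: (g x).
Qed.

Lemma cfun_conj f : cfun f -> cfun (fun x => (f x)^*%C).
Proof.
by move=> [f1 f2]; split; [apply: A_eq f1|apply: A_eq (funN f2)] => x;
  case: (f x).
Qed.

Lemma cfun_real f : A f -> cfun (fun x => (f x)%:C%C).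
Proof. by move=> Af; split => //; have [Ac _ _] := Aring; apply: Ac. Qed.

Lemma cfun_sum (I : Type) (s : seq I) (P : pred I) (f : I -> T -> C) :
  (forall i, cfun (f i)) -> cfun (fun x => \sum_(i <- s | P i) f i x).
Proof.
move=> cf; elim: s => [|i s IH].
  by under eq_fun do rewrite big_nil; apply: cfun_cst.
under eq_fun do rewrite big_cons.
by case: (P i) => //; apply: cfunD.
Qed.

End FunRing.

(** * Globally regular functions, real and complex *)

Section Regular.
Variable R : realType.
Notation C := (R[i]%C).
Implicit Types X Y Z : rspace R.

Definition reg X (f : X -> R) := regular setT f.
Definition creg X (f : X -> C) := cfun (@reg X) f.

Lemma reg_ring X : fun_ring (@reg X).
Proof.
have oT := zopenT X.
split=> [c|f g|f g]; [exact: regular_cst|exact: regularD|exact: regularM].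
Qed.

Lemma reg_eq X (f g : X -> R) : f =1 g -> reg f -> reg g.
Proof. by move=> /funext ->. Qed.

Lemma creg_eq X (f g : X -> C) : f =1 g -> creg f -> creg g.
Proof. by move=> /funext ->. Qed.

Lemma reg_cst X c : reg (fun _ : X => c). Proof. by case: (reg_ring X). Qed.
Lemma regD X (f g : X -> R) : reg f -> reg g -> reg (fun x => f x + g x).
Proof. by case: (reg_ring X) => _ + _; apply. Qed.
Lemma regM X (f g : X -> R) : reg f -> reg g -> reg (fun x => f x * g x).
Proof. by case: (reg_ring X) => _ _; apply. Qed.
Lemma regN X (f : X -> R) : reg f -> reg (fun x => - f x).
Proof. exact: (funN (reg_ring X)). Qed.
Lemma regV X (f : X -> R) : reg f -> (forall x, f x != 0) ->
  reg (fun x => (f x)^-1).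
Proof.
move=> rf f0; have := regularV (zopenT X) rf.
by have -> : [set x | setT x /\ f x != 0] = setT by apply/seteqP; split.
Qed.

Lemma creg_cst X c : creg (fun _ : X => c). Proof. exact: cfun_cst (reg_ring X) c. Qed.
Lemma cregD X (f g : X -> C) : creg f -> creg g -> creg (fun x => f x + g x).
Proof. exact: (cfunD (reg_ring X)). Qed.
Lemma cregM X (f g : X -> C) : creg f -> creg g -> creg (fun x => f x * g x).
Proof. exact: (cfunM (reg_ring X)). Qed.
Lemma cregN X (f : X -> C) : creg f -> creg (fun x => - f x).
Proof. exact: (cfunN (reg_ring X)). Qed.
Lemma creg_conj X (f : X -> C) : creg f -> creg (fun x => (f x)^*%C).
Proof. exact: (cfun_conj (reg_ring X)). Qed.
Lemma creg_real X (f : X -> R) : reg f -> creg (fun x => (f x)%:C%C).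
Proof. exact: (cfun_real (reg_ring X)). Qed.
Lemma creg_sum X (I : Type) (s : seq I) (P : pred I) (f : I -> X -> C) :
  (forall i, creg (f i)) -> creg (fun x => \sum_(i <- s | P i) f i x).
Proof. exact: (cfun_sum (reg_ring X)). Qed.

Lemma invc_parts (z : C) :
  z^-1 = ((complex.Re z / (complex.Re z ^+ 2 + complex.Im z ^+ 2)) -i*
          (complex.Im z / (complex.Re z ^+ 2 + complex.Im z ^+ 2)))%C.
Proof. by case: z. Qed.

Lemma sqr_norm_eq0 (z : C) :
  (complex.Re z ^+ 2 + complex.Im z ^+ 2 == 0) = (z == 0).
Proof.
case: z => a b; rewrite eq_complex /= paddr_eq0 ?sqr_ge0 // !sqrf_eq0 //.
Qed.

(** The real denominator Re^2 + Im^2 is regular and vanishes only where f does. *)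
Lemma cregV X (f : X -> C) : creg f -> (forall x, f x != 0) ->
  creg (fun x => (f x)^-1).
Proof.
move=> [f1 f2] f0.
have rV : reg (fun x => (complex.Re (f x) ^+ 2 + complex.Im (f x) ^+ 2)^-1).
  apply: regV => [|x]; last by rewrite sqr_norm_eq0.
  by apply: regD; apply: regM.
split.
- by apply: reg_eq (regM f1 rV) => x; rewrite invc_parts.
- by apply: reg_eq (regN (regM f2 rV)) => x; rewrite invc_parts.
Qed.

Lemma reg_comp X Y (g : Y -> R) (f : X -> Y) :
  is_morphism f -> reg g -> reg (fun x => g (f x)).
Proof. by move=> mf rg; have [_ H] := mf _ (zopenT Y); exact: (H g rg). Qed.

Lemma creg_comp X Y (g : Y -> C) (f : X -> Y) :
  is_morphism f -> creg g -> creg (fun x => g (f x)).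
Proof. by move=> mf [g1 g2]; split; [exact: (reg_comp mf g1)|exact: (reg_comp mf g2)]. Qed.

Lemma open_reg X (f : X -> R) : reg f -> zopen [set x | f x != 0].
Proof.
move=> rf; have := zopen_neq0 (zopenT X) rf.
by congr zopen; apply/seteqP; split=> x // [].
Qed.

Lemma zopenU X (U V : set X) : zopen U -> zopen V -> zopen (U `|` V).
Proof.
move=> oU oV; apply: zopen_local => x [Ux|Vx].
  by exists U; split=> // y; left.
by exists V; split=> // y; right.
Qed.

Lemma open_creg X (f : X -> C) : creg f -> zopen [set x | f x != 0].
Proof.
move=> [f1 f2]; have := zopenU (open_reg f1) (open_reg f2).
congr zopen; apply/seteqP; split=> x /=; rewrite eq_complex negb_and.
  by case=> ->; rewrite ?orbT.
by move=> /orP[]; [left|right].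
Qed.

Lemma open_preim X Y (f : X -> Y) (U : set Y) :
  is_morphism f -> zopen U -> zopen (f @^-1` U).
Proof. by move=> mf /mf[]. Qed.

Lemma closed_creg X (f : X -> C) : creg f -> zclosed [set x | f x = 0].
Proof.
move=> /open_creg; rewrite /zclosed; congr zopen.
by apply/seteqP; split=> x /=; [move/eqP|move=> /eqP].
Qed.

Lemma zclosedI X (A B : set X) : zclosed A -> zclosed B -> zclosed (A `&` B).
Proof. by rewrite /zclosed setCI; apply: zopenU. Qed.

Lemma zclosed_forall X (I : finType) (A : I -> set X) :
  (forall i, zclosed (A i)) -> zclosed [set x | forall i, A i x].
Proof.
move=> cA; apply: zopen_local => x /existsNP[i nAx].
by exists (~` A i); split; [exact: cA|by []|move=> y nAy /(_ i)].
Qed.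

(** If f separates x and y, the locus [f z.1 - f z.2 != 0] is a neighbourhood of (x, y) that misses
    the diagonal. *)
Lemma separated_creg X :
  (forall x y : X, x <> y -> exists f : X -> C, creg f /\ f x != f y) ->
  separated X.
Proof.
move=> H; apply: zopen_local => -[x y] /= /H[f [cf fxy]].
exists [set z : X * X | f z.1 - f z.2 != 0]; split=> /=.
- apply: (@open_creg (prod_space X X) (fun z => f z.1 - f z.2)).
  apply: cregD; first exact: creg_comp (@morph_fst _ X X) cf.
  by apply: cregN; exact: creg_comp (@morph_snd _ X X) cf.
- by rewrite subr_eq0.
- by move=> [a b] /=; rewrite subr_eq0 => /eqP fab ab; apply: fab; rewrite ab.
Qed.

(** The two notions of regularity on an open U agree: this direction goes from the subspace
    structure back to the sheaf of X, and [reg_subspace] is the other one. *)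
Lemma regular_subspace_open X (U : set X) (h : subspace U -> R) (H : X -> R) :
  zopen U -> reg h -> (forall y, H (\val y) = h y) -> regular U H.
Proof.
move=> oU rh E; apply: regular_glue => // x Ux.
have [A [B [p [q [Gp Gq [Ax Bx] qx F]]]]] := rh (insp Ux) I.
(* Every polynomial expression in restricted functions is itself the restriction of one regular
   function on one open set of X. *)
have pull (V : set (set_type U)) (s : set_type U -> R) :
  genring (pullback_gens (fun x : set_type U => \val x : X)) V s ->
  exists (V' : set X) (s' : X -> R), [/\ zopen V', regular V' s',
    V = (fun x => \val x) @^-1` V' & forall y, s y = s' (\val y)].
  elim=> {V s} [V s [V' [s' [oV' rs' -> ->]]]|c|V1 V2 s1 s2 _ [W1 [t1 [o1 r1 -> e1]]]
    _ [W2 [t2 [o2 r2 -> e2]]]|V1 V2 s1 s2 _ [W1 [t1 [o1 r1 -> e1]]]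
    _ [W2 [t2 [o2 r2 -> e2]]]].
  - by exists V', s'.
  - by exists setT, (fun=> c); split=> //; [exact: zopenT|apply: regular_cst; exact: zopenT].
  - have o12 := zopenI o1 o2.
    exists (W1 `&` W2), (fun x => t1 x + t2 x); split=> //; last first.
      by move=> y; rewrite e1 e2.
    by apply: regularD => //;
      [apply: (regular_sub o1 o12 _ r1)|apply: (regular_sub o2 o12 _ r2)] => ? [].
  - have o12 := zopenI o1 o2.
    exists (W1 `&` W2), (fun x => t1 x * t2 x); split=> //; last first.
      by move=> y; rewrite e1 e2.
    by apply: regularM => //;
      [apply: (regular_sub o1 o12 _ r1)|apply: (regular_sub o2 o12 _ r2)] => ? [].
have [A' [p' [oA rp eA ep]]] := pull _ _ Gp.
have [B' [q' [oB rq eB eq]]] := pull _ _ Gq.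
pose B2 := [set x | B' x /\ q' x != 0].
have oB2 : zopen B2 by exact: zopen_neq0.
have o1 := zopenI oA oB2.
have o2 := zopenI oU o1.
exists (U `&` (A' `&` B2)); split=> //.
  split=> //; split; first by rewrite eA in Ax.
  by rewrite eB in Bx; split=> //; rewrite eq in qx.
apply: (@regular_eq _ _ _ (fun x => p' x * (q' x)^-1)) => //.
  move=> y [Uy [A'y [B'y qy]]].
  have := F (insp Uy) I; rewrite -E /= ep eq /= => -> //.
  - by rewrite eA.
  - by rewrite eB.
apply: regularM => //.
- by apply: (regular_sub oA o2 _ rp) => y [_ []].
- by apply: (regular_sub oB2 o2) (regularV oB rq) => y [_ []].
Qed.

Lemma reg_subspace X (U : set X) (f : X -> R) :
  zopen U -> regular U f -> @reg (subspace U) (fun x => f (\val x)).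
Proof.
move=> oU rf; have [_ /(_ _ rf)] := @morph_val R X U _ oU.
rewrite /reg; congr regular.
by apply/seteqP; split=> // x _; exact: val_in.
Qed.

End Regular.

(** Descends through field operations, conjugation and sums; what remains is the regularity of atoms
    absent from the context and the nonvanishing of denominators. *)
Ltac cregs := repeat (first [ assumption |
  lazymatch goal with
  | |- creg (fun _ => ?c) => exact: creg_cst
  | |- creg (fun x => @?f x + @?g x) => apply: (@cregD _ _ f g)
  | |- creg (fun x => @?f x * @?g x) => apply: (@cregM _ _ f g)
  | |- creg (fun x => - @?f x) => apply: (@cregN _ _ f)
  | |- creg (fun x => (@?f x)^*%C) => apply: (@creg_conj _ _ f)
  | |- creg (fun x => (@?f x)^-1) => apply: (@cregV _ _ f)
  | |- creg (fun x => \sum_(i <- _ | _) (@?f x i)) =>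
      apply: (@creg_sum _ _ _ _ _ (fun i x => f x i)) => ?
  end ]).

(** * Families as morphisms into a subspace *)

Section Moduli.
Variables (R : realType) (A : rspace R) (S : set A).

Definition classifying_fun (B : rvar R) (f : family S B) (b : B) : subspace S :=
  insp (family_in f b).

Lemma classifying_morph (B : rvar R) (f : family S B) :
  is_morphism (classifying_fun f).
Proof. by apply: morph_sub; apply: homP. Qed.

Lemma fine_moduli_subspace (hS : smooth_variety (subspace S)) :
  fine_moduli_space (M := RVar hS) (F := families S) (tautological_family hS).
Proof.
(* [K1] and [K2] say that classifying a family and pulling back the tautological one are mutually
   inverse; representability and universality are both read off from them. *)
have K1 (B : rvar R) (f : family S B) :
    family_pullback (Hom (classifying_morph f) : hom B (RVar hS))
      (tautological_family hS) = f by exact: family_ext.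
have K2 (B : rvar R) (m : hom B (RVar hS)) :
    Hom (classifying_morph (family_pullback m (tautological_family hS))) = m
      :> hom B (RVar hS).
  by apply: hom_ext => b; apply: insp_inj.
split.
  exists (fun B m => family_pullback m (tautological_family hS)); split.
  - move=> B; exists (fun f => Hom (classifying_morph f) : hom B (RVar hS)).
      by move=> m; exact: K2.
    exact: K1.
  - by move=> B C m h; apply: family_ext.
  - exact: family_ext.
move=> B f; exists (Hom (classifying_morph f)); split; first exact/esym/K1.
by move=> m fm; rewrite -[RHS]K2; apply: hom_ext => b; rewrite fm.
Qed.

End Moduli.

(** * Test curves for Zariski closures *)

Section Line.
Variable R : realType.

Definition real_line : rspace R :=
  generated (fun (U : set R) f => U = setT /\ f = id).

Lemma reg_real_line : reg (id : real_line -> R).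
Proof. by apply: (gen_regularG _).2. Qed.

(** W contains the nonvanishing locus of a polynomial that is nonzero at 0, and such a polynomial
    has finitely many roots. *)
Lemma real_line_nbhd0 (W : set real_line) :
  zopen W -> W 0 -> exists t : R, t != 0 /\ W t.
Proof.
move=> oW /oW[U [q [Gq Ux q0 qW]]].
have [p [UT pq]] : exists p : {poly R}, U = setT /\ forall t, q t = p.[t].
  elim: Gq {Ux q0 qW} => {U q} [U q [-> ->]|c|U V f g _ [p [-> pf]] _ [s [-> chart_sign]]|
    U V f g _ [p [-> pf]] _ [s [-> chart_sign]]].
  - by exists 'X; split=> // t; rewrite hornerX.
  - by exists c%:P; split=> // t; rewrite hornerC.
  - by exists (p + s); split=> [|t]; rewrite ?setIT // hornerD pf chart_sign.
  - by exists (p * s); split=> [|t]; rewrite ?setIT // hornerM pf chart_sign.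
have p0 : p != 0 by apply: contraNneq q0 => E; rewrite pq E horner0.
(* The integers 1, ..., [size p] are nonzero, and one more than the degree of p, so they cannot all
   be roots. *)
pose s : seq R := [seq i.+1%:R | i <- iota 0 (size p)].
have us : uniq s by rewrite map_inj_uniq ?iota_uniq // => i j /eqP; rewrite eqr_nat => /eqP[].
have /allPn[_ /mapP[i _ ->] nr] : ~~ all (root p) s.
  apply/negP => rs; have := max_poly_roots p0 rs us.
  by rewrite size_map size_iota ltnn.
exists i.+1%:R; split; first by rewrite pnatr_eq0.
by apply: qW; rewrite ?UT // pq.
Qed.

(** Plays the role of a limit t -> 0: if the curve lies in A for all nonzero t with [g t] in W, then
    [g 0] cannot be separated from A by W. *)
Lemma curve_nbhd0 (X : rspace R) (g : real_line -> X) (W : set X) :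
  is_morphism g -> zopen W -> W (g 0) -> exists t : R, t != 0 /\ W (g t).
Proof. by move=> mg oW; apply: (@real_line_nbhd0 (g @^-1` W)); apply: open_preim. Qed.

End Line.

(** * The ideal of a retract *)

Section Retraction.
Variables (R : realType) (X : rspace R) (Z U : set X) (k : nat).
Variables (f : 'I_k -> X -> R) (r : subspace U -> subspace U).
Hypotheses (oU : zopen U) (rf : forall i, regular U (f i)).
Hypothesis rZ : forall y, Z (\val y) -> r y = y.
Hypothesis Zr : forall y, Z (\val (r y)).
Hypothesis fZ : forall i x, U x -> Z x -> f i x = 0.
Hypothesis Zf : forall x, U x -> (forall i, f i x = 0) -> Z x.

(* Functions on U congruent modulo the ideal (f_i) to their pullback along the
   retraction r of U onto Z. *)
Definition retr_cong (g : subspace U -> R) :=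
  [/\ reg g, reg (fun y => g (r y)) &
      exists h : 'I_k -> subspace U -> R, (forall i, reg (h i)) /\
        forall y, g y - g (r y) = \sum_i h i y * f i (\val y)].

(** A structure on U with possibly fewer regular functions. If the inclusion into X is still a
    morphism from it, then every regular function on an open set of X becomes, within U, locally a
    quotient of congruent functions. *)
Definition retr_space : rspace R :=
  generated (fun (V : set (subspace U)) g => V = setT /\ retr_cong g).

Lemma retr_congP g : retr_cong g -> @reg _ retr_space g.
Proof. by move=> H; apply: (gen_regularG _).2. Qed.

Lemma retr_cong_fix g : reg g -> (forall y, g (r y) = g y) -> retr_cong g.
Proof.
move=> rg E; split=> //; first by rewrite (funext E).
exists (fun _ _ => 0); split=> [i|y]; first exact: reg_cst.
by rewrite E subrr big1 // => i; rewrite mul0r.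
Qed.

Lemma retr_cong_gen i : retr_cong (fun y => f i (\val y)).
Proof.
have fr y : f i (\val (r y)) = 0 by apply: fZ; [exact: val_in|exact: Zr].
split; first exact: reg_subspace.
  by apply: reg_eq (reg_cst _ 0) => y; rewrite fr.
exists (fun j _ => (i == j)%:R); split=> [j|y]; first exact: reg_cst.
rewrite fr subr0 (bigD1 i) //= eqxx mul1r big1 ?addr0 // => j.
by rewrite eq_sym => /negbTE->; rewrite mul0r.
Qed.

(** Congruent functions form a ring, so the numerator and denominator of a local quotient are
    themselves congruent. *)
Lemma genring_retr V g :
  genring (fun (V : set (subspace U)) g => V = setT /\ retr_cong g) V g ->
  V = setT /\ retr_cong g.
Proof.
elim=> {V g} [V g //|c|V W p q _ [-> [p1 p2 [h [rh eh]]]] _ [-> [q1 q2 [l [rl el]]]]|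
  V W p q _ [-> [p1 p2 [h [rh eh]]]] _ [-> [q1 q2 [l [rl el]]]]].
- split=> //; split; [exact: reg_cst|exact: reg_cst|].
  exists (fun _ _ => 0); split=> [i|y]; first exact: reg_cst.
  by rewrite subrr big1 // => i; rewrite mul0r.
- split; first exact: setIT.
  split; [exact: regD|exact: regD|].
  exists (fun i y => h i y + l i y); split=> [i|y]; first exact: regD.
  under eq_bigr do rewrite mulrDl.
  by rewrite big_split /= -eh -el; ring.
- split; first exact: setIT.
  split; [exact: regM|exact: regM|].
  (* From pq - p'q' = (p - p')q + p'(q - q'), where primes denote the pullback along r. *)
  exists (fun i y => h i y * q y + p (r y) * l i y); split=> [i|y].
    by apply: regD; apply: regM.
  under eq_bigr do rewrite mulrDl -mulrA (mulrC (q y)) mulrA -(mulrA (p (r y))).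
  by rewrite big_split /= -mulr_suml -mulr_sumr -eh -el; ring.
Qed.

Definition ext0 (h : subspace U -> R) (x : X) : R :=
  if pselect (U x) is left Ux then h (insp Ux) else 0.

Lemma ext0E h y : ext0 h (\val y) = h y.
Proof.
rewrite /ext0; case: pselect => [Ux|[]]; last exact: val_in.
by congr h; apply: insp_inj.
Qed.

Lemma regular_ext0 h : reg h -> regular U (ext0 h).
Proof. by move=> rh; apply: regular_subspace_open oU rh (ext0E h). Qed.

(** Off Z some f_i is invertible and g = (g / f_i) f_i. Near a point of Z, write g = p / q with p
    and q congruent: since g vanishes on Z, so does the numerator there, that is, p vanishes at r y,
    and p = p - p(r y) lies in the ideal. *)
Lemma generate_ideal_retract :
  @is_morphism R retr_space X (fun y : subspace U => \val y) ->
  generate_ideal Z U f.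
Proof.
move=> mv; split=> // W g oW WU rg gZ x Wx.
have [[i fx]|/forallNP Hf] := pselect (exists i, f i x <> 0).
  pose W' := [set x | U x /\ f i x != 0].
  have oW' : zopen W' by exact: zopen_neq0.
  have oWW := zopenI oW oW'.
  have fx0 : f i x != 0 by apply/eqP.
  exists (W `&` W'), (fun j y => if j == i then g y * (f i y)^-1 else 0).
  split=> //.
  - by split=> //; split=> //; apply: WU.
  - move=> j; case: eqP => [_|_]; last exact: regular_cst.
    apply: regularM => //; first by apply: (regular_sub oW oWW _ rg) => y [].
    by apply: (regular_sub oW' oWW) (regularV oU (rf i)) => y [].
  - move=> y [Wy [_ fy]]; rewrite (bigD1 i) //= eqxx mulfVK // big1 ?addr0 //.
    by move=> j /negbTE->; rewrite mul0r.
have Ux := WU _ Wx.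
have Zx : Z x by apply: Zf => // i; apply: contrapT; apply: Hf.
have rx : r (insp Ux) = insp Ux by exact: rZ.
have [oW1 /(_ _ rg) rg1] := mv _ oW.
have [A [B [p [q [Gp Gq _ qx E]]]]] := rg1 (insp Ux) Wx.
have [D [s [Gs _ sx sW]]] := oW1 (insp Ux) Wx.
have {Gp}[AT [p1 p2 [h [rh eh]]]] := genring_retr Gp.
have {Gq}[BT [q1 q2 _]] := genring_retr Gq.
have {Gs}[DT [s1 s2 _]] := genring_retr Gs.
(* Where u is nonzero the denominator is invertible at y and at r y, and r y lies in W; at x itself
   this holds because r fixes x. *)
pose u y := q y * q (r y) * s (r y).
have ru : reg u by apply: regM => //; apply: regM.
pose W1 := [set x | U x /\ ext0 u x != 0].
pose W2 := [set x | U x /\ ext0 q x != 0].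
have oW1' : zopen W1 by apply: zopen_neq0 => //; apply: regular_ext0.
have oW2 : zopen W2 by apply: zopen_neq0 => //; apply: regular_ext0.
have o1 := zopenI oW oW1'; have o2 := zopenI o1 oW2.
have exE h0 y (Uy : U y) : ext0 h0 y = h0 (insp Uy).
  by rewrite -[in LHS](_ : \val (insp Uy) = y) // ext0E.
exists (W `&` W1 `&` W2), (fun i y => ext0 (h i) y * (ext0 q y)^-1); split=> //.
- split; last by split=> //; rewrite exE.
  by split=> //; split=> //; rewrite exE /u rx !mulf_neq0.
- by move=> y [[]].
- move=> i; apply: regularM => //.
    by apply: (regular_sub oU o2 _ (regular_ext0 (rh i))) => y [[] Wy _ _]; apply: WU.
  by apply: (regular_sub oW2 o2) (regularV oU (regular_ext0 q1)) => y [].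
- move=> y [[Wy [Uy uy]] _]; move: uy; rewrite (exE u y Uy) /u !mulf_eq0 !negb_or.
  set y' := insp Uy => /andP[/andP[qy qry] sry].
  have Wry : W (\val (r y')) by apply: sW; rewrite ?DT.
  have pry : p (r y') = 0.
    have := gZ _ Wry (Zr y').
    have := E (r y'); rewrite AT BT /= => -> //.
    by move=> /eqP; rewrite mulf_eq0 invr_eq0 (negbTE qry) orbF => /eqP.
  have := E y'; rewrite AT BT /= => -> //.
  have := eh y'; rewrite pry subr0 => ->; rewrite mulr_suml.
  by apply: eq_bigr => i _; rewrite !(exE _ y Uy) -/y' mulrAC.
Qed.

End Retraction.

(** * Directions and angles mod pi *)

Section Direction.
Variable R : realType.
Notation C := (R[i]%C).
Implicit Types (z w : C) (t : R).

Lemma conjc_neq0 z : (z^*%C == 0) = (z == 0).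
Proof. by case: z => a b; rewrite !eq_complex /= oppr_eq0. Qed.

Lemma conj_fix_real z : z^*%C = z -> z = (complex.Re z)%:C%C.
Proof.
by case: z => a b /= [] E; have -> : b = 0 by lra.
Qed.

Definition dir z : C := z / z^*%C.

Lemma dirM z w : dir (z * w) = dir z * dir w.
Proof. by rewrite /dir rmorphM invfM mulrACA. Qed.

Lemma dir_real t : t != 0 -> dir t%:C%C = 1.
Proof.
move=> t0; rewrite /dir conjc_real divff //.
by rewrite eq_complex /= eqxx andbT.
Qed.

Lemma dir_neq0 z : z != 0 -> dir z != 0.
Proof. by move=> z0; rewrite mulf_neq0 // invr_eq0 conjc_neq0. Qed.

Lemma dir_unit z : z != 0 -> (dir z)^*%C * dir z = 1.
Proof.
move=> z0; rewrite /dir fmorph_div /= conjcK mulf_div (mulrC z^*%C) divff //.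
by rewrite mulf_neq0 ?conjc_neq0.
Qed.

(** Written without division, the relation also makes sense at z = 0, where it constrains no
    direction; away from 0 it determines the direction by [conj_mul_eq]. *)
Lemma conj_mul_dir z : z^*%C * dir z = z.
Proof.
have [->|z0] := eqVneq z 0; first by rewrite /dir mul0r mulr0.
by rewrite /dir mulrC divfK // conjc_neq0.
Qed.

Lemma conj_mul_eq z (u : C) : z != 0 -> z^*%C * u = z -> u = dir z.
Proof. by move=> z0 E; rewrite /dir -[X in X / _]E mulrC mulKf // conjc_neq0. Qed.

(** The hypothesis says that z / w equals its own conjugate. *)
Lemma real_multiple z w : w != 0 -> z^*%C * dir w = z ->
  exists t, z = t%:C%C * w.
Proof.
move=> w0 E; exists (complex.Re (z / w)); rewrite -conj_fix_real ?divfK //.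
rewrite fmorph_div /= -[in RHS]E /dir.
by rewrite mulrA mulrAC mulfK.
Qed.

Lemma dir_eq z w : z != 0 -> w != 0 -> dir z = dir w ->
  exists t, t != 0 /\ z = t%:C%C * w.
Proof.
move=> z0 w0 E; have [|t zt] := @real_multiple z w w0.
  by rewrite -E conj_mul_dir.
by exists t; split=> //; apply: contraNneq z0 => t0; rewrite zt t0 mul0r.
Qed.

Definition cis2 t : C := (cos (t *+ 2) +i* sin (t *+ 2))%C.

Lemma cis2D s t : cis2 (s + t) = cis2 s * cis2 t.
Proof.
rewrite /cis2 mulrnDl (cosD (s *+ 2)) (sinD (s *+ 2)); apply/eqP; rewrite eq_complex /=.
by rewrite eqxx /= addrC.
Qed.

Lemma cis2N t : cis2 (- t) = (cis2 t)^*%C.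
Proof. by rewrite /cis2 mulNrn cosN sinN. Qed.

Lemma cis2_pi_int (k : int) : cis2 (pi *~ k) = 1.
Proof.
have nat_case (n : nat) : cis2 (pi *+ n) = 1.
  elim: n => [|n IH]; first by rewrite mulr0n /cis2 mul0rn cos0 sin0.
  by rewrite mulrS cis2D IH mulr1 /cis2 cos2pi sin2pi.
case: k => n; first by rewrite -pmulrn nat_case.
by rewrite NegzE mulrNz cis2N -pmulrn nat_case rmorph1.
Qed.

Lemma sin_pi_int (k : int) : sin (pi *~ k) = 0 :> R.
Proof.
have nat_case (n : nat) : sin (pi *+ n) = 0 :> R.
  elim: n => [|n IH]; first by rewrite mulr0n sin0.
  by rewrite mulrS sinD sinpi IH mul0r mulr0 addr0.
case: k => n; first by rewrite -pmulrn nat_case.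
by rewrite NegzE mulrNz sinN -pmulrn nat_case oppr0.
Qed.

(** Reduce t modulo pi to [0, pi[, where the sine is positive except at 0. *)
Lemma sin_eq0_piZ t : sin t = 0 -> exists k : int, t = pi *~ k.
Proof.
move=> st; have pi0 := pi_gt0 R.
pose k := Num.floor (t / pi); exists k.
have /andP[k1 k2] := floor_itv (t / pi).
pose u := t - pi *~ k.
have u0 : 0 <= u by rewrite subr_ge0 -mulrzr mulrC -ler_pdivlMr.
have upi : u < pi.
  by rewrite ltrBlDr -{1}[pi]mulr1z -mulrzDr -mulrzr mulrC -ltr_pdivrMr // addrC.
have spi : sin (pi *~ k) = 0 := sin_pi_int k.
have su : sin u = 0 by rewrite /u sinB st spi mul0r mulr0 subrr.
apply/eqP; rewrite -subr_eq0 -/u; apply/contraT => nz.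
have : 0 < sin u by apply: sin_gt0_pi; rewrite upi andbT lt_def nz.
by rewrite su ltxx.
Qed.

Lemma cis2_eq1 t : cis2 t = 1 -> exists k : int, t = pi *~ k.
Proof.
move=> [+ _]; rewrite cos_mulr2n cos2sin2 => E; apply: sin_eq0_piZ.
by apply/eqP; rewrite -sqrf_eq0; apply/eqP; lra.
Qed.

Definition e2 (x : Rpi R) : C := cis2 (repr x).

(** Two representatives differ by a multiple of pi, on which [cis2] is 1; so the choice made by
    [repr] does not matter. *)
Lemma e2_pi t : e2 (\pi_(Quotient.quot (@piZ R)) t)%qT = cis2 t.
Proof.
rewrite /e2; set s := repr _.
have /eqP : (\pi_(Quotient.quot (@piZ R)) s)%qT = (\pi_(Quotient.quot (@piZ R)) t)%qT.
  by rewrite reprK.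
rewrite -Quotient.idealrBE => /asboolP[k E].
by rewrite -[s](subrK t) cis2D E cis2_pi_int mul1r.
Qed.

Lemma e2_inj : injective e2.
Proof.
move=> x y; rewrite -[x]reprK -[y]reprK !e2_pi => E.
apply/eqP; rewrite -Quotient.idealrBE; apply/asboolP.
apply: cis2_eq1; rewrite cis2D cis2N E -cis2N -cis2D subrr.
by rewrite /cis2 mul0rn cos0 sin0.
Qed.

Lemma e2D x y : e2 (x + y) = e2 x * e2 y.
Proof.
rewrite -[x]reprK -[y]reprK !e2_pi -cis2D -e2_pi; congr e2.
by rewrite -{1}[x]reprK -{1}[y]reprK !piE !reprK.
Qed.

Lemma e20 : e2 0 = 1.
Proof.
have := e2D 0 0; rewrite addr0 => E.
have e0 : e2 0 != 0.
  by rewrite /e2 -sqr_norm_eq0 /= cos2Dsin2 oner_neq0.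
by apply: (mulfI e0); rewrite mulr1 -E.
Qed.

Lemma e2_neq0 x : e2 x != 0.
Proof.
apply/eqP => E; have := e2D x (- x); rewrite subrr e20 E mul0r => /eqP.
by rewrite oner_eq0.
Qed.

Lemma e2N x : e2 (- x) = (e2 x)^-1.
Proof. by apply: (mulfI (e2_neq0 x)); rewrite -e2D subrr e20 divff ?e2_neq0. Qed.

Lemma e2B x y : e2 (x - y) = e2 x / e2 y.
Proof. by rewrite e2D e2N. Qed.

Definition argpi z : Rpi R := Arg_pi (complex.Re z) (complex.Im z).

Lemma cis_Arg (x y : R) : (x +i* y)%C != 0 ->
  let r := Num.sqrt (x ^+ 2 + y ^+ 2) in
  [/\ r != 0, cos (Arg x y) = x / r & sin (Arg x y) = y / r].
Proof.
move=> z0 r; have r2 : 0 < x ^+ 2 + y ^+ 2.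
  rewrite lt_def addr_ge0 ?sqr_ge0 // andbT.
  by have := sqr_norm_eq0 (x +i* y)%C => /= ->.
have rp : 0 < r by rewrite sqrtr_gt0.
have rr : r ^+ 2 = x ^+ 2 + y ^+ 2 by rewrite sqr_sqrtr // ltW.
have xr : -1 <= x / r <= 1.
  rewrite -ler_norml normrM normfV (gtr0_norm rp) ler_pdivrMr // mul1r.
  rewrite -sqrtr_sqr; apply: ler_wsqrtr; by rewrite lerDl sqr_ge0.
have ca : cos (acos (x / r)) = x / r by rewrite acosK // in_itv.
have sa : sin (acos (x / r)) = `|y| / r.
  rewrite sin_acos //.
  have -> : 1 - (x / r) ^+ 2 = (`|y| / r) ^+ 2.
    rewrite !exprMn !exprVn rr real_normK ?num_real //.
    by field; rewrite gt_eqF.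
  by rewrite sqrtr_sqr ger0_norm // divr_ge0 // ltW.
split; first by rewrite gt_eqF.
- by rewrite /Arg -/r; case: ifP => _; rewrite ?cosN.
- rewrite /Arg -/r; case: ifP => [y0|/negbT]; first by rewrite sa ger0_norm.
  by rewrite -ltNge => y0; rewrite sinN sa ltr0_norm // mulNr opprK.
Qed.

Lemma e2_argpi z : z != 0 -> e2 (argpi z) = dir z.
Proof.
case: z => x y z0; rewrite /argpi /Arg_pi e2_pi /=.
have [r0 c s] := cis_Arg z0; set r := Num.sqrt _ in r0 c s.
have n0 : x ^+ 2 + y ^+ 2 != 0.
  by have := sqr_norm_eq0 (x +i* y)%C => /= ->.
have rr : r ^+ 2 = x ^+ 2 + y ^+ 2.
  by rewrite sqr_sqrtr // addr_ge0 ?sqr_ge0.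
rewrite /cis2 cos_mulr2n sin_mulr2n c s.
have -> : x / r * (y / r) *+ 2 = 2 * x * y / (r ^+ 2) by field.
have -> : (x / r) ^+ 2 *+ 2 - 1 = 2 * x ^+ 2 / (r ^+ 2) - 1 by field.
rewrite rr /dir /=; apply/eqP; rewrite eq_complex /= sqrrN.
by apply/andP; split; apply/eqP; field.
Qed.

(** A unit vector on the line with angle x. Changing the representative can change its sign, so only
    expressions of even degree in it are meaningful. *)
Definition rpi_root (x : Rpi R) : C := (cos (repr x) +i* sin (repr x))%C.

Lemma rpi_root_neq0 x : rpi_root x != 0.
Proof.
by rewrite -sqr_norm_eq0 /= cos2Dsin2 oner_neq0.
Qed.

Lemma dir_rpi_root x : dir (rpi_root x) = e2 x.
Proof.
rewrite /e2 /cis2 /rpi_root /dir; set t := repr x.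
apply/eqP; rewrite eq_complex /= sqrrN cos2Dsin2 !divr1.
rewrite cos_mulr2n sin_mulr2n.
have := cos2Dsin2 t => E.
by apply/andP; split; apply/eqP; [nra|ring].
Qed.

Lemma e2_unit x : (e2 x)^*%C * e2 x = 1.
Proof. by rewrite -dir_rpi_root dir_unit ?rpi_root_neq0. Qed.

Lemma argpi_mul z w : z != 0 -> w != 0 -> argpi (z * w) = argpi z + argpi w.
Proof.
move=> z0 w0; apply: e2_inj.
by rewrite e2D !e2_argpi ?mulf_neq0 // dirM.
Qed.

End Direction.

(** * Projective spaces *)

Section Glue.
Variable R : realType.
Implicit Types X : rspace R.
Notation C := (R[i]%C).

Lemma reg_glue X (f : X -> R) :
  (forall x, exists V : set X, [/\ zopen V, V x &
     @reg _ (subspace V) (fun y => f (\val y))]) -> reg f.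
Proof.
move=> H; apply: regular_glue; first exact: zopenT.
move=> x _; have [V [oV Vx rf]] := H x; exists V; split=> //.
exact: regular_subspace_open oV rf _.
Qed.

Lemma creg_glue X (f : X -> C) :
  (forall x, exists V : set X, [/\ zopen V, V x &
     @creg _ (subspace V) (fun y => f (\val y))]) -> creg f.
Proof.
by move=> H; split; apply: reg_glue => x; have [V [oV Vx [r1 r2]]] := H x;
  exists V.
Qed.

Lemma reg_sum X (I : Type) (s : seq I) (P : pred I) (f : I -> X -> R) :
  (forall i, reg (f i)) -> reg (fun x => \sum_(i <- s | P i) f i x).
Proof.
move=> rf; elim: s => [|i s IH].
  by apply: reg_eq (reg_cst _ 0) => x; rewrite big_nil.
case Pi: (P i); last by apply: reg_eq IH => x; rewrite big_cons Pi.
by apply: reg_eq (regD (rf i) IH) => x; rewrite big_cons Pi.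
Qed.

End Glue.

Section HomogeneousCoordinates.
Variables (F : fieldType) (n : nat).
Implicit Types (L : proj_pt F n) (v : 'rV[F]_n.+1).

Lemma hrep_neq0 L : hrep L != 0.
Proof.
rewrite /hrep vpick0; apply/eqP => L0.
by have := valP L; rewrite -/(pline L) /= L0 dimv0.
Qed.

Lemma hcoord_hrep L : hcoord L (hrep L).
Proof.
split; first exact: hrep_neq0.
apply/eqP; rewrite eq_sym eqEdim dim_vline hrep_neq0 (eqP (valP L)) andbT.
by rewrite -memvE memv_pick.
Qed.

Lemma proj_pt_eq L L' v : hcoord L v -> hcoord L' v -> L = L'.
Proof. by move=> [_ E] [_ E']; apply: val_inj; rewrite -/(pline L) E -E'. Qed.

Lemma hcoordZ L v (c : F) : c != 0 -> hcoord L v -> hcoord L (c *: v).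
Proof.
move=> c0 [v0 E]; split; first by rewrite scaler_eq0 negb_or c0.
rewrite E; apply/eqP; rewrite eqEdim !dim_vline scaler_eq0 negb_or c0 v0 /=.
rewrite leqnn andbT -memvE; apply/vlineP; exists c^-1.
by rewrite scalerA mulVf // scale1r.
Qed.

Lemma hcoord_scale L v w : hcoord L v -> hcoord L w ->
  exists c, c != 0 /\ w = c *: v.
Proof.
move=> [v0 E] [w0 E']; have : w \in <[v]>%VS by rewrite -E E' memv_line.
move=> /vlineP[c wc]; exists c; split=> //.
by apply: contraNneq w0 => c0; rewrite wc c0 scale0r.
Qed.

Lemma hrep_scale L v : hcoord L v -> exists c, c != 0 /\ hrep L = c *: v.
Proof. by move=> hv; apply: hcoord_scale hv (hcoord_hrep L). Qed.

Lemma hcoord_of_scale L v (c : F) : c != 0 -> hrep L = c *: v -> hcoord L v.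
Proof.
move=> c0 E; have := hcoordZ (_ : c^-1 != 0) (hcoord_hrep L).
by rewrite E scalerA mulVf // scale1r invr_eq0; apply.
Qed.

Lemma default_line : \dim <[const_mx 1 : 'rV[F]_n.+1]>%VS == 1%N.
Proof.
rewrite dim_vline eqb1; apply/eqP => /matrixP/(_ 0 0); rewrite !mxE => /eqP.
by rewrite oner_eq0.
Qed.

(* A default point when v = 0. *)
Definition mkline v : proj_pt F n :=
  insubd (exist _ <[const_mx 1]>%VS default_line) <[v]>%VS.

Lemma hcoord_mkline v : v != 0 -> hcoord (mkline v) v.
Proof. by move=> v0; split=> //; rewrite /pline val_insubd dim_vline v0. Qed.

Lemma neq0_coord v : v != 0 -> exists i, v 0 i != 0.
Proof.
move=> v0; apply: contrapT => /forallNP H; move/eqP: v0; apply.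
by apply/rowP => i; rewrite mxE; have /negP := H i; rewrite negbK => /eqP.
Qed.

End HomogeneousCoordinates.

(** * Real projective space through orthogonal projectors *)

Section RPn.
Variables (R : realType) (n : nat).
Implicit Types (L : proj_pt R n) (v : 'rV[R]_n.+1).

Definition sqnorm v : R := \sum_k v 0 k ^+ 2.

Lemma sqnorm_eq0 v : (sqnorm v == 0) = (v == 0).
Proof.
rewrite psumr_eq0 => [|i _]; last exact: sqr_ge0.
apply/allP/eqP => [H|-> i _]; last by rewrite /= mxE expr0n /= eqxx.
apply/rowP => i; have := H i (mem_index_enum _); rewrite sqrf_eq0 => /eqP ->.
by rewrite mxE.
Qed.

(** Entry (i, j) of the matrix of the orthogonal projector onto L. It is invariant under scaling,
    and its denominator never vanishes. *)
Definition rp_coord (i j : 'I_n.+1) L : R :=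
  hrep L 0 i * hrep L 0 j / sqnorm (hrep L).

(** The affine coordinate x_i / x_j is the quotient of entries (i, j) and (j, j), and the chart x_j
    != 0 is where the diagonal entry is nonzero. *)
Lemma morph_RP (X : rspace R) (f : X -> RP R n) :
  (forall i j, reg (fun x => rp_coord i j (f x))) -> is_morphism f.
Proof.
move=> rf; apply: morph_generated => _ _ [i [j [-> ->]]].
have s0 L : sqnorm (hrep L) != 0 by rewrite sqnorm_eq0 hrep_neq0.
have E : f @^-1` @hnonzero R n j = [set x | setT x /\ rp_coord j j (f x) != 0].
  apply/seteqP; split=> x; rewrite /= /hnonzero /rp_coord /=.
    by move=> h; split=> //; rewrite !mulf_neq0 // invr_eq0.
  by move=> [_]; rewrite !mulf_eq0 !negb_or => /andP[/andP[]].
have oE := zopen_neq0 (zopenT X) (rf j j).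
rewrite E; split=> //.
apply: (@regular_eq _ _ _ (fun x => rp_coord i j (f x) * (rp_coord j j (f x))^-1)).
- exact: oE.
- move=> x [_]; rewrite /= /hratio /rp_coord !mulf_eq0 !negb_or.
  by move=> /andP[/andP[h _] _]; have := s0 (f x) => s0x; field; rewrite h s0x.
apply: regularM => //; last exact: (regularV (zopenT X) (rf j j)).
by apply: (regular_sub (zopenT X) oE _ (rf i j)).
Qed.

(** On the chart x_m != 0, divide numerator and denominator by x_m^2: the denominator becomes a sum
    of squares of affine coordinates. *)
Lemma reg_rp_coord i j : @reg _ (RP R n) (rp_coord i j).
Proof.
apply: reg_glue => L; have [m hm] := neq0_coord (hrep_neq0 L).
have gen k := @gen_regularG R (proj_pt R n) (fun (U : set (proj_pt R n)) f =>
    exists i j, U = @hnonzero R n j /\ f = hratio i j) (@hnonzero R n m)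
    (hratio k m) (ex_intro _ k (ex_intro _ m (conj erefl erefl))).
have oV := (gen m).1.
exists (@hnonzero R n m : set (RP R n)); split=> //.
have rr k : @reg _ (subspace (@hnonzero R n m : set (RP R n)))
    (fun y => hratio k m (\val y)) by apply: reg_subspace => //; exact: (gen k).2.
have hy (y : subspace (@hnonzero R n m : set (RP R n))) : hrep (\val y) 0 m != 0.
  exact: (val_in y).
have s0 L' : sqnorm (hrep L') != 0 by rewrite sqnorm_eq0 hrep_neq0.
have E (y : subspace (@hnonzero R n m : set (RP R n))) :
    \sum_k hratio k m (\val y) ^+ 2 = sqnorm (hrep (\val y)) / hrep (\val y) 0 m ^+ 2.
  by rewrite /sqnorm mulr_suml; apply: eq_bigr => k _; rewrite /hratio exprMn exprVn.
apply: (@reg_eq _ _ (fun y : subspace (@hnonzero R n m : set (RP R n)) =>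
  hratio i m (\val y) * hratio j m (\val y) *
  (\sum_k hratio k m (\val y) ^+ 2)^-1)).
  move=> y; rewrite E /hratio /rp_coord.
  by have := s0 (\val y); have := hy y => h1 h2; field; rewrite h1 h2.
apply: regM; first exact: regM.
apply: regV => [|y]; last by rewrite E mulf_neq0 // invr_eq0 expf_neq0.
by apply: reg_sum => k; apply: regM.
Qed.

End RPn.

(** * Complex projective space through Hermitian projectors *)

Section CPn.
Variables (R : realType) (n : nat).
Notation C := (R[i]%C).
Implicit Types (L : proj_pt C n) (v : 'rV[C]_n.+1).

Definition cnorm m (v : 'rV[C]_m) : C := \sum_k v 0 k * (v 0 k)^*%C.

Lemma cnorm_eq0 m (v : 'rV[C]_m) : (cnorm v == 0) = (v == 0).
Proof.
rewrite psumr_eq0 => [|i _]; last exact: mulcJ_ge0.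
apply/allP/eqP => [H|-> i _]; last by rewrite /= mxE mul0r eqxx.
apply/rowP => i; have := H i (mem_index_enum _).
by rewrite mulf_eq0 conjc_neq0 orbb mxE => /eqP.
Qed.

Lemma cnormZ m (c : C) (v : 'rV[C]_m) : cnorm (c *: v) = c * c^*%C * cnorm v.
Proof.
rewrite /cnorm mulr_sumr; apply: eq_bigr => k _; rewrite mxE rmorphM /=.
by rewrite mulrACA.
Qed.

(** Conjugating the second factor makes this invariant under complex scaling: it is an entry of the
    Hermitian projector onto L. *)
Definition cp_coord (i j : 'I_n.+1) L : C :=
  hrep L 0 i * (hrep L 0 j)^*%C / cnorm (hrep L).

Lemma cp_coordE i j L v : hcoord L v ->
  cp_coord i j L = v 0 i * (v 0 j)^*%C / cnorm v.
Proof.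
move=> hv; have [c [c0 E]] := hrep_scale hv; case: hv => v0 _.
rewrite /cp_coord E cnormZ !mxE rmorphM /=.
have s0 : cnorm v != 0 by rewrite cnorm_eq0.
by field; rewrite s0 c0 conjc_neq0 c0.
Qed.

Lemma morph_CP (X : rspace R) (f : X -> CP R n) :
  (forall i j, creg (fun x => cp_coord i j (f x))) -> is_morphism f.
Proof.
move=> rf.
have s0 L : cnorm (hrep L) != 0 by rewrite cnorm_eq0 hrep_neq0.
have H i j : zopen (f @^-1` @hnonzero C n j) /\
    @creg _ (subspace (f @^-1` @hnonzero C n j)) (fun y => hratio i j (f (\val y))).
  have E : f @^-1` @hnonzero C n j = [set x | cp_coord j j (f x) != 0].
    apply/seteqP; split=> x; rewrite /= /hnonzero /cp_coord /=.
      by move=> h; rewrite !mulf_neq0 // ?invr_eq0 // conjc_neq0.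
    by rewrite !mulf_eq0 !negb_or => /andP[/andP[]].
  rewrite E; split; first exact: open_creg.
  apply: (@creg_eq _ _ (fun y : subspace [set x | cp_coord j j (f x) != 0] =>
      cp_coord i j (f (\val y)) *
      (cp_coord j j (f (\val y)))^-1)).
    move=> y; have := val_in y; rewrite /= /hratio /cp_coord !mulf_eq0 !negb_or.
    move=> /andP[/andP[h h'] _]; have := s0 (f (\val y)) => s0x.
    by field; rewrite h h' s0x.
  apply: cregM; first exact: creg_comp (@morph_val _ X _) (rf i j).
  apply: cregV; first exact: creg_comp (@morph_val _ X _) (rf j j).
  by move=> y; exact: (val_in y).
apply: morph_generated => _ _ [i [j [-> [->|->]]]];
  have [oE [r1 r2]] := H i j; split=> //.
- exact: regular_subspace_open oE r1 _.
- exact: regular_subspace_open oE r2 _.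
Qed.

Lemma creg_cp_coord i j : @creg _ (CP R n) (cp_coord i j).
Proof.
apply: creg_glue => L; have [m hm] := neq0_coord (hrep_neq0 L).
pose V : set (CP R n) := @hnonzero C n m.
have genR k := @gen_regularG R (proj_pt C n) (fun (U : set (proj_pt C n)) f =>
    exists i j, U = @hnonzero C n j /\ (f = (fun L => complex.Re (hratio i j L)) \/
       f = (fun L => complex.Im (hratio i j L)))) V
    (fun L => complex.Re (hratio k m L))
    (ex_intro _ k (ex_intro _ m (conj erefl (or_introl erefl)))).
have genI k := @gen_regularG R (proj_pt C n) (fun (U : set (proj_pt C n)) f =>
    exists i j, U = @hnonzero C n j /\ (f = (fun L => complex.Re (hratio i j L)) \/
       f = (fun L => complex.Im (hratio i j L)))) V
    (fun L => complex.Im (hratio k m L))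
    (ex_intro _ k (ex_intro _ m (conj erefl (or_intror erefl)))).
have oV : zopen V := (genR m).1.
exists V; split=> //.
have rr k : @creg _ (subspace V) (fun y => hratio k m (\val y)).
  split; first exact: (reg_subspace oV (genR k).2).
  exact: (reg_subspace oV (genI k).2).
have hy (y : subspace V) : hrep (\val y) 0 m != 0 by exact: (val_in y).
have s0 L' : cnorm (hrep L') != 0 by rewrite cnorm_eq0 hrep_neq0.
have E (y : subspace V) :
    \sum_k hratio k m (\val y) * (hratio k m (\val y))^*%C =
    cnorm (hrep (\val y)) / (hrep (\val y) 0 m * (hrep (\val y) 0 m)^*%C).
  rewrite /cnorm mulr_suml; apply: eq_bigr => k _; rewrite /hratio fmorph_div /=.
  by rewrite invfM mulrACA.
apply: (@creg_eq _ _ (fun y : subspace V => hratio i m (\val y) * (hratio j m (\val y))^*%C *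
  (\sum_k hratio k m (\val y) * (hratio k m (\val y))^*%C)^-1)).
  move=> y; rewrite E /hratio /cp_coord fmorph_div /=.
  have := s0 (\val y); have := hy y => h1 h2.
  by field; rewrite h1 h2 conjc_neq0 h1.
apply: cregM; first by apply: cregM => //; apply: creg_conj.
apply: cregV => [|y]; last first.
  by rewrite E mulf_neq0 // invr_eq0 mulf_neq0 ?conjc_neq0.
by apply: creg_sum => k; apply: cregM => //; apply: creg_conj.
Qed.

End CPn.

(** * Coordinates on the factors of the ambient spaces *)

Section BaseSpaces.
Variable R : realType.
Notation C := (R[i]%C).
Implicit Types (X : rspace R).

Lemma creg_C0 : @creg R (C0 R) id.
Proof. by split; apply: (gen_regularG _).2; split=> //; [left|right]. Qed.

Lemma morph_C0 X (f : X -> C0 R) : @creg R X f -> is_morphism f.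
Proof.
move=> [f1 f2]; apply: morph_generated => _ _ [-> [->|->]].
- by split; [exact: zopenT|exact: f1].
- by split; [exact: zopenT|exact: f2].
Qed.

Lemma creg_XX k : creg (fun v : XX R => \val v 0 k).
Proof.
apply: (creg_comp (@morph_val _ (caffine_space R 3) _)
  (_ : @creg _ (caffine_space R 3) (fun v => v 0 k))).
by split; apply: (gen_regularG _).2; exists k; split=> //; [left|right].
Qed.

Lemma morph_XX X (f : X -> XX R) :
  (forall k, creg (fun x => \val (f x) 0 k)) -> is_morphism f.
Proof.
move=> rf; apply: morph_sub; apply: morph_generated => _ _ [k [-> [->|->]]];
  have [r1 r2] := rf k.
- by split; [exact: zopenT|exact: r1].
- by split; [exact: zopenT|exact: r2].
Qed.

Lemma creg_PX i j : creg (fun L : PX R => cp_coord i j (\val L)).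
Proof.
apply: (creg_comp (@morph_val _ (CP R 2) _)
  (_ : @creg _ (CP R 2) (cp_coord i j))); exact: creg_cp_coord.
Qed.

Lemma morph_PX X (f : X -> PX R) :
  (forall i j, creg (fun x => cp_coord i j (\val (f x)))) -> is_morphism f.
Proof. by move=> rf; apply: morph_sub; apply: morph_CP. Qed.

Lemma re_posK (k : 'I_3) : (re_pos k)./2 = k :> nat.
Proof.
by rewrite /re_pos inordK ?doubleK //; case: k => [[|[|[|]]]].
Qed.

Lemma im_posK (k : 'I_3) : (im_pos k)./2 = k :> nat.
Proof.
by rewrite /im_pos inordK /= ?uphalf_double //; case: k => [[|[|[|]]]].
Qed.

Lemma odd_re_pos (k : 'I_3) : odd (re_pos k) = false.
Proof. by rewrite /re_pos inordK ?odd_double //; case: k => [[|[|[|]]]]. Qed.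

Lemma odd_im_pos (k : 'I_3) : odd (im_pos k) = true.
Proof. by rewrite /im_pos inordK /= ?odd_double //; case: k => [[|[|[|]]]]. Qed.

Lemma pos_cases (m : 'I_6) : exists k, m = re_pos k \/ m = im_pos k.
Proof.
have lt : (m./2 < 3)%N by case: m => [[|[|[|[|[|[|]]]]]]].
exists (Ordinal lt); have := odd_double_half m; case: (odd m) => E; [right|left];
  apply/val_inj; rewrite /= /re_pos /im_pos inordK;
  by [exact: esym E|move: (ltn_ord m); rewrite -{1}E].
Qed.

Lemma complexifyK (w : 'rV[R]_6) : realify (complexify w) = w.
Proof.
apply/rowP => m; rewrite !mxE.
have [k [->|->]] := pos_cases m; rewrite ?odd_re_pos ?odd_im_pos ?re_posK ?im_posK /=.
- by rewrite inord_val.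
- by rewrite inord_val.
Qed.

Lemma realifyK (v : 'rV[C]_3) : complexify (realify v) = v.
Proof.
apply/rowP => k; rewrite !mxE odd_re_pos odd_im_pos re_posK im_posK !inord_val.
by case: (v 0 k).
Qed.

Lemma realify_re v k : realify v 0 (re_pos k) = complex.Re (v 0 k) :> R.
Proof. by rewrite mxE odd_re_pos re_posK inord_val. Qed.

Lemma realify_im v k : realify v 0 (im_pos k) = complex.Im (v 0 k) :> R.
Proof. by rewrite mxE odd_im_pos im_posK inord_val. Qed.

Lemma realify_eq0 (v : 'rV[C]_3) : (realify v == 0) = (v == 0).
Proof.
apply/eqP/eqP => [E|->]; last first.
  by apply/rowP => m; rewrite !mxE /=; case: odd.
rewrite -[v]realifyK E; apply/rowP => k; rewrite !mxE; exact: erefl.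
Qed.

Lemma realifyZ (t : R) (v : 'rV[C]_3) : realify (t%:C%C *: v) = t *: realify v.
Proof.
apply/rowP => m; rewrite !mxE; case: (v 0 _) => a b /=.
by case: odd; rewrite mul0r ?addr0 ?subr0.
Qed.

Lemma complexifyZ (t : R) w : complexify (t *: w) = t%:C%C *: complexify w.
Proof. by rewrite -[w in LHS]complexifyK -realifyZ realifyK. Qed.

Lemma sqnorm_realify (v : 'rV[C]_3) : (sqnorm (realify v))%:C%C = cnorm v.
Proof.
rewrite /sqnorm /cnorm !big_ord_recl !big_ord0 !mxE /=.
have -> : inord 0 = ord0 :> 'I_3 by apply/val_inj; rewrite /= inordK.
have -> : inord 1 = lift ord0 ord0 :> 'I_3 by apply/val_inj; rewrite /= inordK.
have -> : inord 2 = lift ord0 (lift ord0 ord0) :> 'I_3.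
  by apply/val_inj; rewrite /= inordK.
case: (v 0 _) => a b; case: (v 0 _) => c d; case: (v 0 _) => e f /=.
apply/eqP; rewrite eq_complex /=; apply/andP; split; apply/eqP; ring.
Qed.

Lemma sqnorm_complexify (w : 'rV[R]_6) : (sqnorm w)%:C%C = cnorm (complexify w).
Proof. by rewrite -sqnorm_realify complexifyK. Qed.

Definition sides (L : proj_pt R 5) : 'rV[C]_3 := complexify (hrep L).

Lemma sides_neq0 L : sides L != 0.
Proof. by rewrite -realify_eq0 complexifyK hrep_neq0. Qed.

Lemma cnorm_sides L : cnorm (sides L) != 0.
Proof. by rewrite cnorm_eq0 sides_neq0. Qed.

(** The side vector of L is defined up to a real factor, so both kinds of product are invariant. The
    Hermitian ones only see it up to a complex factor; the symmetric ones retain its direction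
    modulo sign. *)
Definition side_sym (k l : 'I_3) (L : proj_pt R 5) : C :=
  sides L 0 k * sides L 0 l / cnorm (sides L).
Definition side_herm (k l : 'I_3) (L : proj_pt R 5) : C :=
  sides L 0 k * (sides L 0 l)^*%C / cnorm (sides L).

Lemma sides_scale L (v : 'rV[C]_3) : hcoord L (realify v) ->
  exists t : R, t != 0 /\ sides L = t%:C%C *: v.
Proof.
move=> /hrep_scale[t [t0 E]]; exists t; split=> //.
by rewrite /sides E complexifyZ realifyK.
Qed.

Lemma hcoord_sides L : hcoord L (realify (sides L)).
Proof. by rewrite complexifyK; exact: hcoord_hrep. Qed.

Lemma hcoord_sides_scale L (v : 'rV[C]_3) (t : R) :
  t != 0 -> sides L = t%:C%C *: v -> hcoord L (realify v).
Proof.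
move=> t0 E; apply: (@hcoord_of_scale _ _ _ _ t) => //.
by rewrite -realifyZ -E complexifyK.
Qed.

Lemma realC_neq0 (t : R) : (t%:C%C == 0 :> C) = (t == 0).
Proof. by rewrite eq_complex /= eqxx andbT. Qed.

Lemma side_symE k l L v : hcoord L (realify v) ->
  side_sym k l L = v 0 k * v 0 l / cnorm v.
Proof.
move=> h; have [t [t0 E]] := sides_scale h; rewrite /side_sym E cnormZ !mxE conjc_real.
have v0 : cnorm v != 0 by rewrite cnorm_eq0 -realify_eq0; case: h.
by field; rewrite v0 realC_neq0.
Qed.

Lemma side_hermE k l L v : hcoord L (realify v) ->
  side_herm k l L = v 0 k * (v 0 l)^*%C / cnorm v.
Proof.
move=> h; have [t [t0 E]] := sides_scale h.
have cE : (t%:C%C * v 0 l)^*%C = t%:C%C * (v 0 l)^*%C.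
  by rewrite rmorphM -[X in _ = X * _]conjc_real.
rewrite /side_herm E cnormZ !mxE cE conjc_real.
have v0 : cnorm v != 0 by rewrite cnorm_eq0 -realify_eq0; case: h.
by field; rewrite v0 realC_neq0.
Qed.

Lemma divc_real (z : C) (t : R) :
  z / t%:C%C = (complex.Re z / t +i* (complex.Im z / t))%C.
Proof.
have -> : (t%:C%C)^-1 = (t^-1)%:C%C by rewrite fmorphV.
case: z => a b; apply/eqP; rewrite eq_complex /=.
by apply/andP; split; apply/eqP; ring.
Qed.

Lemma creg_RP5 k l :
  @creg _ (RP R 5) (side_sym k l) /\ @creg _ (RP R 5) (side_herm k l).
Proof.
pose nu := @rp_coord R 5.
have rn i j : @reg _ (RP R 5) (nu i j) by exact: reg_rp_coord.
split.
- split.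
  + apply: (@reg_eq _ (RP R 5) (fun L => nu (re_pos k) (re_pos l) L
        + - nu (im_pos k) (im_pos l) L)); last by apply: regD => //; apply: regN.
    move=> L; rewrite /side_sym -sqnorm_complexify divc_real /sides /nu /rp_coord !mxE /=.
    by ring.
  + apply: (@reg_eq _ (RP R 5) (fun L => nu (re_pos k) (im_pos l) L
        + nu (im_pos k) (re_pos l) L)); last exact: regD.
    move=> L; rewrite /side_sym -sqnorm_complexify divc_real /sides /nu /rp_coord !mxE /=.
    by ring.
- split.
  + apply: (@reg_eq _ (RP R 5) (fun L => nu (re_pos k) (re_pos l) L
        + nu (im_pos k) (im_pos l) L)); last exact: regD.
    move=> L; rewrite /side_herm -sqnorm_complexify divc_real /sides /nu /rp_coord !mxE /=.
    by ring.
  + apply: (@reg_eq _ (RP R 5) (fun L => - nu (re_pos k) (im_pos l) L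
        + nu (im_pos k) (re_pos l) L)); last by apply: regD => //; apply: regN.
    move=> L; rewrite /side_herm -sqnorm_complexify divc_real /sides /nu /rp_coord !mxE /=.
    by ring.
Qed.

(** For sides x + iy and x' + iy' the real parts of the two products are xx' - yy' and xx' + yy',
    the imaginary parts xy' + yx' and yx' - xy'; half sums and differences recover every product of
    two real coordinates. *)
Lemma morph_RP5 X (f : X -> RP R 5) :
  (forall k l, creg (fun x => side_sym k l (f x))) ->
  (forall k l, creg (fun x => side_herm k l (f x))) -> is_morphism f.
Proof.
move=> rS rH; apply: morph_RP => i j.
have [k [->|->]] := pos_cases i; have [l [->|->]] := pos_cases j;
  have [s1 s2] := rS k l; have [h1 h2] := rH k l.
- apply: (@reg_eq _ X (fun x => 2^-1 * (complex.Re (side_sym k l (f x)) +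
    complex.Re (side_herm k l (f x))))).
    move=> x; rewrite /side_sym /side_herm -sqnorm_complexify !divc_real.
    rewrite /sides /rp_coord !mxE /=.
    by field; rewrite sqnorm_eq0 hrep_neq0.
  by apply: regM; [exact: reg_cst|exact: regD].
- apply: (@reg_eq _ X (fun x => 2^-1 * (complex.Im (side_sym k l (f x)) +
    - complex.Im (side_herm k l (f x))))).
    move=> x; rewrite /side_sym /side_herm -sqnorm_complexify !divc_real.
    rewrite /sides /rp_coord !mxE /=.
    by field; rewrite sqnorm_eq0 hrep_neq0.
  by apply: regM; [exact: reg_cst|apply: regD => //; apply: regN].
- apply: (@reg_eq _ X (fun x => 2^-1 * (complex.Im (side_sym k l (f x)) +
    complex.Im (side_herm k l (f x))))).
    move=> x; rewrite /side_sym /side_herm -sqnorm_complexify !divc_real.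
    rewrite /sides /rp_coord !mxE /=.
    by field; rewrite sqnorm_eq0 hrep_neq0.
  by apply: regM; [exact: reg_cst|exact: regD].
- apply: (@reg_eq _ X (fun x => 2^-1 * (complex.Re (side_herm k l (f x)) +
    - complex.Re (side_sym k l (f x))))).
    move=> x; rewrite /side_sym /side_herm -sqnorm_complexify !divc_real.
    rewrite /sides /rp_coord !mxE /=.
    by field; rewrite sqnorm_eq0 hrep_neq0.
  by apply: regM; [exact: reg_cst|apply: regD => //; apply: regN].
Qed.

Definition line_vec (M : proj_pt R 1) : C :=
  (hrep M 0 ord0 +i* hrep M 0 ord_max)%C.

Definition vec_row (z : C) : 'rV[R]_2 :=
  \row_(i < 2) (if i == ord0 then complex.Re z else complex.Im z).

Lemma vec_rowE M : hrep M = vec_row (line_vec M).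
Proof.
apply/rowP => i; rewrite mxE; case: eqP => [->//|/eqP ne] /=.
by congr (hrep M _ _); apply/val_inj; move: ne; case: i => [[|[|]]].
Qed.

Lemma vec_row_eq0 z : (vec_row z == 0) = (z == 0).
Proof.
apply/eqP/eqP => [/rowP E|->]; last by apply/rowP => i; rewrite !mxE; case: ifP.
move: (E ord0) (E ord_max); rewrite !mxE /=.
by case: z {E} => a b /= -> ->.
Qed.

Lemma vec_rowZ (t : R) z : vec_row (t%:C%C * z) = t *: vec_row z.
Proof.
apply/rowP => i; rewrite !mxE; case: z => a b /=.
by case: ifP; rewrite mul0r ?addr0 ?subr0.
Qed.

Lemma vec_row_inj : injective vec_row.
Proof.
move=> [a b] [c d] /rowP E; move: (E ord0) (E ord_max); rewrite !mxE /=.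
by move=> -> ->.
Qed.

Lemma line_vec_neq0 M : line_vec M != 0.
Proof. by rewrite -vec_row_eq0 -vec_rowE hrep_neq0. Qed.

Lemma P1_to_RpiE M : P1_to_Rpi M = argpi (line_vec M).
Proof. by []. Qed.

Lemma e2_P1 M : e2 (P1_to_Rpi M) = dir (line_vec M).
Proof. by rewrite P1_to_RpiE e2_argpi ?line_vec_neq0. Qed.

Lemma hcoord_vec_row M z : hcoord M (vec_row z) ->
  exists t : R, t != 0 /\ line_vec M = t%:C%C * z.
Proof.
move=> /hrep_scale[t [t0 E]]; exists t; split=> //.
by apply: vec_row_inj; rewrite -vec_rowE E vec_rowZ.
Qed.

Lemma hcoord_dir M z : z != 0 -> e2 (P1_to_Rpi M) = dir z -> hcoord M (vec_row z).
Proof.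
move=> z0; rewrite e2_P1 => /dir_eq[||t [t0 E]] //; first exact: line_vec_neq0.
by apply: (@hcoord_of_scale _ _ _ _ t) => //; rewrite vec_rowE E vec_rowZ.
Qed.

Lemma dir_hcoord M z : hcoord M (vec_row z) -> e2 (P1_to_Rpi M) = dir z.
Proof.
move=> /hcoord_vec_row[t [t0 E]].
by rewrite e2_P1 E dirM dir_real // mul1r.
Qed.

Lemma P1_to_Rpi_inj : injective (@P1_to_Rpi R).
Proof.
move=> M M' E; apply: (@proj_pt_eq _ _ _ _ (vec_row (line_vec M))).
  by rewrite -vec_rowE; exact: hcoord_hrep.
by apply: hcoord_dir; rewrite ?line_vec_neq0 // -E e2_P1.
Qed.

Definition Rpi_to_P1 (x : Rpi R) : RP R 1 := mkline (vec_row (rpi_root x)).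

Lemma Rpi_to_P1K : cancel Rpi_to_P1 (@P1_to_Rpi R).
Proof.
move=> x; apply: e2_inj; rewrite -(dir_rpi_root x); apply: (@dir_hcoord (Rpi_to_P1 x)).
by apply: hcoord_mkline; rewrite vec_row_eq0 rpi_root_neq0.
Qed.

Lemma P1_to_RpiK : cancel (@P1_to_Rpi R) Rpi_to_P1.
Proof. by move=> M; apply: P1_to_Rpi_inj; rewrite Rpi_to_P1K. Qed.

Lemma sqnorm_P1 (M : proj_pt R 1) :
  sqnorm (hrep M) = hrep M 0 ord0 ^+ 2 + hrep M 0 ord_max ^+ 2.
Proof.
rewrite /sqnorm big_ord_recl big_ord1; congr (_ + _).
by congr (hrep M _ _ ^+ 2); apply/val_inj.
Qed.

Lemma dir_line_vec M : dir (line_vec M) =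
  ((rp_coord ord0 ord0 M - rp_coord ord_max ord_max M) +i*
   (2 * rp_coord ord0 ord_max M))%C.
Proof.
have s0 : sqnorm (hrep M) != 0 by rewrite sqnorm_eq0 hrep_neq0.
rewrite /rp_coord /line_vec /dir; apply/eqP; rewrite eq_complex /= sqrrN.
rewrite sqnorm_P1 in s0 *.
by apply/andP; split; apply/eqP; field.
Qed.

Lemma creg_P1 : @creg _ (RP R 1) (fun M => e2 (P1_to_Rpi M)).
Proof.
have rn i j := @reg_rp_coord R 1 i j.
split.
- apply: (@reg_eq _ (RP R 1) (fun M => rp_coord ord0 ord0 M + - rp_coord ord_max ord_max M)).
    by move=> M; rewrite e2_P1 dir_line_vec.
  by apply: regD => //; apply: regN.
- apply: (@reg_eq _ (RP R 1) (fun M => 2 * rp_coord ord0 ord_max M)).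
    by move=> M; rewrite e2_P1 dir_line_vec.
  by apply: regM => //; apply: reg_cst.
Qed.

Lemma morph_P1 X (f : X -> RP R 1) :
  creg (fun x => e2 (P1_to_Rpi (f x))) -> is_morphism f.
Proof.
move=> [r1 r2]; apply: morph_RP => i j.
(* The projector has trace 1. The real part of [e2] is the difference of the diagonal entries, so
   each is recovered; the imaginary part is twice the off-diagonal entry. *)
have key (M : proj_pt R 1) : rp_coord ord0 ord0 M + rp_coord ord_max ord_max M = 1.
  have s0 : sqnorm (hrep M) != 0 by rewrite sqnorm_eq0 hrep_neq0.
  by rewrite /rp_coord -mulrDl -!expr2 -sqnorm_P1 divff.
have r00 : reg (fun x => rp_coord ord0 ord0 (f x)).
  apply: (@reg_eq _ X (fun x => 2^-1 * (1 + complex.Re (e2 (P1_to_Rpi (f x)))))).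
    by move=> x; rewrite e2_P1 dir_line_vec /=; have := key (f x); lra.
  by apply: regM; [exact: reg_cst|apply: regD => //; exact: reg_cst].
have r11 : reg (fun x => rp_coord ord_max ord_max (f x)).
  apply: (@reg_eq _ X (fun x => 1 + - rp_coord ord0 ord0 (f x))).
    by move=> x; have := key (f x); lra.
  by apply: regD; [exact: reg_cst|exact: regN].
have r01 : reg (fun x => rp_coord ord0 ord_max (f x)).
  apply: (@reg_eq _ X (fun x => 2^-1 * complex.Im (e2 (P1_to_Rpi (f x))))).
    by move=> x; rewrite e2_P1 dir_line_vec /=; lra.
  by apply: regM => //; exact: reg_cst.
have two (m : 'I_2) : m = ord0 \/ m = ord_max.
  by case: m => [[|[|]]] // p; [left|right]; apply/val_inj.
have [->|->] := two i; have [->|->] := two j => //.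
by apply: reg_eq r01 => x; rewrite /rp_coord mulrAC mulrC mulrA.
Qed.

Lemma creg_e2 : @creg _ (Rpi_space R) (@e2 R).
Proof. by have [r1 r2] := creg_P1; split. Qed.

Lemma morph_P1_to_Rpi : @is_morphism R (RP R 1) (Rpi_space R) (@P1_to_Rpi R).
Proof. by []. Qed.

(** The doubled angle is a complete regular coordinate on R/pi; factoring through the projective
    line transfers the criterion of [morph_P1]. *)
Lemma morph_Rpi X (f : X -> Rpi_space R) :
  creg (fun x => e2 (f x)) -> is_morphism f.
Proof.
move=> rf; apply: (@morph_eq R X (Rpi_space R) (fun x => P1_to_Rpi (Rpi_to_P1 (f x)))).
  by move=> x; rewrite Rpi_to_P1K.
apply: (morph_comp morph_P1_to_Rpi); apply: morph_P1.
by under eq_fun do rewrite Rpi_to_P1K.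
Qed.

Lemma morph_Rpi_to_P1 : @is_morphism R (Rpi_space R) (RP R 1) Rpi_to_P1.
Proof.
apply: morph_P1; apply: creg_eq creg_e2 => x.
by rewrite Rpi_to_P1K.
Qed.

End BaseSpaces.

(** * Affine charts *)

Section AffineCharts.
Variable R : realType.
Implicit Types X : rspace R.

Definition polyfun n (q : 'rV[R]_n -> R) : Prop :=
  genring (fun (U : set 'rV[R]_n) f =>
    exists i : 'I_n, U = setT /\ f = fun v => v 0 i) setT q.

Lemma polyfun_ring n : fun_ring (@polyfun n).
Proof.
split=> [c|f g pf pg|f g pf pg]; first exact: genring_cst.
- by have := genring_add pf pg; rewrite setIT.
- by have := genring_mul pf pg; rewrite setIT.
Qed.

Lemma polyfun_coord n (i : 'I_n) : polyfun (fun v => v 0 i).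
Proof. by apply: genring_base; exists i. Qed.

Lemma reg_polyfun n (q : 'rV[R]_n -> R) :
  polyfun q -> @reg _ (affine_space R n) q.
Proof.
move=> pq v _; exists setT, setT, q, (fun=> 1).
by split=> //; [exact: genring_cst|exact: oner_neq0|move=> y *; rewrite divr1].
Qed.

Lemma morph_affine X n (f : X -> affine_space R n) :
  (forall i, reg (fun x => (f x : 'rV[R]_n) 0 i)) -> is_morphism f.
Proof.
move=> rf; apply: morph_generated => _ _ [i [-> ->]].
by split; [exact: zopenT|exact: rf].
Qed.

Definition vinit n (v : 'rV[R]_n.+1) : 'rV[R]_n := \row_j v 0 (lift ord_max j).

Definition vsnoc n (v : 'rV[R]_n) (t : R) : 'rV[R]_n.+1 :=
  \row_i (if unlift ord_max i is Some j then v 0 j else t).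

Lemma vinit_snoc n (v : 'rV[R]_n) t : vinit (vsnoc v t) = v.
Proof. by apply/rowP => j; rewrite !mxE liftK. Qed.

Lemma vsnoc_last n (v : 'rV[R]_n) t : vsnoc v t 0 ord_max = t.
Proof. by rewrite mxE unlift_none. Qed.

Lemma vsnocK n (w : 'rV[R]_n.+1) : vsnoc (vinit w) (w 0 ord_max) = w.
Proof. by apply/rowP => i; rewrite mxE; case: unliftP => [j ->|->] //; rewrite mxE. Qed.

(** The polynomial is taken in one more variable, which it does not involve: that variable becomes
    the inverse of q in the hypersurface presentation. *)
Lemma polyfun_mpoly n (q : 'rV[R]_n -> R) : polyfun q ->
  exists p : mpoly.mpoly n.+1 R,
    (forall v : 'rV[R]_n.+1, mpoly.meval (fun i => v 0 i) p = q (vinit v)) /\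
    mpoly.mderiv ord_max p = 0.
Proof.
rewrite /polyfun; elim=> {q} [U q [i [_ ->]]|c|U V f g _ [p [Ep dp]] _ [s [Es ds]]|
  U V f g _ [p [Ep dp]] _ [s [Es ds]]].
- exists (mpoly.mpolyX R (mpoly.mnm1 (lift ord_max i))); split=> [v|].
    by rewrite mpoly.mevalXU mxE.
  by rewrite mpoly.mderivX mpoly.mnm1E eq_sym (negbTE (neq_lift _ _)) scale0r.
- exists (mpoly.mpolyC n.+1 c); split=> [v|]; first by rewrite mpoly.mevalC.
  by rewrite mpoly.mderivC.
- exists (p + s); split=> [v|]; first by rewrite mpoly.mevalD Ep Es.
  by rewrite mpoly.mderivD dp ds addr0.
- exists (p * s); split=> [v|]; first by rewrite mpoly.mevalM Ep Es.
  by rewrite mpoly.mderivM dp ds mul0r mulr0 addr0.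
Qed.

(* The principal open set q != 0 of R^n is the hypersurface q(x) t = 1 of R^(n+1). *)
Lemma smooth_affine_chart_principal X (U : set X) n
    (x : X -> 'rV[R]_n) (y : 'rV[R]_n -> X) (q : 'rV[R]_n -> R) :
  polyfun q ->
  (forall i, @reg _ (subspace U) (fun p => x (\val p) 0 i)) ->
  (forall p, U p -> q (x p) != 0 /\ y (x p) = p) ->
  (forall v, q v != 0 -> U (y v) /\ x (y v) = v) ->
  @is_morphism R (subspace [set v : affine_space R n | q v != 0]) X
    (fun v => y (\val v)) ->
  smooth_affine_chart U.
Proof.
move=> pq rx xy yx my; have [p [Ep dp]] := polyfun_mpoly pq.
pose F : mpoly.mpoly n.+1 R := p * mpoly.mpolyX R (mpoly.mnm1 ord_max) - 1.
have EF (v : 'rV[R]_n.+1) : mpoly.meval (fun i => v 0 i) F = q (vinit v) * v 0 ord_max - 1.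
  by rewrite mpoly.mevalB mpoly.mevalM mpoly.mevalXU Ep mpoly.meval1.
have VF (v : 'rV[R]_n.+1) : zero_set [set F] v <-> q (vinit v) * v 0 ord_max = 1.
  split=> [/(_ F erefl)|E _ ->].
    by rewrite EF => /eqP; rewrite subr_eq0 => /eqP.
  by rewrite EF E subrr.
have qV (v : 'rV[R]_n.+1) : zero_set [set F] v -> q (vinit v) != 0.
  by move=> /VF E; apply: contra_eq_neq E => ->; rewrite mul0r eq_sym oner_neq0.
have psiP (z : subspace U) : zero_set [set F] (vsnoc (x (\val z)) (q (x (\val z)))^-1).
  have [q0 _] := xy _ (val_in z).
  by apply/VF; rewrite vinit_snoc vsnoc_last divff.
pose psi (z : subspace U) : subspace (zero_set [set F]) := insp (psiP z).
have phiP (w : subspace (zero_set [set F])) : U (y (vinit (\val w))).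
  by have [] := yx _ (qV _ (val_in w)).
pose phi (w : subspace (zero_set [set F])) : subspace U := insp (phiP w).
exists n.+1, [set F], psi; split.
  move=> v Vv; exists 1%N, (fun=> F), 1; split.
  - by move=> w _ Vw; apply: Vw.
  (* The last partial derivative of F is q, since p is independent of the last variable, and q is
     nonzero on the hypersurface. *)
  - rewrite rank_rV; apply/eqP; rewrite eqb1; apply/eqP => /matrixP/(_ 0 ord_max).
    rewrite !mxE mpoly.mderivB mpoly.mderivM dp mul0r add0r.
    rewrite -[1%R in X in _ - X]mpoly.mpolyC1 mpoly.mderivC subr0.
    rewrite mpoly.mderivX mpoly.mnm1E eqxx scale1r.
    have -> (m : mpoly.multinom n.+1) : mpoly.mnm_sub m m = mpoly.mnm0.
      by apply/mpoly.mnmP => i; rewrite mpoly.mnmBE subnn mpoly.mnm0E.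
    rewrite mpoly.mpolyX0 mulr1 Ep => /eqP.
    by rewrite (negbTE (qV _ Vv)).
  - by rewrite mpoly.meval1 oner_neq0.
  - by move=> w _ /(_ 0) Fw _ ->.
split.
  apply: morph_sub; apply: morph_affine => i.
  case: (unliftP ord_max i) => [j ->|->].
    by apply: reg_eq (rx j) => z; rewrite /= mxE liftK.
  apply: (@reg_eq _ _ (fun z : subspace U => (q (x (\val z)))^-1)).
    by move=> z; rewrite /= vsnoc_last.
  apply: regV; last by move=> z; have [] := xy _ (val_in z).
  apply: (reg_comp (_ : @is_morphism _ _ (affine_space R n) (fun z : subspace U => x (\val z)))
    (reg_polyfun pq)).
  exact: morph_affine.
exists phi; split.
- apply: morph_sub.
  pose r (w : subspace (zero_set [set F])) :
    subspace [set v : affine_space R n | q v != 0] := insp (qV _ (val_in w)).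
  apply: (morph_comp my (_ : is_morphism r)).
  apply: morph_sub; apply: morph_affine => i.
  apply: (@reg_eq _ _ (fun w : subspace (zero_set [set F]) =>
    (\val w : 'rV[R]_n.+1) 0 (lift ord_max i))).
    by move=> w; rewrite /= mxE.
  exact: (reg_comp (@morph_val _ (affine_space R n.+1) _) (reg_polyfun (polyfun_coord _))).
- move=> z; apply: insp_inj; rewrite /= vinit_snoc.
  by have [] := xy _ (val_in z).
- move=> w; apply: insp_inj; rewrite /=.
  have Vw := val_in w; have q0 := qV _ Vw.
  have [_ ->] := yx _ q0.
  rewrite -[RHS]vsnocK; congr vsnoc.
  by move/VF: Vw => E; apply: (mulfI q0); rewrite E divff.
Qed.

Lemma smooth_variety_charts X (I : finType) (U : I -> set X) :
  separated X -> (forall x, exists i, U i x) ->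
  (forall i, zopen (U i) /\ smooth_affine_chart (U i)) -> smooth_variety X.
Proof.
move=> sX cU oU; split=> //; exists #|I|, (fun i => U (enum_val i)); split=> //.
by move=> x; have [i Ui] := cU x; exists (enum_rank i); rewrite enum_rankK.
Qed.

End AffineCharts.

(** * Blowing up the zero locus of a complex function *)

Section BlowupZeta.
Variable R : realType.
Notation C := (R[i]%C).

Lemma open_creg_on (X : rspace R) (U : set X) (f : X -> C) :
  zopen U -> @creg _ (subspace U) (fun y => f (\val y)) ->
  zopen [set x | U x /\ f x != 0].
Proof.
move=> oU [f1 f2].
have r1 := regular_subspace_open (H := fun x => complex.Re (f x)) oU f1 (fun=> erefl).
have r2 := regular_subspace_open (H := fun x => complex.Im (f x)) oU f2 (fun=> erefl).
have := zopenU (zopen_neq0 oU r1) (zopen_neq0 oU r2).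
congr zopen; apply/seteqP; split=> x /=; rewrite eq_complex negb_and.
  by case=> -[Ux ->]; rewrite ?orbT.
by move=> [Ux /orP[]]; [left|right].
Qed.

Definition re_im (T : Type) (z : T -> C) (i : 'I_2) (x : T) : R :=
  if i == ord0 then complex.Re (z x) else complex.Im (z x).

Lemma row_re_im (T : Type) (z : T -> C) x : \row_i re_im z i x = vec_row (z x).
Proof. by apply/rowP => i; rewrite !mxE. Qed.

Lemma re_im_eq0 (T : Type) (z : T -> C) x :
  (forall i, re_im z i x = 0) <-> z x = 0.
Proof.
split=> [H|E i]; last by rewrite /re_im E; case: ifP.
by move: (H ord0) (H ord_max); rewrite /re_im /=; case: (z x) => a b /= -> ->.
Qed.

Variables (X : rspace R) (Z U : set X) (zeta : X -> C).
Hypotheses (oU : zopen U) (rz : @creg _ (subspace U) (fun y => zeta (\val y))).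
Hypothesis Zz : forall x, U x -> (Z x <-> zeta x = 0).

Lemma regular_re_im i : regular U (re_im zeta i).
Proof.
have [r1 r2] := rz; rewrite /re_im; case: (i == ord0).
- exact: (regular_subspace_open oU r1).
- exact: (regular_subspace_open oU r2).
Qed.

Section Ideal.
Variable r : subspace U -> subspace U.
Hypothesis rZ : forall y, zeta (\val y) = 0 -> r y = y.
Hypothesis zr : forall y, zeta (\val (r y)) = 0.

Let S := retr_space (re_im zeta) r.

Lemma creg_retr_fix (g : subspace U -> C) :
  creg g -> (forall y, g (r y) = g y) -> @creg _ S g.
Proof.
move=> [g1 g2] E; split; apply: retr_congP.
- by apply: (@retr_cong_fix R X U _ _ r) g1 _ => y; rewrite E.
- by apply: (@retr_cong_fix R X U _ _ r) g2 _ => y; rewrite E.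
Qed.

Lemma creg_retr_zeta : @creg _ S (fun y => zeta (\val y)).
Proof.
have H := @retr_cong_gen R X Z U _ (re_im zeta) r oU regular_re_im.
have {}H i : @reg _ S (fun y => re_im zeta i (\val y)).
  apply: retr_congP; apply: H => [y|j x Ux Zx].
  - by apply/Zz; [exact: val_in|exact: zr].
  - by move: j; apply/re_im_eq0/Zz.
by split; [exact: (H ord0)|exact: (H ord_max)].
Qed.

Lemma generate_ideal_zeta :
  @is_morphism R S X (fun y : subspace U => \val y) ->
  generate_ideal Z U (re_im zeta).
Proof.
apply: (@generate_ideal_retract _ _ _ _ _ _ r) => //.
- exact: regular_re_im.
- by move=> y Zy; apply: rZ; apply/(Zz (val_in y)).
- by move=> y; apply/(Zz (val_in (r y))).
- by move=> i x Ux Zx; move: i; apply/re_im_eq0/Zz.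
- by move=> x Ux /re_im_eq0 zx; apply/Zz.
Qed.

End Ideal.

(** Curves leaving Z in each direction m; they reach every point of the exceptional circle over
    x. *)
Hypothesis curve : forall x (m : C), U x -> Z x -> m != 0 ->
  exists g : real_line R -> X, [/\ is_morphism g, g 0 = x &
    forall t, U (g t) -> zeta (g t) = t%:C%C * m].

Definition zeta_model : set (prod_space X (RP R 1)) :=
  [set z : X * RP R 1 | U z.1 /\
     (zeta z.1)^*%C * e2 (P1_to_Rpi z.2) = zeta z.1].

(** The equation is closed over U and holds on the graph, which gives one inclusion. Conversely it
    forces the direction where zeta != 0, and over zeta = 0 every direction is attained along a
    curve. *)
Lemma blowup_modelE : blowup_model Z U (re_im zeta) = zeta_model.
Proof.
pose P := prod_space X (RP R 1).
have oUP : zopen ((fun z : P => z.1) @^-1` U).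
  exact: open_preim (@morph_fst _ X (RP R 1)) oU.
apply/seteqP; split=> -[x M] [/= Ux].
  move=> cl; split=> //=; apply: contrapT => ne.
  (* The failure of the equation is an open condition, and it would therefore occur at some point of
     the graph. *)
  have oN : zopen [set z : P | U z.1 /\
      (zeta z.1)^*%C * e2 (P1_to_Rpi z.2) - zeta z.1 != 0].
    apply: (@open_creg_on P _ (fun z => (zeta z.1)^*%C * e2 (P1_to_Rpi z.2) - zeta z.1)) => //.
    pose Q := subspace ((fun z : P => z.1) @^-1` U).
    have mP : @is_morphism _ Q P (fun y => \val y) by exact: morph_val.
    pose q (y : Q) : subspace U := @insp _ X U (\val y).1 (val_in y).
    have mq : is_morphism q.
      by apply: morph_sub; apply: morph_comp (@morph_fst _ X (RP R 1)) mP.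
    have r1 : creg (fun y : Q => zeta (\val y).1) by exact: (creg_comp mq rz).
    have r2 : creg (fun y : Q => e2 (P1_to_Rpi (\val y).2)).
      exact: (creg_comp (morph_comp (@morph_snd _ X (RP R 1)) mP) (creg_P1 R)).
    by cregs.
  have [|[y N] [[/= Uy nZ hN] [_ /=]]] := cl _ oN.
    by split=> //=; rewrite subr_eq0; apply/eqP.
  rewrite row_re_im in hN; rewrite (dir_hcoord hN) conj_mul_dir subrr eqxx.
  by [].
move=> E; split=> //=; have [z0|z0] := eqVneq (zeta x) 0; last first.
  apply: sub_zclosure; split=> //=; first by move=> /(Zz Ux)/eqP; apply/negP.
  by rewrite row_re_im; apply: hcoord_dir => //; apply: conj_mul_eq E.
move=> V oV Vx.
have m0 := line_vec_neq0 M.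
(* With m chosen on the line M, the values t m of zeta all span M: the lifted curve keeps its second
   component constant. *)
have [g [mg g0 gz]] := curve Ux ((Zz Ux).2 z0) m0.
pose h (t : real_line R) : P := (g t, M).
have mh : is_morphism h by apply: morph_prod => //; exact: morph_cst.
have [|t [t0 [Vt Ut]]] := curve_nbhd0 mh (zopenI oV oUP).
  by rewrite /h g0.
exists (h t); split=> //=.
have zt := gz _ Ut.
have zt0 : zeta (g t) != 0 by rewrite zt mulf_neq0 // realC_neq0.
split=> //=; first by move=> /(Zz Ut)/eqP; apply/negP.
rewrite row_re_im zt vec_rowZ -vec_rowE.
by apply: hcoordZ => //; exact: hcoord_hrep.
Qed.

(** E is the exceptional coordinate of Y. Together with [pr] it maps Y over U into the model; [inv]
    gives the inverse morphism, and joint injectivity makes it a two-sided inverse. *)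
Lemma blowup_zeta_local (Y : rspace R) (pr : Y -> X) (E : Y -> Rpi R)
    (inv : subspace zeta_model -> Y) :
  is_morphism pr ->
  @is_morphism _ (subspace (pr @^-1` U)) (Rpi_space R) (fun y => E (\val y)) ->
  (forall y, U (pr y) -> (zeta (pr y))^*%C * e2 (E y) = zeta (pr y)) ->
  is_morphism inv ->
  (forall z, pr (inv z) = (\val z).1) ->
  (forall z, E (inv z) = P1_to_Rpi (\val z).2) ->
  (forall y y', U (pr y) -> pr y = pr y' -> E y = E y' -> y = y') ->
  exists psi : subspace (pr @^-1` U) -> subspace (blowup_model Z U (re_im zeta)),
    is_isomorphism psi /\ forall y, (\val (psi y)).1 = pr (\val y).
Proof.
move=> mpr mE hE minv pinv Einv inj; rewrite blowup_modelE.
pose K := zeta_model.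
have KP (y : subspace (pr @^-1` U)) : K (pr (\val y), Rpi_to_P1 (E (\val y))).
  have Uy := val_in y; split=> //=; rewrite Rpi_to_P1K; exact: hE.
pose psi (y : subspace (pr @^-1` U)) : subspace K := insp (KP y).
have IP (z : subspace K) : (pr @^-1` U) (inv z).
  by rewrite /= pinv; case: (val_in z).
pose phi (z : subspace K) : subspace (pr @^-1` U) := insp (IP z).
exists psi; split=> //; split.
  apply: morph_sub; apply: morph_prod.
    exact: morph_comp mpr (@morph_val _ Y _).
  exact: (@morph_comp _ _ (Rpi_space R) (RP R 1) _ _ (@morph_Rpi_to_P1 R) mE).
exists phi; split.
- exact: morph_sub.
- move=> y; apply: insp_inj; apply: inj => /=.
  + exact: (IP (psi y)).
  + by rewrite pinv.
  + by rewrite Einv /= Rpi_to_P1K.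
- move=> z; apply: insp_inj; rewrite /= pinv Einv P1_to_RpiK.
  by case: z => -[].
Qed.

End BlowupZeta.

(** * Triangles up to complex scaling *)

Section Indices.
Implicit Types j k : 'I_3.

Lemma I3_cases j k : [\/ k = j, k = j + 1 | k = j + 2%:R].
Proof.
case: j => [[|[|[|]]]] // ?; case: k => [[|[|[|]]]] // ?;
  by [constructor 1; apply/val_inj|constructor 2; apply/val_inj|
      constructor 3; apply/val_inj].
Qed.

Lemma I3_1 j : (j + 1 == j) = false. Proof. by case: j => [[|[|[|]]]]. Qed.
Lemma I3_2 j : (j + 2%:R == j) = false. Proof. by case: j => [[|[|[|]]]]. Qed.
Lemma I3_21 j : (j + 2%:R == j + 1) = false. Proof. by case: j => [[|[|[|]]]]. Qed.
Lemma I3_add11 j : j + 1 + 1 = j + 2%:R.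
Proof. by case: j => [[|[|[|]]]] // ?; apply/val_inj. Qed.
Lemma I3_add12 j : j + 1 + 2%:R = j.
Proof. by case: j => [[|[|[|]]]] // ?; apply/val_inj. Qed.
Lemma I3_add21 j : j + 2%:R + 1 = j.
Proof. by case: j => [[|[|[|]]]] // ?; apply/val_inj. Qed.
Lemma I3_add22 j : j + 2%:R + 2%:R = j + 1.
Proof. by case: j => [[|[|[|]]]] // ?; apply/val_inj. Qed.

Lemma sum_I3 (V : zmodType) j (F : 'I_3 -> V) :
  \sum_k F k = F j + F (j + 1) + F (j + 2%:R).
Proof.
rewrite (bigD1 j) //= (bigD1 (j + 1)) ?I3_1 //= (bigD1 (j + 2%:R)) /=.
  rewrite big1 ?addr0; first by rewrite [LHS]addrA.
  by move=> k; case: (I3_cases j k) => ->; rewrite ?eqxx ?andbF.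
by rewrite I3_2 I3_21.
Qed.

End Indices.

Section Rho.
Variable R : realType.
Notation C := (R[i]%C).
Implicit Types (j k : 'I_3) (z : C) (v : 'rV[C]_3).

(* The sides (z, 1, -1-z) of a triangle, listed from the j-th one on. *)
Definition rho j z : 'rV[C]_3 :=
  \row_k (if k == j then z else if k == j + 1 then 1 else - (1 + z)).

Lemma rho0 j z : rho j z 0 j = z. Proof. by rewrite mxE eqxx. Qed.
Lemma rho1 j z : rho j z 0 (j + 1) = 1. Proof. by rewrite mxE I3_1 eqxx. Qed.
Lemma rho2 j z : rho j z 0 (j + 2%:R) = - (1 + z).
Proof. by rewrite mxE I3_2 I3_21. Qed.

Lemma sum_rho j z : \sum_k rho j z 0 k = 0.
Proof. by rewrite (sum_I3 j) rho0 rho1 rho2; ring. Qed.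

Lemma rho_neq0 j z : rho j z != 0.
Proof.
by apply/eqP => /rowP/(_ (j + 1)); rewrite rho1 mxE => /eqP; rewrite oner_eq0.
Qed.

Lemma cnorm_rho j z : cnorm (rho j z) != 0.
Proof. by rewrite cnorm_eq0 rho_neq0. Qed.

Lemma rho_ratio j v : \sum_k v 0 k = 0 -> v 0 (j + 1) != 0 ->
  v = v 0 (j + 1) *: rho j (v 0 j / v 0 (j + 1)).
Proof.
move=> s0 v1; apply/rowP => k; rewrite mxE.
case: (I3_cases j k) => ->; rewrite ?rho0 ?rho1 ?rho2.
- by rewrite mulrC divfK.
- by rewrite mulr1.
- rewrite mulrN mulrDr mulr1 [_ * (_ / _)]mulrC divfK //.
  by move/eqP: s0; rewrite (sum_I3 j) addr_eq0 => /eqP E; rewrite -[LHS]opprK -E addrC.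
Qed.

(** If two entries vanished, the zero sum would force the third to vanish too. *)
Lemma exists_two_sides v : v != 0 -> \sum_k v 0 k = 0 ->
  exists j, v 0 (j + 1) != 0 /\ v 0 (j + 2%:R) != 0.
Proof.
move=> v0 s0; have [i vi] := neq0_coord v0; rewrite (sum_I3 i) in s0.
have [v1|v1] := eqVneq (v 0 (i + 1)) 0.
  exists (i + 1); rewrite I3_add11 I3_add12; split=> //.
  apply: contraNneq vi => v2; move: s0; rewrite v1 v2 !addr0 => ->; exact/eqP.
by exists (i + 2%:R); rewrite I3_add21 I3_add22.
Qed.

Lemma creg_rho (X : rspace R) j (z : X -> C) k :
  creg z -> creg (fun x => rho j (z x) 0 k).
Proof.
move=> rz; case: (I3_cases j k) => ->.
- by apply: creg_eq rz => x; rewrite rho0.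
- by apply: creg_eq (creg_cst _ 1) => x; rewrite rho1.
- apply: (@creg_eq _ _ (fun x => - (1 + z x))) => [x|]; first by rewrite rho2.
  by cregs.
Qed.

Lemma creg_cnorm_rho (X : rspace R) j (z : X -> C) :
  creg z -> creg (fun x => (cnorm (rho j (z x)))^-1).
Proof.
move=> rz; apply: cregV => [|x]; last exact: cnorm_rho.
apply: creg_sum => k; have := creg_rho j k rz => H.
by apply: cregM => //; apply: creg_conj.
Qed.

End Rho.

(** * The complex projective line of side ratios *)

Section ProjectiveX.
Variable R : realType.
Notation C := (R[i]%C).
Implicit Types (j k : 'I_3) (z : C) (L : PX R).

Definition pxv L : 'rV[C]_3 := hrep (\val L).

Lemma pxv_neq0 L : pxv L != 0. Proof. exact: hrep_neq0. Qed.

Lemma sum_pxv L : \sum_k pxv L 0 k = 0.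
Proof. by apply: (val_in L); exact: memv_pick. Qed.

Lemma cp_coord_pxv k L : (cp_coord k k (\val L) == 0) = (pxv L 0 k == 0).
Proof.
rewrite /cp_coord !mulf_eq0 conjc_neq0 invr_eq0 orbb.
by rewrite [X in _ || X](_ : _ = false) ?orbF //; apply/negbTE; rewrite cnorm_eq0 hrep_neq0.
Qed.

Lemma mkPX_in j z : [set L : proj_pt C 2 |
  forall v : 'rV[C]_3, v \in pline L -> \sum_k v 0 k = 0] (mkline (rho j z)).
Proof.
move=> v; have [_ ->] := hcoord_mkline (rho_neq0 j z) => /vlineP[c ->].
under eq_bigr do rewrite mxE.
by rewrite -mulr_sumr sum_rho mulr0.
Qed.

Definition mkPX j z : PX R := insp (@mkPX_in j z).

Lemma hcoord_mkPX j z : hcoord (\val (mkPX j z)) (rho j z).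
Proof. exact: hcoord_mkline (rho_neq0 j z). Qed.

Lemma pxv_mkPX j z : exists c : C, c != 0 /\ pxv (mkPX j z) = c *: rho j z.
Proof. exact: hrep_scale (hcoord_mkPX j z). Qed.

Definition zetaP j L : C := pxv L 0 j / pxv L 0 (j + 1).

Definition two_sidesP j : set (PX R) :=
  [set L | pxv L 0 (j + 1) != 0 /\ pxv L 0 (j + 2%:R) != 0].

Lemma zetaP_mkPX j z : zetaP j (mkPX j z) = z.
Proof.
have [c [c0 E]] := pxv_mkPX j z; rewrite /zetaP E.
rewrite [X in X / _]mxE [X in _ / X]mxE rho0 rho1 mulr1.
by rewrite mulrC mulKf.
Qed.

Lemma two_sidesP_mkPX j z : two_sidesP j (mkPX j z) <-> 1 + z != 0.
Proof.
have [c [c0 E]] := pxv_mkPX j z; rewrite /two_sidesP /= E.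
rewrite [X in X != 0 /\ _]mxE [X in _ /\ X != 0]mxE rho1 rho2 mulr1 mulrN oppr_eq0.
rewrite mulf_eq0 (negbTE c0) /=.
by split=> [[]|].
Qed.

Lemma mkPX_zetaP j L : two_sidesP j L -> mkPX j (zetaP j L) = L.
Proof.
move=> [v1 _]; apply: insp_inj.
apply: (proj_pt_eq (hcoord_mkPX j (zetaP j L))).
apply: (hcoord_of_scale v1); exact: rho_ratio (sum_pxv L) v1.
Qed.

Lemma zetaP_neqN1 j L : two_sidesP j L -> 1 + zetaP j L != 0.
Proof. by move=> h; apply/(two_sidesP_mkPX j); rewrite mkPX_zetaP. Qed.

Lemma morph_mkPX (X : rspace R) j (z : X -> C) :
  creg z -> is_morphism (fun x => mkPX j (z x)).
Proof.
move=> rz; apply: morph_PX => k l.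
apply: (@creg_eq _ _ (fun x => rho j (z x) 0 k * (rho j (z x) 0 l)^*%C /
   cnorm (rho j (z x)))) => [x|]; first by rewrite (cp_coordE _ _ (hcoord_mkPX _ _)).
have := creg_rho j k rz; have := creg_rho j l rz; have := creg_cnorm_rho j rz.
by move=> *; cregs.
Qed.

Lemma open_two_sidesP j : zopen (two_sidesP j).
Proof.
have := zopenI (open_creg (creg_PX R (j + 1) (j + 1)))
  (open_creg (creg_PX R (j + 2%:R) (j + 2%:R))).
congr zopen; apply/seteqP; split=> L /=; by rewrite /two_sidesP /= !cp_coord_pxv.
Qed.

Lemma creg_zetaP j :
  @creg _ (subspace (two_sidesP j))
    (fun y : subspace (two_sidesP j) => zetaP j (\val y)).
Proof.
pose S := subspace (two_sidesP j).
have mv : @is_morphism _ S (PX R) (fun y => \val y) by exact: morph_val.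
have r1 : creg (fun y : S => cp_coord j (j + 1) (\val (\val y))).
  exact: (creg_comp mv (creg_PX R _ _)).
have r2 : creg (fun y : S => cp_coord (j + 1) (j + 1) (\val (\val y))).
  exact: (creg_comp mv (creg_PX R _ _)).
have n0 (y : S) : pxv (\val y) 0 (j + 1) != 0 by case: (val_in y).
apply: (@creg_eq _ S (fun y => cp_coord j (j + 1) (\val (\val y)) /
   cp_coord (j + 1) (j + 1) (\val (\val y)))).
  move=> y; have := n0 y; rewrite /zetaP /cp_coord -/(pxv (\val y)) => h.
  have := cnorm_eq0 (pxv (\val y)); rewrite (negbTE (pxv_neq0 _)) => /negbT c0.
  by field; rewrite c0 conjc_neq0 h.
cregs => y; by rewrite cp_coord_pxv.
Qed.

Lemma two_sidesP_cover L : exists j, two_sidesP j L.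
Proof. exact: exists_two_sides (pxv_neq0 L) (sum_pxv L). Qed.

(** When one side vanishes the zero sum makes the other two opposite, so the line is one of the
    three listed points. *)
Lemma class_centersE L : class_centers L <-> exists k, pxv L 0 k = 0.
Proof.
pose o0 : 'I_3 := ord0; pose o1 : 'I_3 := 1; pose o2 : 'I_3 := 2%:R.
have key a b c : hcoord (\val L) (row3 a b c) ->
    exists d : C, [/\ pxv L 0 o0 = d * a, pxv L 0 o1 = d * b & pxv L 0 o2 = d * c].
  by move=> /hrep_scale[d [_ E]]; exists d; rewrite /pxv E !mxE.
have key2 a b c (d : C) : d != 0 -> pxv L 0 o0 = d * a -> pxv L 0 o1 = d * b ->
    pxv L 0 o2 = d * c -> hcoord (\val L) (row3 a b c).
  move=> d0 E0 E1 E2; apply: (hcoord_of_scale d0); apply/rowP => k; rewrite !mxE.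
  case: (I3_cases o0 k) => ->; [rewrite -[LHS]/(pxv L 0 o0) E0|
    rewrite -[LHS]/(pxv L 0 (o0 + 1))|rewrite -[LHS]/(pxv L 0 (o0 + 2%:R))] => //=.
  - by rewrite add0r E1.
  - by rewrite add0r E2.
split=> [[]/key[d [E0 E1 E2]]|[k]].
- by exists o0; rewrite E0 mulr0.
- by exists o1; rewrite E1 mulr0.
- by exists o2; rewrite E2 mulr0.
have s := sum_pxv L; rewrite (sum_I3 o0) -/o0 !add0r -/o1 -/o2 in s.
have nz : ~ (pxv L 0 o0 = 0 /\ pxv L 0 o1 = 0).
  move=> [E0 E1]; have /eqP := pxv_neq0 L; apply; apply/rowP => l; rewrite [RHS]mxE.
  by case: (I3_cases o0 l) => ->; rewrite ?add0r //; move: s; rewrite E0 E1 !add0r.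
case: (I3_cases o0 k) => ->; rewrite ?add0r -/o1 -/o2 => E.
- constructor 1; apply: (key2 _ _ _ (pxv L 0 o1)); rewrite ?mulr0 ?mulr1 ?mulrN1 //.
    by apply/eqP => E1; apply: nz.
  by move/eqP: s; rewrite E add0r addr_eq0 => /eqP ->; rewrite opprK.
- constructor 2; apply: (key2 _ _ _ (pxv L 0 o0)); rewrite ?mulr0 ?mulr1 ?mulrN1 //.
    by apply/eqP => E1; apply: nz.
  by move/eqP: s; rewrite E addr0 addr_eq0 => /eqP ->; rewrite opprK.
- constructor 3; apply: (key2 _ _ _ (pxv L 0 o0)); rewrite ?mulr0 ?mulr1 ?mulrN1 //.
    apply/eqP => E0; apply: nz; split=> //.
    by move: s; rewrite E E0 add0r addr0.
  by move/eqP: s; rewrite E addr0 addr_eq0 => /eqP ->; rewrite opprK.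
Qed.

Lemma class_centers_zetaP j L :
  two_sidesP j L -> (class_centers L <-> zetaP j L = 0).
Proof.
move=> [v1 v2]; rewrite class_centersE /zetaP; split=> [[k]|/eqP].
  by case: (I3_cases j k) => -> E; rewrite ?E ?mul0r //;
    move: v1 v2; rewrite E eqxx.
by rewrite mulf_eq0 invr_eq0 (negbTE v1) orbF => /eqP; exists j.
Qed.

Lemma zclosed_class_centers : zclosed (@class_centers R).
Proof.
have m3 (a b c : C) : (a * (b * c) == 0) = [|| a == 0, b == 0 | c == 0].
  by rewrite !mulf_eq0.
pose p L : C := cp_coord 0 0 (\val L) * (cp_coord 1 1 (\val L) * cp_coord 2%:R 2%:R (\val L)).
have rp : creg p by do 2! (apply: cregM; first exact: creg_PX); exact: creg_PX.
have := closed_creg rp; congr zclosed; apply/seteqP; split=> L /=; rewrite /p.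
  move=> /eqP; rewrite m3 !cp_coord_pxv class_centersE.
  by move=> /or3P[]/eqP E; [exists 0|exists 1|exists 2%:R].
rewrite class_centersE => -[k /eqP E]; apply/eqP; rewrite m3 !cp_coord_pxv.
by move: E; case: (I3_cases 0 k) => ->; rewrite ?add0r => ->; rewrite ?orbT.
Qed.

End ProjectiveX.

(** * Charts of the blowup of C at the origin *)

Section MobiusCharts.
Variable R : realType.
Notation C := (R[i]%C).
Implicit Types (b : bool) (z e : C) (u n : R).

Definition chart_unit b : C := if b then 'i%C else 1.
(** The value of [dir] at [chart_unit b]. Multiplying by it rotates the circle so that the direction
    missed by the chart is always at -1. *)
Definition chart_sign b : C := if b then -1 else 1.

Definition mobd b n : C := chart_unit b * (1 +i* n)%C.
Definition mobz b u n : C := u%:C%C * mobd b n.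
Definition mobu b z : R := complex.Re (z * (chart_unit b)^*%C).
(** The half-angle formula tan s = sin 2s / (1 + cos 2s): the slope of a line, read from its doubled
    angle. *)
Definition mobn b e : R := complex.Im (chart_sign b * e) / (1 + complex.Re (chart_sign b * e)).

Lemma kap_neq0 b : chart_unit b != 0.
Proof. by case: b; rewrite /chart_unit ?oner_neq0 // eq_complex /= oner_eq0 andbF. Qed.

Lemma mobd_neq0 b n : mobd b n != 0.
Proof. by rewrite mulf_neq0 ?kap_neq0 // eq_complex /= oner_eq0. Qed.

Lemma kapJ b : chart_unit b * (chart_unit b)^*%C = 1.
Proof.
case: b; apply/eqP; rewrite eq_complex /=; apply/andP; split; apply/eqP; ring.
Qed.

Lemma dir_kap b : dir (chart_unit b) = chart_sign b.
Proof.
by rewrite /dir; case: b; apply/eqP; rewrite eq_complex /=; apply/andP; split;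
  apply/eqP; field.
Qed.

Lemma sg2 b : chart_sign b * chart_sign b = 1.
Proof. by case: b; rewrite /chart_sign ?mulrNN mulr1. Qed.

Lemma dir_mobd b n : dir (mobd b n) = chart_sign b * dir (1 +i* n)%C.
Proof. by rewrite dirM dir_kap. Qed.

Lemma dir1i n : dir (1 +i* n)%C =
  (((1 - n ^+ 2) / (1 + n ^+ 2)) +i* (2 * n / (1 + n ^+ 2)))%C.
Proof.
have p : 1 + n ^+ 2 != 0 by rewrite gt_eqF // ltr_pwDl ?sqr_ge0.
by rewrite /dir; apply/eqP; rewrite eq_complex /= sqrrN expr1n; apply/andP;
  split; apply/eqP; field.
Qed.

(** The unit circle meets the vertical line Re = -1 only at -1. *)
Lemma unit_1Re_neq0 (e : C) : e^*%C * e = 1 -> 1 + e != 0 -> 1 + complex.Re e != 0.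
Proof.
case: e => x y [] /= E _ h; apply: contraNneq h => x1; rewrite eq_complex /= x1 eqxx /=.
rewrite add0r -sqrf_eq0; apply/eqP.
have xE : x = -1 by lra.
by move: E; rewrite xE; nra.
Qed.

(** For x^2 + y^2 = 1 and n = y / (1 + x) one has 1 + n^2 = 2 / (1 + x) and 1 - n^2 = 2x / (1 + x);
    substitute in the rational parametrization [dir1i]. *)
Lemma stereographic (e : C) : e^*%C * e = 1 -> 1 + e != 0 ->
  dir (1 +i* (complex.Im e / (1 + complex.Re e)))%C = e.
Proof.
move=> E h; have := unit_1Re_neq0 E h; rewrite dir1i.
case: e E {h} => x y [] /= E _ h.
have E' : y ^+ 2 = 1 - x ^+ 2 by lra.
have d : 1 + (y / (1 + x)) ^+ 2 = 2 / (1 + x).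
  by rewrite exprMn exprVn E'; field.
have d' : 1 - (y / (1 + x)) ^+ 2 = 2 * x / (1 + x).
  by rewrite exprMn exprVn E'; field.
rewrite d d'; apply/eqP; rewrite eq_complex /=; apply/andP; split; apply/eqP;
  by field; rewrite h.
Qed.

Lemma e2_sg_unit b (t : Rpi R) : (chart_sign b * e2 t)^*%C * (chart_sign b * e2 t) = 1.
Proof.
rewrite rmorphM /= mulrACA e2_unit mulr1.
by case: b; rewrite /chart_sign ?rmorphN rmorph1 ?mulrNN mulr1.
Qed.

Lemma mob_chart_dir b (t : Rpi R) : 1 + chart_sign b * e2 t != 0 ->
  argpi (mobd b (mobn b (e2 t))) = t.
Proof.
move=> h; apply: e2_inj; rewrite e2_argpi ?mobd_neq0 // dir_mobd stereographic //.
  by rewrite mulrA sg2 mul1r.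
exact: e2_sg_unit.
Qed.

Lemma mob_chart_u b u n : mobu b (mobz b u n) = u.
Proof.
rewrite /mobu /mobz /mobd.
have -> : u%:C%C * (chart_unit b * (1 +i* n)%C) * (chart_unit b)^*%C = u%:C%C * (1 +i* n)%C.
  by rewrite -[RHS]mulr1 -(kapJ b); ring.
by rewrite /= mulr1 mul0r subr0.
Qed.

(** The relation puts z on the line of angle t, so z is a real multiple of [mobd], and [mobu] reads
    off the factor. *)
Lemma mob_chart_z b z (t : Rpi R) : z^*%C * e2 t = z -> 1 + chart_sign b * e2 t != 0 ->
  mobz b (mobu b z) (mobn b (e2 t)) = z.
Proof.
move=> E h; have h1 := unit_1Re_neq0 (e2_sg_unit b t) h.
have /real_multiple[|s zs] : z^*%C * dir (mobd b (mobn b (e2 t))) = z.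
- by rewrite -e2_argpi ?mobd_neq0 // mob_chart_dir.
- exact: mobd_neq0.
by rewrite zs -/(mobz b s _) mob_chart_u.
Qed.

Lemma mob_chart_mob b u n :
  (mobz b u n)^*%C * e2 (argpi (mobd b n)) = mobz b u n.
Proof.
rewrite e2_argpi ?mobd_neq0 // /mobz rmorphM /= -mulrA conj_mul_dir.
by rewrite oppr0.
Qed.

Lemma sg_e2_mobd b n : chart_sign b * e2 (argpi (mobd b n)) = dir (1 +i* n)%C.
Proof. by rewrite e2_argpi ?mobd_neq0 // dir_mobd mulrA sg2 mul1r. Qed.

Lemma mob_chart_dom b n : 1 + chart_sign b * e2 (argpi (mobd b n)) != 0.
Proof.
have p : 0 < 1 + n ^+ 2 by rewrite ltr_pwDl ?sqr_ge0.
rewrite sg_e2_mobd dir1i eq_complex /= negb_and; apply/orP; left.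
have -> : 1 + (1 - n ^+ 2) / (1 + n ^+ 2) = 2 / (1 + n ^+ 2).
  by field; rewrite gt_eqF.
by rewrite mulf_neq0 // ?pnatr_eq0 // invr_eq0 gt_eqF.
Qed.

Lemma mob_chart_n b n : mobn b (e2 (argpi (mobd b n))) = n.
Proof.
have p : 1 + n ^+ 2 != 0 by rewrite gt_eqF // ltr_pwDl ?sqr_ge0.
rewrite /mobn sg_e2_mobd dir1i /=.
have -> : 1 + (1 - n ^+ 2) / (1 + n ^+ 2) = 2 / (1 + n ^+ 2) by field.
by field.
Qed.

(** The directions missed by the two charts are opposite points of the circle. *)
Lemma mob_chart_cover (t : Rpi R) : exists b, 1 + chart_sign b * e2 t != 0.
Proof.
have [E|h] := eqVneq (1 + e2 t) 0; last by exists false; rewrite mul1r.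
exists true; rewrite mulN1r; move/eqP: E; rewrite addrC addr_eq0 => /eqP ->.
by rewrite opprK -[1 + 1]/(2%:R) pnatr_eq0.
Qed.

Lemma reg_mobu (X : rspace R) b (z : X -> C) : creg z -> reg (fun x => mobu b (z x)).
Proof. by move=> rz; have [] : creg (fun x => z x * (chart_unit b)^*%C) by cregs. Qed.

Lemma reg_mobn (X : rspace R) b (t : X -> Rpi_space R) :
  is_morphism t -> (forall x, 1 + chart_sign b * e2 (t x) != 0) ->
  reg (fun x => mobn b (e2 (t x))).
Proof.
move=> mt h; have re : creg (fun x => e2 (t x)) by exact: (creg_comp mt (creg_e2 R)).
have [r1 r2] : creg (fun x => chart_sign b * e2 (t x)) by cregs.
apply: regM => //; apply: regV; first by apply: regD => //; exact: reg_cst.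
by move=> x; apply: unit_1Re_neq0 => //; exact: e2_sg_unit.
Qed.

Section FunRing.
Variables (T : Type) (A : (T -> R) -> Prop) (Ar : fun_ring A) (b : bool).
Variables (u n : T -> R) (Au : A u) (An : A n).

Lemma cfun_mobd : cfun A (fun x => mobd b (n x)).
Proof.
apply: (cfunM Ar); first exact: cfun_cst.
by have [Ac _ _] := Ar; split=> //=; exact: Ac.
Qed.

Lemma cfun_mobz : cfun A (fun x => mobz b (u x) (n x)).
Proof. by apply: (cfunM Ar); [exact: cfun_real|exact: cfun_mobd]. Qed.

(** The real function |1 + z|^2, whose nonvanishing expresses z != -1; in the charts it is the
    polynomial cutting out a principal open set. *)
Lemma fun_norm1p (z : T -> C) : cfun A z ->
  A (fun x => complex.Re ((1 + z x) * (1 + z x)^*%C)).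
Proof.
move=> cz; have c1 : cfun A (fun x => 1 + z x) by apply: (cfunD Ar) => //; exact: cfun_cst.
by have [] := cfunM Ar c1 (cfun_conj Ar c1).
Qed.

End FunRing.

Lemma Re_mulJ_eq0 (z : C) : (complex.Re (z * z^*%C) == 0) = (z == 0).
Proof. by rewrite -sqr_norm_eq0; case: z => x y /=; rewrite mulrN opprK -!expr2. Qed.

Lemma morph_argpi_mobd (X : rspace R) b (n : X -> R) :
  reg n -> @is_morphism _ X (Rpi_space R) (fun x => argpi (mobd b (n x))).
Proof.
move=> rn; apply: morph_Rpi.
apply: (@creg_eq _ _ (fun x => dir (mobd b (n x)))).
  by move=> x; rewrite e2_argpi // mobd_neq0.
have r := cfun_mobd (reg_ring X) b rn; rewrite -/(creg _) in r.
by rewrite /dir; cregs => x; rewrite conjc_neq0 mobd_neq0.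
Qed.

End MobiusCharts.

(** * Similarity classes *)

Section ClassSpace.
Variable R : realType.
Notation C := (R[i]%C).
Implicit Types (j k : 'I_3) (z : C) (L : PX R) (tau : TT R).

(** Passing between representatives of L multiplies all sides by one complex number; this shifts all
    three directions by the same angle and leaves their differences unchanged. *)
Lemma triangle_classesE L tau : triangle_classes (L, tau) <->
  exists xi : 'I_3 -> Rpi R,
    (forall k, pxv L 0 k != 0 -> xi k = argpi (pxv L 0 k)) /\
    (forall k, \val tau k = xi (k + 1) - xi (k + 2%:R)).
Proof.
split.
  move=> [[[[B abc] p] xi] [[w [hw _ _ xiw]] [[w' [hw' hL]] tauE]]].
  have [c [c0 wE]] := hcoord_scale hw hw'.
  have [d [d0 vE]] := hrep_scale hL.
  rewrite wE complexifyZ scalerA in vE.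
  have e0 : d * c%:C%C != 0 by rewrite mulf_neq0 // realC_neq0.
  set e := d * c%:C%C in vE e0.
  exists (fun k => xi k + argpi e); split=> k; last first.
    by rewrite tauE opprD addrACA subrr addr0.
  rewrite /pxv vE mxE mulf_eq0 negb_or => /andP[_ wk].
  rewrite (argpi_mul e0 wk) addrC; congr (_ + _); rewrite xiw //.
  by rewrite /argpi mxE.
move=> [xi [xiV tauE]].
have z0 : [set v : 'rV[C]_3 | \sum_j v 0 j = 0] 0.
  by rewrite /= big1 // => k _; rewrite mxE.
have v0 := pxv_neq0 L.
have rv0 : realify (pxv L) != 0 by rewrite realify_eq0.
(* The class is realized by a triangle shrunk to a point, whose shape survives in its projective
   component. *)
exists ((0 : C0 R, (insp z0 : XX R)), (mkline (realify (pxv L)) : RP R 5), xi); split.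
  exists (realify (pxv L)); split.
  - exact: hcoord_mkline.
  - by rewrite /= eqxx.
  - move=> _; have := sum_pxv L; rewrite (sum_I3 0) => /eqP; rewrite eq_complex.
    rewrite !(sum_I3 0) !realify_re !realify_im.
    by case: (pxv L 0 _) => ? ?; case: (pxv L 0 _) => ? ?; case: (pxv L 0 _) => ? ? /=
      => /andP[/eqP -> /eqP ->].
  - by move=> k; rewrite realifyK realify_re realify_im => /xiV.
split=> //=; exists (realify (pxv L)); split; first exact: hcoord_mkline.
by rewrite realifyK; exact: hcoord_hrep.
Qed.

Definition mobD : set (prod_space (C0 R) (Rpi_space R)) :=
  [set p : C * Rpi R | 1 + p.1 != 0 /\ (p.1)^*%C * e2 p.2 = p.1].

(** The directions of the sides j+1 and j+2 are forced, and their quotient -(1 + zeta) gives the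
    angle j. The angle j+2 is the direction of side j minus that of side j+1: the direction of zeta
    if zeta != 0, arbitrary otherwise. The angle j+1 follows from the zero sum. *)
Lemma triangle_classes_local j L tau : two_sidesP j L ->
  (triangle_classes (L, tau) <->
   \val tau j = - argpi (- (1 + zetaP j L)) /\
   (zetaP j L)^*%C * e2 (\val tau (j + 2%:R)) = zetaP j L).
Proof.
move=> UL; have [v1 v2] := UL; have z1 := zetaP_neqN1 UL.
have vE := rho_ratio (sum_pxv L) v1; rewrite -/(zetaP j L) in vE.
have E0 : pxv L 0 j = pxv L 0 (j + 1) * zetaP j L.
  by rewrite mulrC /zetaP divfK.
have E2 : pxv L 0 (j + 2%:R) = pxv L 0 (j + 1) * - (1 + zetaP j L).
  by rewrite {1}vE mxE rho2.
have nz1 : - (1 + zetaP j L) != 0 by rewrite oppr_eq0.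
have key1 (x y : Rpi R) : x - (x + y) = - y by rewrite opprD addNKr.
have key2 (x a t b : Rpi R) : - a + x + t = 0 -> x = b + a - (t + b).
  move=> E; have -> : x = a + (- a + x + t) - t by rewrite !addrA subrr add0r addrK.
  by rewrite E addr0 opprD [in RHS](addrC b) addrACA subrr addr0.
rewrite triangle_classesE; split.
  move=> [xi [xiV tauE]]; rewrite !tauE I3_add21 I3_add22 (xiV (j + 1)) // (xiV (j + 2%:R)) //.
  split; first by rewrite E2 argpi_mul // key1.
  have [->|z0] := eqVneq (zetaP j L) 0; first by rewrite rmorph0 mul0r.
  rewrite xiV; last by rewrite E0 mulf_neq0.
  by rewrite E0 argpi_mul // addrC addKr e2_argpi // conj_mul_dir.
move=> [tj t2].
(* The direction of side j is read from the angle j+2, so that it is also chosen correctly when the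
   side vanishes. *)
exists (fun k => if k == j then \val tau (j + 2%:R) + argpi (pxv L 0 (j + 1))
                 else argpi (pxv L 0 k)); split=> k.
  case: (k =P j) => [->|//]; rewrite {1}E0 mulf_eq0 negb_or => /andP[_ z0].
  rewrite E0 argpi_mul // addrC; congr (_ + _).
  by apply: e2_inj; rewrite e2_argpi //; apply: conj_mul_eq.
have sumt : \val tau j + \val tau (j + 1) + \val tau (j + 2%:R) = 0.
  by rewrite -(sum_I3 j); exact: (val_in tau).
case: (I3_cases j k) => ->; rewrite ?I3_add11 ?I3_add12 ?I3_add21 ?I3_add22
  ?I3_1 ?I3_2 ?eqxx.
- by rewrite tj E2 argpi_mul // key1.
- by rewrite E2 argpi_mul //; apply: key2; rewrite -tj.
- by rewrite addrK.
Qed.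

Definition angles j z (t : Rpi R) k : Rpi R :=
  if k == j then - argpi (- (1 + z)) else
  if k == j + 1 then argpi (- (1 + z)) - t else t.

Lemma angles_in j z t :
  [set tau : 'I_3 -> Rpi R | \sum_k tau k = 0] (angles j z t).
Proof.
rewrite /= (sum_I3 j) /angles !eqxx I3_1 I3_2 I3_21.
by rewrite addrA addNr add0r addNr.
Qed.

Definition mkTT j z t : TT R := insp (@angles_in j z t).

Lemma mkD_in j (p : subspace mobD) :
  triangle_classes (mkPX j (\val p).1, mkTT j (\val p).1 (\val p).2).
Proof.
have [z1 zt] := val_in p; have U := (two_sidesP_mkPX j _).2 z1.
by apply/(triangle_classes_local _ U); rewrite zetaP_mkPX /= /angles eqxx I3_2 I3_21.
Qed.

Definition mkD j (p : subspace mobD) : class_space R := insp (mkD_in j p).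

Lemma morph_mkD j : is_morphism (mkD j).
Proof.
pose Q := prod_space (C0 R) (Rpi_space R).
have mv : @is_morphism _ (subspace mobD) Q (fun p => \val p) by exact: morph_val.
have rz : creg (fun p : subspace mobD => (\val p).1 : C).
  exact: (creg_comp (morph_comp (@morph_fst _ (C0 R) (Rpi_space R)) mv) (creg_C0 R)).
have mt : @is_morphism _ (subspace mobD) (Rpi_space R) (fun p => (\val p).2).
  exact: morph_comp (@morph_snd _ (C0 R) (Rpi_space R)) mv.
have rt : creg (fun p : subspace mobD => e2 (\val p).2).
  exact: (creg_comp mt (creg_e2 R)).
have nz (p : subspace mobD) : - (1 + (\val p).1) != 0 :> C.
  by rewrite oppr_eq0; case: (val_in p).
have rd : creg (fun p : subspace mobD => dir (- (1 + (\val p).1))).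
  by rewrite /dir; cregs => p; rewrite conjc_neq0.
apply: morph_sub; apply: morph_prod; first exact: morph_mkPX.
apply: morph_sub; apply: morph_power => k; apply: morph_Rpi.
have dn (p : subspace mobD) : dir (- (1 + (\val p).1)) != 0 by apply: dir_neq0.
case: (I3_cases j k) => ->; rewrite /mkTT /= /angles ?eqxx ?I3_1 ?I3_2 ?I3_21.
- apply: (@creg_eq _ _ (fun p : subspace mobD => (dir (- (1 + (\val p).1)))^-1)).
    by move=> p; rewrite e2N (e2_argpi (nz p)).
  by cregs.
- apply: (@creg_eq _ _ (fun p : subspace mobD =>
      dir (- (1 + (\val p).1)) * (e2 (\val p).2)^-1)).
    by move=> p; rewrite e2B (e2_argpi (nz p)).
  by cregs => p; exact: e2_neq0.
- by [].
Qed.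

Definition cl_side (d : class_space R) : PX R := (\val d).1.
(** This is xi_j - xi_(j+1), the direction of the ratio of these sides, which stays free when side j
    vanishes. *)
Definition cl_angle j (d : class_space R) : Rpi R := \val (\val d).2 (j + 2%:R).

Lemma cl_side_mkD j p : cl_side (mkD j p) = mkPX j (\val p).1.
Proof. by []. Qed.

Lemma cl_angle_mkD j p : cl_angle j (mkD j p) = (\val p).2.
Proof. by rewrite /cl_angle /= /angles I3_2 I3_21. Qed.

Lemma cl_mob j d : two_sidesP j (cl_side d) ->
  mobD (zetaP j (cl_side d), cl_angle j d).
Proof.
move=> U; split; first exact: zetaP_neqN1.
have := val_in d; rewrite /cl_side in U *; rewrite /cl_angle.
by case: (\val d) U => L tau /= U /(triangle_classes_local _ U)[].
Qed.

Lemma class_ext j d d' : two_sidesP j (cl_side d) -> cl_side d = cl_side d' ->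
  cl_angle j d = cl_angle j d' -> d = d'.
Proof.
case: d => -[L tau] hd; case: d' => -[L' tau'] hd'.
rewrite /cl_side /cl_angle /= => U E; rewrite -{L'}E in hd' *.
move=> Et; apply: val_inj => /=; congr (_, _); apply: val_inj.
have [t0 _] := (triangle_classes_local tau U).1 (set_mem hd).
have [t0' _] := (triangle_classes_local tau' U).1 (set_mem hd').
have s : \sum_k \val tau k = 0 by exact: (val_in tau).
have s' : \sum_k \val tau' k = 0 by exact: (val_in tau').
have {}Et : \val tau (j + 2%:R) = \val tau' (j + 2%:R) := Et.
have key (a x y c : Rpi R) : a + x + c = 0 -> a + y + c = 0 -> x = y.
  by move=> <- /addIr/addrI.
rewrite (sum_I3 j) t0 Et in s; rewrite (sum_I3 j) t0' in s'.
apply/funext => k; case: (I3_cases j k) => ->; rewrite ?t0 ?t0' //.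
exact: key s s'.
Qed.

Lemma morph_cl_side : is_morphism cl_side.
Proof. exact: morph_comp (@morph_fst _ (PX R) (TT R)) (@morph_val _ _ _). Qed.

Lemma morph_cl_tau k :
  @is_morphism _ (class_space R) (Rpi_space R) (fun d => \val (\val d).2 k).
Proof.
pose P := power_space 3 (Rpi_space R).
have m1 : is_morphism (fun d : class_space R => (\val d).2).
  exact: morph_comp (@morph_snd _ (PX R) (TT R)) (@morph_val _ _ _).
have m2 : @is_morphism _ (class_space R) P (fun d => \val (\val d).2).
  exact: (morph_comp (@morph_val _ P _) m1).
exact (@morph_comp R _ P (Rpi_space R) (fun f => f k) _ (@morph_proj R 3 (Rpi_space R) k) m2).
Qed.

Lemma class_space_blowup : class_space_is_blowup R.
Proof.
split; [exact: zclosed_class_centers|exact: morph_cl_side|move=> L].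
have [j UL] := two_sidesP_cover L.
have rz := creg_zetaP R j.
have oU := @open_two_sidesP R j.
have Zz := @class_centers_zetaP R j.
have invP (q : subspace (zeta_model (two_sidesP j) (zetaP j))) :
    mobD (zetaP j (\val q).1, P1_to_Rpi (\val q).2).
  by have [Uq E] := val_in q; split=> //; exact: zetaP_neqN1.
pose inv q := mkD j (insp (invP q)).
have [||||||||psi [ipsi epsi]] := @blowup_zeta_local R (PX R) (@class_centers R) _ _
    oU rz Zz _ (class_space R) (@class_blowdown R) (cl_angle j) inv.
- move=> x m Ux Zx m0; exists (fun t => mkPX j (t%:C%C * m)); split.
  + apply: morph_mkPX; apply: cregM; last exact: creg_cst.
    by apply: creg_real; exact: reg_real_line.
  + by rewrite rmorph0 mul0r -[RHS](mkPX_zetaP Ux) ((Zz _ Ux).1 Zx).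
  + by move=> t _; rewrite zetaP_mkPX.
- exact: morph_cl_side.
- exact: (@morph_comp _ _ (class_space R) (Rpi_space R) _ _
    (morph_cl_tau _) (@morph_val _ _ _)).
- by move=> d /cl_mob[].
- apply: (morph_comp (morph_mkD j)); apply: morph_sub.
  pose S : rspace R := subspace (zeta_model (@two_sidesP R j) (@zetaP R j)).
  have mv : @is_morphism _ S (prod_space (PX R) (RP R 1)) (fun q => \val q).
    exact: morph_val.
  apply: morph_prod.
    apply: morph_C0.
    have US (q : S) : two_sidesP j (\val q).1 by case: (val_in q).
    pose r (q : S) : subspace (two_sidesP j) := insp (US q).
    have mr : is_morphism r.
      by apply: morph_sub; exact: morph_comp (@morph_fst _ (PX R) (RP R 1)) mv.
    exact: (creg_comp mr rz).
  exact: (@morph_comp _ _ (RP R 1) (Rpi_space R) _ _ (@morph_P1_to_Rpi R)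
    (morph_comp (@morph_snd _ (PX R) (RP R 1)) mv)).
- move=> q; rewrite -[RHS](@mkPX_zetaP _ j) //; by case: (val_in q).
- by move=> q; rewrite cl_angle_mkD.
- exact: class_ext.
exists (two_sidesP j), 1%N, (re_im (zetaP j)), psi; split=> //.
have rP : two_sidesP j (mkPX j (0 : C)).
  by apply/two_sidesP_mkPX; rewrite addr0 oner_neq0.
(* In this chart the center is the single point zeta = 0, so the retraction is constant. *)
pose r (_ : subspace (@two_sidesP R j)) : subspace (@two_sidesP R j) := insp rP.
apply: (@generate_ideal_zeta _ _ _ _ _ oU rz Zz r).
- move=> y zy; apply: insp_inj; rewrite /=.
  by rewrite -[RHS](mkPX_zetaP (val_in y)) zy.
- by move=> y; rewrite /= zetaP_mkPX.
(* On the chart the inclusion factors through zeta, whose real and imaginary parts generate the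
   ideal and hence are congruent. *)
apply: (@morph_eq _ _ _ (fun y : retr_space (re_im (zetaP j)) r =>
    mkPX j (zetaP j (\val (y : subspace (two_sidesP j)))))).
  by move=> y; rewrite mkPX_zetaP //; exact: (val_in (y : subspace (two_sidesP j))).
apply: morph_mkPX; apply: (creg_retr_zeta oU rz Zz) => y.
by rewrite /= zetaP_mkPX.
Qed.

End ClassSpace.

(** * Separation of points by regular functions *)

Section Separation.
Variable R : realType.
Notation C := (R[i]%C).

Lemma separated_by_creg (X : rspace R) :
  (forall x y : X, (forall f : X -> C, creg f -> f x = f y) -> x = y) ->
  separated X.
Proof.
move=> H; apply: separated_creg => x y xy; apply: contrapT => /forallNP nf.
apply: xy; apply: H => f rf; apply/eqP; apply: contrapT => /negP fxy.
by apply: (nf f).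
Qed.

(** A nonzero column of the projector spans the line. *)
Lemma cp_coord_inj n (L L' : proj_pt C n) :
  (forall i j, cp_coord i j L = cp_coord i j L') -> L = L'.
Proof.
move=> E; have [m hm] := neq0_coord (hrep_neq0 L).
have c0 (M : proj_pt C n) : cnorm (hrep M) != 0 :> C by rewrite cnorm_eq0 hrep_neq0.
have h' : hrep L' 0 m != 0.
  have : cp_coord m m L' != 0.
    by rewrite -E /cp_coord !mulf_neq0 ?conjc_neq0 // invr_eq0.
  by apply: contraNneq => h; rewrite /cp_coord h !mul0r.
have key (M : proj_pt C n) : hrep M 0 m != 0 ->
    hcoord M (\row_i (cp_coord i m M / cp_coord m m M)).
  move=> h; apply: (@hcoord_of_scale _ _ _ _ (hrep M 0 m)) => //.
  apply/rowP => i; rewrite !mxE /cp_coord.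
  by have := c0 M => c; field; rewrite h c conjc_neq0 h.
apply: (proj_pt_eq (key L hm)).
have := key L' h'; congr hcoord; apply/rowP => i; by rewrite !mxE !E.
Qed.

Lemma rp_coord_inj n (L L' : proj_pt R n) :
  (forall i j, rp_coord i j L = rp_coord i j L') -> L = L'.
Proof.
move=> E; have [m hm] := neq0_coord (hrep_neq0 L).
have c0 (M : proj_pt R n) : sqnorm (hrep M) != 0 :> R by rewrite sqnorm_eq0 hrep_neq0.
have h' : hrep L' 0 m != 0.
  have : rp_coord m m L' != 0.
    by rewrite -E /rp_coord !mulf_neq0 // invr_eq0.
  by apply: contraNneq => h; rewrite /rp_coord h !mul0r.
have key (M : proj_pt R n) : hrep M 0 m != 0 ->
    hcoord M (\row_i (rp_coord i m M / rp_coord m m M)).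
  move=> h; apply: (@hcoord_of_scale _ _ _ _ (hrep M 0 m)) => //.
  apply/rowP => i; rewrite !mxE /rp_coord.
  by have := c0 M => c; field; rewrite h c.
apply: (proj_pt_eq (key L hm)).
have := key L' h'; congr hcoord; apply/rowP => i; by rewrite !mxE !E.
Qed.

End Separation.

(** * Charts of the space of similarity classes *)

Section ClassCharts.
Variable R : realType.
Notation C := (R[i]%C).

Lemma separated_class_space : separated (class_space R).
Proof.
apply: separated_by_creg => d d' H.
have E1 : cl_side d = cl_side d'.
  apply: insp_inj; apply: cp_coord_inj => i j.
  exact: (H _ (creg_comp (@morph_cl_side R) (creg_PX R i j))).
have E2 k : \val (\val d).2 k = \val (\val d').2 k.
  apply: e2_inj; exact: (H _ (creg_comp (@morph_cl_tau R k) (creg_e2 R))).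
have [j Uj] := two_sidesP_cover (cl_side d).
exact: (class_ext Uj E1 (E2 _)).
Qed.

Variables (j : 'I_3) (b : bool).

Definition class_dom : set (class_space R) :=
  [set d | two_sidesP j (cl_side d) /\ 1 + chart_sign R b * e2 (cl_angle j d) != 0].

Lemma open_class_dom : zopen class_dom.
Proof.
apply: zopenI; first exact: (open_preim (@morph_cl_side R) (@open_two_sidesP R j)).
apply: (@open_creg _ (class_space R) (fun d => 1 + chart_sign R b * e2 (cl_angle j d))).
have re := creg_comp (@morph_cl_tau R (j + 2%:R)) (creg_e2 R).
by apply: cregD; [exact: creg_cst|apply: cregM; [exact: creg_cst|exact: re]].
Qed.

Definition class_chart (d : class_space R) : 'rV[R]_2 :=
  \row_i nth 0 [:: mobu b (zetaP j (cl_side d)); mobn b (e2 (cl_angle j d))] i.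

Definition class_z (v : 'rV[R]_2) : C := mobz b (v 0 ord0) (v 0 ord_max).
Definition class_t (v : 'rV[R]_2) : Rpi R := argpi (mobd b (v 0 ord_max)).

Lemma mobD0 : @mobD R (0, 0).
Proof. by split; [rewrite /= addr0 oner_neq0|rewrite rmorph0 mul0r]. Qed.

(* Values at points outside the chart domain are irrelevant. *)
Definition class_param (v : 'rV[R]_2) : class_space R :=
  mkD j (if pselect (mobD (class_z v, class_t v)) is left h then insp h
         else insp mobD0).

Lemma class_paramE v (h : mobD (class_z v, class_t v)) :
  class_param v = mkD j (insp h).
Proof.
by rewrite /class_param; case: pselect => // h'; congr mkD; apply: insp_inj.
Qed.

Definition class_q (v : 'rV[R]_2) : R :=
  complex.Re ((1 + class_z v) * (1 + class_z v)^*%C).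

Lemma class_q_mob v : class_q v != 0 -> mobD (class_z v, class_t v).
Proof.
rewrite /class_q Re_mulJ_eq0 => h; split=> //=; exact: mob_chart_mob.
Qed.

Lemma class_smooth_chart : smooth_affine_chart class_dom.
Proof.
apply: (@smooth_affine_chart_principal _ _ _ 2 class_chart class_param class_q).
- apply: (fun_norm1p (@polyfun_ring R 2)); apply: (cfun_mobz (@polyfun_ring R 2));
    exact: polyfun_coord.
- move=> i.
  have mv : @is_morphism _ (subspace class_dom) (class_space R) (fun d => \val d).
    exact: morph_val.
  have US (d : subspace class_dom) : two_sidesP j (cl_side (\val d)).
    by case: (val_in d).
  pose r (d : subspace class_dom) : subspace (@two_sidesP R j) := insp (US d).
  have mr : is_morphism r by apply: morph_sub; exact: (morph_comp (@morph_cl_side R) mv).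
  have rz := reg_mobu b (creg_comp mr (creg_zetaP R j)).
  have rn : reg (fun d : subspace class_dom => mobn b (e2 (cl_angle j (\val d)))).
    apply: (@reg_mobn _ _ b (fun d : subspace class_dom => cl_angle j (\val d))).
      exact: (@morph_comp _ _ (class_space R) (Rpi_space R) _ _ (@morph_cl_tau R _) mv).
    by move=> d; case: (val_in d).
  case: i => -[|[|//]] p.
  + by apply: reg_eq rz => d; rewrite mxE.
  + by apply: reg_eq rn => d; rewrite mxE.
- move=> d [Ud hd]; have [z1 zt] := cl_mob Ud.
  have zE : class_z (class_chart d) = zetaP j (cl_side d).
    by rewrite /class_z !mxE /= mob_chart_z.
  have tE : class_t (class_chart d) = cl_angle j d.
    by rewrite /class_t !mxE /= mob_chart_dir.
  split; first by rewrite /class_q zE Re_mulJ_eq0.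
  have h : mobD (class_z (class_chart d), class_t (class_chart d)) by rewrite zE tE.
  rewrite (class_paramE h); apply: (@class_ext _ j).
  + by rewrite cl_side_mkD /= zE mkPX_zetaP.
  + by rewrite cl_side_mkD /= zE mkPX_zetaP.
  + by rewrite cl_angle_mkD /= tE.
- move=> v /class_q_mob h; rewrite (class_paramE h); split.
    split; first by rewrite cl_side_mkD; apply/two_sidesP_mkPX; case: h.
    by rewrite cl_angle_mkD /=; exact: mob_chart_dom.
  rewrite /class_chart cl_side_mkD cl_angle_mkD zetaP_mkPX /=.
  apply/rowP => -[[|[|//]] p]; rewrite mxE /=.
  + by rewrite mob_chart_u; congr (v _ _); apply/val_inj.
  + by rewrite mob_chart_n; congr (v _ _); apply/val_inj.
- pose Q := subspace [set v : affine_space R 2 | class_q v != 0].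
  have mv : @is_morphism _ Q (affine_space R 2) (fun v => \val v) by exact: morph_val.
  have rc i : reg (fun v : Q => (\val v : 'rV[R]_2) 0 i).
    exact: (reg_comp mv (reg_polyfun (@polyfun_coord R 2 i))).
  have hP (v : Q) : mobD (class_z (\val v), class_t (\val v)).
    by apply: class_q_mob; exact: (val_in v).
  apply: (@morph_eq _ _ _ (fun v : Q => mkD j (insp (hP v)))).
    by move=> v; rewrite (class_paramE (hP v)).
  apply: (morph_comp (@morph_mkD R j)); apply: morph_sub; apply: morph_prod.
    by apply: morph_C0; exact: (cfun_mobz (reg_ring Q) b (rc _) (rc _)).
  exact: (morph_argpi_mobd b (rc ord_max)).
Qed.

End ClassCharts.

Lemma smooth_class_space (R : realType) : smooth_variety (class_space R).
Proof.
apply: (@smooth_variety_charts _ _ ('I_3 * bool)%type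
  (fun i => @class_dom R i.1 i.2)).
- exact: separated_class_space.
- move=> d; have [j Uj] := two_sidesP_cover (cl_side d).
  by have [b hb] := mob_chart_cover (cl_angle j d); exists (j, b).
- by move=> [j b]; split; [exact: open_class_dom|exact: class_smooth_chart].
Qed.

(** * The first blowup of the space of triangles *)

Section FirstBlowup.
Variable R : realType.
Notation C := (R[i]%C).
Implicit Types (j k : 'I_3).

Definition BX : rspace R := prod_space (C0 R) (XX R).

Definition abc (x : BX) : 'rV[C]_3 := \val x.2.

Lemma sum_abc (x : BX) : \sum_k abc x 0 k = 0.
Proof. exact: (val_in x.2). Qed.

Lemma creg_abc k : creg (fun x : BX => abc x 0 k).
Proof. exact: (creg_comp (@morph_snd _ (C0 R) (XX R)) (creg_XX R k)). Qed.

Lemma creg_B0 : creg (fun x : BX => x.1 : C).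
Proof. exact: (creg_comp (@morph_fst _ (C0 R) (XX R)) (creg_C0 R)). Qed.

Lemma BX_ext (x y : BX) : x.1 = y.1 -> abc x = abc y -> x = y.
Proof.
by case: x y => [B v] [B' v'] /= -> E; congr (_, _); apply: val_inj.
Qed.

Lemma mkXX_in (v : 'rV[C]_3) : \sum_k v 0 k = 0 -> [set v : 'rV[C]_3 | \sum_j v 0 j = 0] v.
Proof. by []. Qed.

Definition mkXX (v : 'rV[C]_3) (s0 : \sum_k v 0 k = 0) : XX R := insp (mkXX_in s0).

(** C0 times the tautological real line bundle over the real projectivization of X: a real line of
    side vectors together with a vector on it. *)
Definition yset : set (prod_space BX (RP R 5)) :=
  [set y : BX * RP R 5 | \sum_k sides y.2 0 k = 0 /\
     exists l : R, abc y.1 = l%:C%C *: sides y.2].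

Definition Ysp : rspace R := subspace yset.

Definition yB (y : Ysp) : C := (\val y).1.1.
Definition yabc (y : Ysp) : 'rV[C]_3 := abc (\val y).1.
Definition ylin (y : Ysp) : RP R 5 := (\val y).2.
Definition yW (y : Ysp) : 'rV[C]_3 := sides (ylin y).

Lemma sum_yW y : \sum_k yW y 0 k = 0. Proof. by case: (val_in y). Qed.

Lemma yW_neq0 y : yW y != 0. Proof. exact: sides_neq0. Qed.

Lemma yabcE y : exists l : R, yabc y = l%:C%C *: yW y.
Proof. by case: (val_in y). Qed.

Lemma Ysp_ext (y y' : Ysp) :
  yB y = yB y' -> yabc y = yabc y' -> ylin y = ylin y' -> y = y'.
Proof.
move=> EB Ea El; apply: insp_inj.
rewrite [LHS]surjective_pairing [RHS]surjective_pairing; congr (_, _) => //.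
exact: BX_ext.
Qed.

Lemma morph_yval : @is_morphism _ Ysp (prod_space BX (RP R 5)) (fun y => \val y).
Proof. exact: morph_val. Qed.

Lemma morph_ypr : is_morphism (fun y : Ysp => (\val y).1 : BX).
Proof. exact: (morph_comp (@morph_fst _ BX (RP R 5)) morph_yval). Qed.

Lemma morph_ylin : is_morphism ylin.
Proof. exact: (morph_comp (@morph_snd _ BX (RP R 5)) morph_yval). Qed.

Lemma creg_yB : creg yB. Proof. exact: (creg_comp morph_ypr creg_B0). Qed.

Lemma creg_yabc k : creg (fun y => yabc y 0 k).
Proof. exact: (creg_comp morph_ypr (creg_abc k)). Qed.

Lemma creg_ysym k l : creg (fun y => side_sym k l (ylin y)).
Proof. exact: (creg_comp morph_ylin (creg_RP5 R k l).1). Qed.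

Lemma creg_yherm k l : creg (fun y => side_herm k l (ylin y)).
Proof. exact: (creg_comp morph_ylin (creg_RP5 R k l).2). Qed.

Lemma morph_Ysp (X : rspace R) (f : X -> Ysp) :
  creg (fun x => yB (f x)) -> (forall k, creg (fun x => yabc (f x) 0 k)) ->
  is_morphism (fun x => ylin (f x)) -> is_morphism f.
Proof.
move=> rB rabc ml; apply: morph_sub; apply: morph_prod; last exact: ml.
by apply: morph_prod; [exact: morph_C0|exact: morph_XX].
Qed.

Lemma yherm_eq0 k y : (side_herm k k (ylin y) == 0) = (yW y 0 k == 0).
Proof.
rewrite /side_herm !mulf_eq0 conjc_neq0 invr_eq0 orbb.
by rewrite [X in _ || X](_ : _ = false) ?orbF //; apply/negbTE/cnorm_sides.
Qed.

Definition two_sidesY j : set Ysp :=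
  [set y | yW y 0 (j + 1) != 0 /\ yW y 0 (j + 2%:R) != 0].

Lemma open_two_sidesY j : zopen (two_sidesY j).
Proof.
have := zopenI (open_creg (creg_yherm (j + 1) (j + 1)))
  (open_creg (creg_yherm (j + 2%:R) (j + 2%:R))).
by congr zopen; apply/seteqP; split=> y /=; rewrite /two_sidesY /= !yherm_eq0.
Qed.

Lemma two_sidesY_cover y : exists j, two_sidesY j y.
Proof. exact: exists_two_sides (yW_neq0 y) (sum_yW y). Qed.

Definition zetaY j y : C := yW y 0 j / yW y 0 (j + 1).
Definition phiY j y : Rpi R := argpi (yW y 0 (j + 1)).
Definition sideY j y : C := yabc y 0 (j + 1).

Lemma creg_zetaY j :
  @creg _ (subspace (two_sidesY j)) (fun y : subspace (two_sidesY j) => zetaY j (\val y)).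
Proof.
pose S := subspace (two_sidesY j).
have mv : @is_morphism _ S Ysp (fun y => \val y) by exact: morph_val.
have r1 := creg_comp mv (creg_yherm j (j + 1)).
have r2 := creg_comp mv (creg_yherm (j + 1) (j + 1)).
have n0 (y : S) : yW (\val y) 0 (j + 1) != 0 by case: (val_in y).
apply: (@creg_eq _ S (fun y => side_herm j (j + 1) (ylin (\val y)) /
   side_herm (j + 1) (j + 1) (ylin (\val y)))).
  move=> y; have := n0 y; rewrite /zetaY /side_herm -/(yW (\val y)) => h.
  have c0 := cnorm_sides (ylin (\val y)); rewrite -/(yW (\val y)) in c0.
  by field; rewrite c0 conjc_neq0 h.
by cregs => y; rewrite yherm_eq0.
Qed.

Lemma morph_phiY j : @is_morphism _ (subspace (two_sidesY j)) (Rpi_space R)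
  (fun y : subspace (two_sidesY j) => phiY j (\val y)).
Proof.
pose S := subspace (two_sidesY j).
have mv : @is_morphism _ S Ysp (fun y => \val y) by exact: morph_val.
have r1 := creg_comp mv (creg_ysym (j + 1) (j + 1)).
have r2 := creg_comp mv (creg_yherm (j + 1) (j + 1)).
have n0 (y : S) : yW (\val y) 0 (j + 1) != 0 by case: (val_in y).
apply: morph_Rpi.
(* The doubled angle of w is w^2 / (w conj w), in which the unknown real scale cancels. *)
apply: (@creg_eq _ S (fun y => side_sym (j + 1) (j + 1) (ylin (\val y)) /
   side_herm (j + 1) (j + 1) (ylin (\val y)))).
  move=> y; have h := n0 y; rewrite /phiY e2_argpi // /dir.
  rewrite /side_herm /side_sym -/(yW (\val y)).
  have c0 := cnorm_sides (ylin (\val y)); rewrite -/(yW (\val y)) in c0.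
  by field; rewrite c0 conjc_neq0 h.
by cregs => y; rewrite yherm_eq0.
Qed.

Lemma yW_rho j y : yW y 0 (j + 1) != 0 ->
  yW y = yW y 0 (j + 1) *: rho j (zetaY j y).
Proof. exact: rho_ratio (sum_yW y). Qed.

Lemma sideY_phiY j y : yW y 0 (j + 1) != 0 ->
  (sideY j y)^*%C * e2 (phiY j y) = sideY j y.
Proof.
move=> w1; rewrite /sideY /phiY e2_argpi //; have [l ->] := yabcE y.
rewrite mxE rmorphM -mulrA conj_mul_dir; congr (_ * _).
exact: conjc_real.
Qed.

Definition MB : rspace R := prod_space (C0 R) (Rpi_space R).

Definition parY : set (prod_space (prod_space (C0 R) MB) (C0 R)) :=
  [set q : C * (C * Rpi R) * C | (q.1.2.1)^*%C * e2 q.1.2.2 = q.1.2.1].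

Definition pB (q : subspace parY) : C := (\val q).1.1.
Definition pb (q : subspace parY) : C := (\val q).1.2.1.
Definition pphi (q : subspace parY) : Rpi R := (\val q).1.2.2.
Definition pz (q : subspace parY) : C := (\val q).2.

Lemma parYP q : (pb q)^*%C * e2 (pphi q) = pb q. Proof. exact: (val_in q). Qed.

Lemma creg_par : [/\ creg pB, creg pb, creg pz &
  @is_morphism _ (subspace parY) (Rpi_space R) pphi].
Proof.
pose P1 := prod_space (C0 R) MB; pose P := prod_space P1 (C0 R).
have mv : @is_morphism _ (subspace parY) P (fun q => \val q) by exact: morph_val.
have m1 : @is_morphism _ (subspace parY) P1 (fun q => (\val q).1).
  exact: (morph_comp (@morph_fst _ P1 (C0 R)) mv).
have m12 : @is_morphism _ (subspace parY) MB (fun q => (\val q).1.2).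
  exact: (morph_comp (@morph_snd _ (C0 R) MB) m1).
split.
- exact: (creg_comp (morph_comp (@morph_fst _ (C0 R) MB) m1) (creg_C0 R)).
- exact: (creg_comp (morph_comp (@morph_fst _ (C0 R) (Rpi_space R)) m12) (creg_C0 R)).
- exact: (creg_comp (morph_comp (@morph_snd _ P1 (C0 R)) mv) (creg_C0 R)).
- exact: (morph_comp (@morph_snd _ (C0 R) (Rpi_space R)) m12).
Qed.

Lemma morph_par (X : rspace R) (f : X -> subspace parY) :
  creg (fun x => pB (f x)) -> creg (fun x => pb (f x)) -> creg (fun x => pz (f x)) ->
  @is_morphism _ X (Rpi_space R) (fun x => pphi (f x)) -> is_morphism f.
Proof.
move=> rB rb rz mp; apply: morph_sub; apply: morph_prod; last exact: morph_C0.
apply: morph_prod; first exact: morph_C0.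
by apply: morph_prod; first exact: morph_C0.
Qed.

Definition dirs j (p : Rpi R) (z : C) : 'rV[C]_3 := rpi_root p *: rho j z.

Lemma dirs_neq0 j p z : dirs j p z != 0.
Proof. by rewrite scaler_eq0 negb_or rpi_root_neq0 rho_neq0. Qed.

Lemma hcoord_dirs j p z : hcoord (mkline (realify (dirs j p z))) (realify (dirs j p z)).
Proof. by apply: hcoord_mkline; rewrite realify_eq0 dirs_neq0. Qed.

Lemma sum_scale_rho j (b z : C) : \sum_k (b *: rho j z) 0 k = 0.
Proof. by under eq_bigr do rewrite mxE; rewrite -mulr_sumr sum_rho mulr0. Qed.

Lemma mkY_in j (q : subspace parY) :
  yset ((pB q, mkXX (sum_scale_rho j (pb q) (pz q))) : BX,
        (mkline (realify (dirs j (pphi q) (pz q))) : RP R 5)).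
Proof.
have [t [t0 E]] := sides_scale (hcoord_dirs j (pphi q) (pz q)).
split; rewrite /= E.
  by rewrite scalerA sum_scale_rho.
(* The side j+1 lies on its own direction line, so the whole side vector is a real multiple of the
   chosen representative. *)
have [s bs] : exists s : R, pb q = s%:C%C * rpi_root (pphi q).
  by apply: real_multiple; rewrite ?rpi_root_neq0 // dir_rpi_root parYP.
exists (s / t); rewrite /abc /= !scalerA bs; congr (_ *: _).
congr (_ * _); rewrite -rmorphM /=; congr (_%:C%C).
by rewrite divfK.
Qed.

Definition mkY j (q : subspace parY) : Ysp := insp (mkY_in j q).

Lemma yB_mkY j q : yB (mkY j q) = pB q. Proof. by []. Qed.
Lemma yabc_mkY j q : yabc (mkY j q) = pb q *: rho j (pz q). Proof. by []. Qed.
Lemma sideY_mkY j q : sideY j (mkY j q) = pb q.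
Proof. by rewrite /sideY yabc_mkY mxE rho1 mulr1. Qed.

Lemma yW_mkY j q : exists t : R, t != 0 /\
  yW (mkY j q) = (t%:C%C * rpi_root (pphi q)) *: rho j (pz q).
Proof.
have [t [t0 E]] := sides_scale (hcoord_dirs j (pphi q) (pz q)).
by exists t; split=> //; rewrite /yW E scalerA.
Qed.

Lemma zetaY_mkY j q : zetaY j (mkY j q) = pz q.
Proof.
have [t [t0 E]] := yW_mkY j q; rewrite /zetaY E.
rewrite [X in X / _]mxE [X in _ / X]mxE rho0 rho1 mulr1 mulrC mulKf //.
by rewrite mulf_neq0 ?rpi_root_neq0 // realC_neq0.
Qed.

Lemma phiY_mkY j q : phiY j (mkY j q) = pphi q.
Proof.
have [t [t0 E]] := yW_mkY j q; rewrite /phiY E mxE rho1 mulr1.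
apply: e2_inj; rewrite e2_argpi; last by rewrite mulf_neq0 ?rpi_root_neq0 // realC_neq0.
by rewrite dirM dir_real // mul1r dir_rpi_root.
Qed.

Lemma two_sidesY_mkY j q : two_sidesY j (mkY j q) <-> 1 + pz q != 0.
Proof.
have [t [t0 E]] := yW_mkY j q; rewrite /two_sidesY /= E.
have c0 : t%:C%C * rpi_root (pphi q) != 0.
  by rewrite mulf_neq0 ?rpi_root_neq0 // realC_neq0.
rewrite [X in X != 0 /\ _]mxE [X in _ /\ X != 0]mxE rho1 rho2 mulr1 mulrN oppr_eq0.
split=> [[_]|h]; first by rewrite mulf_eq0 negb_or => /andP[].
by split=> //; rewrite mulf_neq0.
Qed.

(** The representative [dirs] contains the unit vector [rpi_root], which need not be regular. In the
    products of sides it occurs only as its square, which is [e2], or as its norm, which is 1. *)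
Lemma morph_mkY j : is_morphism (mkY j).
Proof.
have [rB rb rz mp] := creg_par.
have re := creg_comp mp (creg_e2 R).
have rr k := creg_rho j k rz.
apply: morph_Ysp.
- exact: rB.
- move=> k; apply: (@creg_eq _ _ (fun q => pb q * rho j (pz q) 0 k)).
    by move=> q; rewrite yabc_mkY [RHS]mxE.
  by have := rr k; move=> ?; cregs.
have n1 p : rpi_root p * (rpi_root p)^*%C = 1 :> C.
  apply/eqP; rewrite eq_complex /rpi_root /=.
  by rewrite mulrN opprK -!expr2 cos2Dsin2 eqxx /= mulrN mulrC addNr.
have cE q : cnorm (dirs j (pphi q) (pz q)) = cnorm (rho j (pz q)).
  by rewrite cnormZ n1 mul1r.
have root2 p : rpi_root p * rpi_root p = e2 p :> C.
  rewrite -dir_rpi_root /dir -[X in _ = X / _]mulr1 -(n1 p) mulrA mulfK //.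
  by rewrite conjc_neq0 rpi_root_neq0.
apply: morph_RP5 => k l.
- apply: (@creg_eq _ _ (fun q => rho j (pz q) 0 k * rho j (pz q) 0 l * e2 (pphi q) *
     (cnorm (rho j (pz q)))^-1)).
    move=> q; rewrite /= (side_symE _ _ (hcoord_dirs j (pphi q) (pz q))) cE !mxE.
    by rewrite -root2; congr (_ / _); ring.
  by have := rr k; have := rr l; have := creg_cnorm_rho j rz => *; cregs.
- apply: (@creg_eq _ _ (fun q => rho j (pz q) 0 k * (rho j (pz q) 0 l)^*%C *
     (cnorm (rho j (pz q)))^-1)).
    move=> q; rewrite /= (side_hermE _ _ (hcoord_dirs j (pphi q) (pz q))) cE !mxE.
    by rewrite rmorphM -[X in X * _]mul1r -(n1 (pphi q)); congr (_ / _); ring.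
  by have := rr k; have := rr l; have := creg_cnorm_rho j rz => *; cregs.
Qed.

Lemma mkY_coord j y q : two_sidesY j y -> pB q = yB y -> pb q = sideY j y ->
  pphi q = phiY j y -> pz q = zetaY j y -> mkY j q = y.
Proof.
move=> [w1 w2] EB Eb Ep Ez.
have WE := yW_rho w1.
apply: Ysp_ext; first by rewrite yB_mkY.
- rewrite yabc_mkY Eb Ez /sideY; have [l E] := yabcE y.
  by rewrite {1}E mxE -scalerA -WE E.
- apply: (proj_pt_eq (hcoord_dirs j (pphi q) (pz q))).
  have [|||t [t0 tE]] := @dir_eq _ (yW y 0 (j + 1)) (rpi_root (pphi q)).
  + by [].
  + exact: rpi_root_neq0.
  + by rewrite dir_rpi_root Ep /phiY e2_argpi.
  apply: (hcoord_sides_scale t0).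
  by rewrite -/(yW y) WE tE /dirs scalerA Ez.
Qed.

Lemma sum_scale_yW y (t : R) : \sum_k (t%:C%C *: yW y) 0 k = 0.
Proof. by under eq_bigr do rewrite mxE; rewrite -mulr_sumr sum_yW mulr0. Qed.

Lemma scaleY_in y (t : R) : yset ((yB y, mkXX (sum_scale_yW y t)) : BX, ylin y).
Proof. by split; [exact: sum_yW|exists t]. Qed.

(** A curve along the fibre of the line bundle: it leaves the zero section while base point and
    shape stay fixed. *)
Definition scaleY y (t : R) : Ysp := insp (scaleY_in y t).

Lemma morph_scaleY y : @is_morphism _ (real_line R) Ysp (scaleY y).
Proof.
apply: morph_Ysp; [exact: creg_cst| |exact: morph_cst].
move=> k; apply: (@creg_eq _ (real_line R) (fun t => t%:C%C * yW y 0 k)).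
  by move=> t; rewrite /yabc /abc /= [RHS]mxE.
apply: cregM; last exact: creg_cst.
by apply: creg_real; exact: reg_real_line.
Qed.

Lemma scaleY0 y : yabc y = 0 -> scaleY y 0 = y.
Proof.
move=> E; apply: Ysp_ext => //; rewrite E /yabc /abc /=.
by rewrite rmorph0 scale0r.
Qed.

End FirstBlowup.

(** * Equations and ideal for the first blowup *)

Section FirstBlowupProof.
Variable R : realType.
Notation C := (R[i]%C).
Notation BX := (BX R).
Notation Ysp := (Ysp R).
Notation P := (prod_space BX (RP R 5)).
Implicit Types (j k : 'I_3).

Definition abc_coord (i : 'I_6) (x : BX) : R := realify (abc x) 0 i.

Lemma row_abc_coord x : \row_i abc_coord i x = realify (abc x).
Proof. by apply/rowP => i; rewrite mxE. Qed.

(** Real collinearity as a closed condition: the antilinear map sending a to conj(c) W, where c W is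
    the orthogonal projection of a on C W, has as its fixed points exactly the real multiples of W.
    Its matrix is the one of the [side_sym]. *)
Lemma ysetE (y : P) : yset y <->
  (forall l, \sum_k side_sym k l y.2 = 0) /\
  (forall l, \sum_k (abc y.1 0 k)^*%C * side_sym k l y.2 - abc y.1 0 l = 0).
Proof.
set W := sides y.2; set a := abc y.1.
have W0 : W != 0 by exact: sides_neq0.
have N0 : cnorm W != 0 by rewrite cnorm_eq0.
have NR : (cnorm W)^*%C = cnorm W.
  rewrite /cnorm rmorph_sum; apply: eq_bigr => k _.
  by rewrite rmorphM /= conjcK mulrC.
split.
  move=> [s0 [t aE]]; split=> l.
    by rewrite /side_sym -!mulr_suml s0 !mul0r.
  rewrite -/a in aE; rewrite aE; apply/eqP; rewrite subr_eq0; apply/eqP.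
  transitivity (\sum_k (t%:C%C * W 0 l / cnorm W) * (W 0 k * (W 0 k)^*%C)).
    apply: eq_bigr => k _; rewrite mxE /side_sym -/W.
    have -> : (t%:C%C * W 0 k)^*%C = t%:C%C * (W 0 k)^*%C.
      by rewrite rmorphM -[X in _ = X * _]conjc_real.
    by ring.
  by rewrite -mulr_sumr -/(cnorm W) divfK // [RHS]mxE.
move=> [H1 H2]; split.
  have [l Wl] := neq0_coord W0.
  have := H1 l; rewrite /side_sym -!mulr_suml -/W => /eqP.
  by rewrite !mulf_eq0 invr_eq0 (negbTE N0) (negbTE Wl) !orbF => /eqP.
(* The factor conj(c); the fixed-point equation gives a = m W, and substituting this in m shows that
   m equals its conjugate. *)
pose m := (\sum_k (a 0 k)^*%C * W 0 k) / cnorm W.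
have aE l : a 0 l = m * W 0 l.
  have := H2 l => /eqP; rewrite subr_eq0 => /eqP <-.
  rewrite /m mulr_suml mulr_suml; apply: eq_bigr => k _.
  by rewrite /side_sym -/W; ring.
have mr : m^*%C = m.
  rewrite {1}/m fmorph_div /= NR rmorph_sum /=.
  transitivity ((\sum_k m * (W 0 k * (W 0 k)^*%C)) / cnorm W).
    congr (_ / _); apply: eq_bigr => k _.
    by rewrite rmorphM /= conjcK aE mulrA.
  by rewrite -mulr_sumr -/(cnorm W) mulfK.
exists (complex.Re m); rewrite -conj_fix_real //.
by apply/rowP => l; rewrite mxE -aE.
Qed.

Lemma zclosed_yset : zclosed (@yset R).
Proof.
have rS k l : @creg _ P (fun y => side_sym k l y.2).
  exact: (creg_comp (@morph_snd _ BX (RP R 5)) (creg_RP5 R k l).1).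
have ra k : @creg _ P (fun y => abc y.1 0 k).
  exact: (creg_comp (@morph_fst _ BX (RP R 5)) (creg_abc R k)).
have -> : @yset R = [set y : P | forall l, \sum_k side_sym k l y.2 = 0] `&`
   [set y : P | forall l, \sum_k (abc y.1 0 k)^*%C * side_sym k l y.2 - abc y.1 0 l = 0].
  by apply/seteqP; split=> y /ysetE.
apply: zclosedI; apply: zclosed_forall => l.
- apply: (@closed_creg _ P (fun y => \sum_k side_sym k l y.2)).
  exact: creg_sum.
- apply: (@closed_creg _ P (fun y =>
    \sum_k (abc y.1 0 k)^*%C * side_sym k l y.2 - abc y.1 0 l)).
  apply: cregD; last exact: cregN.
  by apply: creg_sum => k; apply: cregM => //; apply: creg_conj.
Qed.

(** Outside the zero section the line is spanned by the vector, which is the graph; a point of the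
    zero section is reached by scaling a vector on its line to 0. *)
Lemma first_modelE : blowup_model (@triangle_center R) setT abc_coord = @yset R.
Proof.
apply/seteqP; split=> y.
  move=> [_]; apply: zclosure_min; first exact: zclosed_yset.
  move=> [x p] [/= _ nZ]; rewrite row_abc_coord => hp.
  have [t [t0 E]] := sides_scale hp.
  split=> /=; rewrite E.
    by under eq_bigr do rewrite mxE; rewrite -mulr_sumr sum_abc mulr0.
  exists t^-1; rewrite scalerA -rmorphM /= mulVf //.
  exact: esym (scale1r _).
move=> hy; split=> //.
pose y' : Ysp := insp hy.
have [a0|a0] := eqVneq (yabc y') 0; last first.
  apply: sub_zclosure; split=> //=; first by move=> Z; move/eqP: a0; apply.
  rewrite row_abc_coord -/(yabc y').
  have [l lE] := yabcE y'.
  have l0 : l != 0.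
    by apply: contraNneq a0 => l0; rewrite lE l0 rmorph0 scale0r.
  apply: (@hcoord_sides_scale _ _ _ l^-1); first by rewrite invr_eq0.
  rewrite lE scalerA -rmorphM /= mulVf //.
  exact: esym (scale1r _).
move=> V oV Vy.
have mg : is_morphism (fun t : real_line R => \val (scaleY y' t) : P).
  exact: (morph_comp (@morph_yval R) (morph_scaleY y')).
have [|t [t0 Vt]] := curve_nbhd0 mg oV; first by rewrite scaleY0.
have t1 : t%:C%C != 0 :> C by rewrite realC_neq0.
exists (\val (scaleY y' t)); split=> //; split=> //=.
  rewrite /triangle_center /=; apply/eqP.
  by rewrite scaler_eq0 negb_or t1 yW_neq0.
rewrite row_abc_coord /abc /= realifyZ.
by apply: hcoordZ => //; exact: hcoord_sides.
Qed.

Definition first_proj (y : Ysp) : BX := (\val y).1.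

Lemma zclosed_triangle_center : zclosed (@triangle_center R).
Proof.
have -> : @triangle_center R = [set x : BX | forall k, abc x 0 k = 0].
  apply/seteqP; split=> x /=; first by move=> E k; rewrite /abc E mxE.
  by move=> E; apply/rowP => k; rewrite [RHS]mxE -[RHS](E k).
by apply: zclosed_forall => k; apply: closed_creg; exact: creg_abc.
Qed.

Lemma sum_zero3 : \sum_k (0 : 'rV[C]_3) 0 k = 0.
Proof. by rewrite big1 // => k _; rewrite mxE. Qed.

Definition flat (y : subspace (setT : set BX)) : subspace (setT : set BX) :=
  @insp R BX setT ((\val y).1, mkXX sum_zero3) I.

Lemma generate_ideal_center : generate_ideal (@triangle_center R) setT abc_coord.
Proof.
have oT := zopenT BX.
have rf i : regular setT (abc_coord i).
  have [k [->|->]] := pos_cases i.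
  - by apply: (@reg_eq _ _ (fun x => complex.Re (abc x 0 k)));
      [move=> x; rewrite /abc_coord realify_re|have [] := creg_abc R k].
  - by apply: (@reg_eq _ _ (fun x => complex.Im (abc x 0 k)));
      [move=> x; rewrite /abc_coord realify_im|have [] := creg_abc R k].
have fZ i x : setT x -> triangle_center x -> abc_coord i x = 0.
  by move=> _ Zx; rewrite /abc_coord /abc Zx !mxE; case: odd.
have Zr y : triangle_center (\val (flat y)) by [].
have ca k := retr_cong_gen oT rf Zr fZ (re_pos k).
have cb k := retr_cong_gen oT rf Zr fZ (im_pos k).
apply: (@generate_ideal_retract _ _ _ _ _ _ flat) => //.
- move=> y Zy; apply: insp_inj; exact: BX_ext.
- move=> x _ H; apply/eqP; rewrite -[_ == _]realify_eq0; apply/eqP/rowP => i.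
  by rewrite [RHS]mxE -[RHS](H i).
pose S := retr_space abc_coord flat.
have mv : @is_morphism _ (subspace (setT : set BX)) BX (fun y => \val y) by exact: morph_val.
(* [flat] fixes the base point, and the coordinates of the sides are generators of the ideal; so all
   coordinates are congruent. *)
apply: (@morph_prod _ S).
- apply: morph_C0; have [r1 r2] := creg_comp mv (creg_B0 R).
  by split; apply: retr_congP; [apply: retr_cong_fix r1 _|apply: retr_cong_fix r2 _].
- apply: morph_XX => k; split.
  + apply: reg_eq (retr_congP (ca k)) => y; by rewrite /abc_coord realify_re.
  + apply: reg_eq (retr_congP (cb k)) => y; by rewrite /abc_coord realify_im.
Qed.

Lemma first_blowup : is_blowup first_proj (@triangle_center R).
Proof.
split; [exact: zclosed_triangle_center|exact: morph_ypr|move=> x].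
pose psi0 (y : subspace (first_proj @^-1` setT)) : subspace (@yset R) := \val y.
have [psi [ipsi epsi]] : exists psi : subspace (first_proj @^-1` setT) ->
    subspace (blowup_model (@triangle_center R) setT abc_coord),
    is_isomorphism psi /\ forall y, (\val (psi y)).1 = first_proj (\val y).
  rewrite first_modelE; exists psi0; split=> //; split; first exact: morph_val.
  exists (fun y : Ysp => @insp _ Ysp (first_proj @^-1` setT) y I); split.
  - exact: morph_sub.
  - by move=> y; apply: insp_inj.
  - by [].
exists setT, 5%N, abc_coord, psi; split=> //; first exact: zopenT.
exact: generate_ideal_center.
Qed.

End FirstBlowupProof.

(** * The second blowup of the space of triangles *)

Section Triangles.
Variable R : realType.
Notation C := (R[i]%C).
Notation BX := (BX R).
Notation Ysp := (Ysp R).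
Notation T := (triangle_space R).
Implicit Types (j k : 'I_3) (t : T).

(** The nondegenerate and degenerate conditions on the sides merge into one: they are a real
    multiple, possibly zero, of the representative. A real factor does not affect directions modulo
    pi. *)
Lemma trianglesE (y : BX * RP R 5) (xi : 'I_3 -> Rpi R) :
  triangles ((y, xi) : triangle_ambient R) <->
  yset y /\ forall k, sides y.2 0 k != 0 -> xi k = argpi (sides y.2 0 k).
Proof.
case: y => -[B v] p /=; split.
  move=> [w [hw h1 h2 h3]].
  have [c [c0 E]] := hrep_scale hw.
  have WE : sides p = c%:C%C *: complexify w by rewrite /sides E complexifyZ.
  have cC : c%:C%C != 0 :> C by rewrite realC_neq0.
  split; last first.
    move=> k; rewrite WE [X in X != 0]mxE mulf_eq0 negb_or => /andP[_ wk].
    rewrite h3 // [in RHS]mxE argpi_mul //.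
    have -> : argpi c%:C%C = 0 :> Rpi R.
      by apply: e2_inj; rewrite e2_argpi // dir_real // e20.
    by rewrite add0r /argpi mxE.
  have [v0|v0] := eqVneq (\val v) 0.
    split=> /=; last by exists 0; rewrite /abc /= v0 rmorph0 scale0r.
    have [r0 i0] := h2 v0.
    rewrite WE; under eq_bigr do rewrite mxE; rewrite -mulr_sumr.
    suff -> : \sum_i complexify w 0 i = 0 by rewrite mulr0.
    rewrite !(sum_I3 0) in r0 i0 *; rewrite !mxE; apply/eqP; rewrite eq_complex /=.
    by rewrite r0 i0 eqxx.
  have [s [s0 sE]] := sides_scale (h1 v0).
  split=> /=; rewrite sE.
    by under eq_bigr do rewrite mxE; rewrite -mulr_sumr (val_in v) mulr0.
  exists s^-1; rewrite scalerA -rmorphM /= mulVf //; exact: esym (scale1r _).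
move=> [[s0 [l lE]] h]; exists (hrep p); rewrite /= in s0 lE h.
split; first exact: hcoord_hrep.
- move=> v0; have l0 : l != 0.
    by apply: contraNneq v0 => l0; move: lE; rewrite /abc /= l0 rmorph0 scale0r => ->.
  apply: (@hcoord_sides_scale _ _ _ l^-1); first by rewrite invr_eq0.
  rewrite -[\val v]/(abc (B, v)) lE scalerA -rmorphM /= mulVf //.
  exact: esym (scale1r _).
- move=> _; rewrite !(sum_I3 0); move: s0; rewrite (sum_I3 0) /sides !mxE => /eqP.
  by rewrite eq_complex /= => /andP[/eqP -> /eqP ->].
- by move=> k /h ->; rewrite /argpi /sides mxE.
Qed.

Lemma second_proj_in t : yset (\val t).1.
Proof. by have := val_in t; case: (\val t) => y xi /trianglesE[]. Qed.

Definition second_proj t : Ysp := insp (second_proj_in t).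

Definition txi t : 'I_3 -> Rpi R := (\val t).2.

Lemma txiE t k : yW (second_proj t) 0 k != 0 -> txi t k = argpi (yW (second_proj t) 0 k).
Proof.
have := val_in t; rewrite /txi /yW /ylin /=.
by case: (sval t) => y xi /trianglesE[_] /=; apply.
Qed.

Lemma morph_second_proj : is_morphism second_proj.
Proof.
apply: morph_sub; exact: (morph_comp (@morph_fst _ (prod_space BX (RP R 5))
  (power_space 3 (Rpi_space R))) (@morph_val _ (triangle_ambient R) _)).
Qed.

Lemma morph_txi k : @is_morphism _ T (Rpi_space R) (fun t => txi t k).
Proof.
pose P3 := power_space 3 (Rpi_space R).
have m1 : @is_morphism _ T P3 txi.
  exact: (morph_comp (@morph_snd _ (prod_space BX (RP R 5)) P3)
    (@morph_val _ (triangle_ambient R) _)).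
exact (@morph_comp R _ P3 (Rpi_space R) (fun f => f k) _ (@morph_proj R 3 (Rpi_space R) k) m1).
Qed.

Lemma triangle_ext t t' : second_proj t = second_proj t' ->
  (forall k, txi t k = txi t' k) -> t = t'.
Proof.
case: t => -[y xi] h; case: t' => -[y' xi'] h' E Ex.
apply: val_inj => /=; congr (_, _); last by apply/funext.
exact: (congr1 (fun z : Ysp => \val z) E).
Qed.

Definition tri_angle j t : Rpi R := txi t j - txi t (j + 1).

Lemma morph_tri_angle j : @is_morphism _ T (Rpi_space R) (tri_angle j).
Proof.
apply: morph_Rpi; apply: (@creg_eq _ T (fun t => e2 (txi t j) * (e2 (txi t (j + 1)))^-1)).
  by move=> t; rewrite /tri_angle e2B.
have r k := creg_comp (morph_txi k) (creg_e2 R).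
apply: cregM; first exact: r.
by apply: cregV; [exact: r|move=> t; exact: e2_neq0].
Qed.

Lemma tri_angle_zetaY j t : two_sidesY j (second_proj t) ->
  (zetaY j (second_proj t))^*%C * e2 (tri_angle j t) = zetaY j (second_proj t).
Proof.
move=> [w1 w2]; set y := second_proj t in w1 w2 *.
have [->|z0] := eqVneq (zetaY j y) 0; first by rewrite rmorph0 mul0r.
have E0 : yW y 0 j = yW y 0 (j + 1) * zetaY j y by rewrite mulrC /zetaY divfK.
have w0 : yW y 0 j != 0 by rewrite E0 mulf_neq0.
rewrite /tri_angle (txiE w0) (txiE w1) -/y E0 argpi_mul // addrC addKr.
by rewrite e2_argpi // conj_mul_dir.
Qed.

Lemma triangle_local_ext j t t' : two_sidesY j (second_proj t) ->
  second_proj t = second_proj t' -> tri_angle j t = tri_angle j t' -> t = t'.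
Proof.
move=> [w1 w2] E Ea; apply: triangle_ext => // k.
have E1 : txi t (j + 1) = txi t' (j + 1).
  by rewrite (txiE w1) E txiE // -E.
have E2 : txi t (j + 2%:R) = txi t' (j + 2%:R).
  by rewrite (txiE w2) E txiE // -E.
case: (I3_cases j k) => -> //.
by rewrite -[LHS](subrK (txi t (j + 1))) -/(tri_angle j t) Ea E1 subrK.
Qed.

Definition parT : set (prod_space (subspace (@parY R)) (Rpi_space R)) :=
  [set q : subspace (@parY R) * Rpi R |
     1 + pz q.1 != 0 /\ (pz q.1)^*%C * e2 q.2 = pz q.1].

(** Directions of the sides (z, 1, -1-z) multiplied by a vector of direction [pphi], with [th]
    standing for the direction of z. *)
Definition xi_of j (q : subspace (@parY R)) (th : Rpi R) k : Rpi R :=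
  if k == j then pphi q + th else
  if k == j + 1 then pphi q else pphi q + argpi (- (1 + pz q)).

Lemma mkT_in j (q : subspace parT) :
  triangles ((\val (mkY j (\val q).1), xi_of j (\val q).1 (\val q).2) : triangle_ambient R).
Proof.
have [z1 zt] := val_in q; apply/trianglesE; split; first exact: val_in.
set p := (\val q).1 in z1 zt *; set th := (\val q).2 in zt *.
move=> k; rewrite -[sides _]/(yW (mkY j p)).
have U := (two_sidesY_mkY j p).2 z1; have [w1 w2] := U.
have WE := yW_rho w1; rewrite zetaY_mkY in WE.
have ph := phiY_mkY j p; rewrite /phiY in ph.
have nz1 : - (1 + pz p) != 0 by rewrite oppr_eq0.
case: (I3_cases j k) => ->; rewrite /xi_of ?eqxx ?I3_1 ?I3_2 ?I3_21 => wk.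
- have E0 : yW (mkY j p) 0 j = yW (mkY j p) 0 (j + 1) * pz p.
    by rewrite {1}WE mxE rho0.
  have z0 : pz p != 0 by apply: contraNneq wk => z0; rewrite E0 z0 mulr0.
  rewrite E0 argpi_mul // ph; congr (_ + _).
  by apply: e2_inj; rewrite e2_argpi //; apply: conj_mul_eq.
- by rewrite ph.
- have E2 : yW (mkY j p) 0 (j + 2%:R) = yW (mkY j p) 0 (j + 1) * - (1 + pz p).
    by rewrite {1}WE mxE rho2.
  by rewrite E2 argpi_mul // ph.
Qed.

Definition mkT j (q : subspace parT) : T :=
  @insp _ (triangle_ambient R) (@triangles R) _ (mkT_in j q).

Lemma second_proj_mkT j q : second_proj (mkT j q) = mkY j (\val q).1.
Proof. exact: insp_inj. Qed.

Lemma tri_angle_mkT j q : tri_angle j (mkT j q) = (\val q).2.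
Proof.
rewrite /tri_angle /txi /= /xi_of !eqxx I3_1.
by rewrite addrC addKr.
Qed.

Lemma morph_mkT j : is_morphism (mkT j).
Proof.
pose P := prod_space (subspace (@parY R)) (Rpi_space R).
have mv : @is_morphism _ (subspace parT) P (fun q => \val q) by exact: morph_val.
have m1 : is_morphism (fun q : subspace parT => (\val q).1).
  exact: (morph_comp (@morph_fst _ (subspace (@parY R)) (Rpi_space R)) mv).
have m2 : @is_morphism _ (subspace parT) (Rpi_space R) (fun q => (\val q).2).
  exact: (morph_comp (@morph_snd _ (subspace (@parY R)) (Rpi_space R)) mv).
have [rB rb rz0 mp0] := creg_par R.
have rz := creg_comp m1 rz0.
have rp := creg_comp m1 (creg_comp mp0 (creg_e2 R)).
have rt := creg_comp m2 (creg_e2 R).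
have nz (q : subspace parT) : - (1 + pz (\val q).1) != 0.
  by rewrite oppr_eq0; case: (val_in q).
have rd : creg (fun q : subspace parT => dir (- (1 + pz (\val q).1))).
  by rewrite /dir; cregs => q; rewrite conjc_neq0.
apply: morph_sub; apply: morph_prod.
  exact: (morph_comp (@morph_yval R) (morph_comp (@morph_mkY R j) m1)).
apply: morph_power => k; apply: morph_Rpi.
case: (I3_cases j k) => ->; rewrite /mkT /= /xi_of ?eqxx ?I3_1 ?I3_2 ?I3_21.
- apply: (@creg_eq _ _ (fun q : subspace parT => e2 (pphi (\val q).1) * e2 (\val q).2)).
    by move=> q; rewrite e2D.
  by cregs.
- exact: rp.
- apply: (@creg_eq _ _ (fun q : subspace parT =>
      e2 (pphi (\val q).1) * dir (- (1 + pz (\val q).1)))).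
    by move=> q; rewrite e2D (e2_argpi (nz q)).
  by cregs.
Qed.

Definition strict : set Ysp :=
  strict_transform (@first_proj R) (@triangle_center R) (@triangle_abc0 R).

Lemma prod_I3 j (F : 'I_3 -> C) :
  (\prod_k F k == 0) = [|| F j == 0, F (j + 1) == 0 | F (j + 2%:R) == 0].
Proof.
apply/idP/idP.
  move=> /prodf_eq0[k _ Fk].
  by case: (I3_cases j k) Fk => -> ->; rewrite ?orbT.
by move=> /or3P[] F0; apply/prodf_eq0; [exists j|exists (j + 1)|exists (j + 2%:R)].
Qed.

(** Off the exceptional locus the sides are a nonzero real multiple of the representative W, so abc
    = 0 amounts to the vanishing of the product of the entries of W, a closed condition on all of Y.
    In this chart only the entry j can vanish. *)
Lemma strictE j y : two_sidesY j y -> (strict y <-> zetaY j y = 0).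
Proof.
move=> [w1 w2]; split.
  have cl : zclosed [set y : Ysp | side_herm 0 0 (ylin y) *
      (side_herm 1 1 (ylin y) * side_herm 2%:R 2%:R (ylin y)) = 0].
    apply: (@closed_creg _ Ysp (fun y => side_herm 0 0 (ylin y) *
      (side_herm 1 1 (ylin y) * side_herm 2%:R 2%:R (ylin y)))).
    by apply: cregM; [exact: creg_yherm|apply: cregM; exact: creg_yherm].
  have m3 (a b c : C) : (a * (b * c) == 0) = [|| a == 0, b == 0 | c == 0].
    by rewrite !mulf_eq0.
  have prodE (y' : Ysp) : (side_herm 0 0 (ylin y') *
      (side_herm 1 1 (ylin y') * side_herm 2%:R 2%:R (ylin y')) == 0) =
      (\prod_k yW y' 0 k == 0).
    by rewrite m3 !yherm_eq0 (prod_I3 0) !add0r.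
  move=> /(zclosure_min cl) H.
  have /eqP : side_herm 0 0 (ylin y) *
      (side_herm 1 1 (ylin y) * side_herm 2%:R 2%:R (ylin y)) = 0.
    apply: H => y' [/= /eqP p0 nZ]; apply/eqP; rewrite prodE.
    have [l lE] := yabcE y'.
    have l0 : l%:C%C != 0 :> C.
      by apply/eqP => l0; apply: nZ; move: lE; rewrite l0 scale0r.
    move: p0; rewrite -[\val (first_proj y').2]/(yabc y') lE !(prod_I3 0).
    by rewrite !(mxE, mulf_eq0) (negbTE l0).
  rewrite prodE (prod_I3 j) (negbTE w1) (negbTE w2) !orbF /zetaY => /eqP ->.
  by rewrite mul0r.
move=> /eqP; rewrite /zetaY mulf_eq0 invr_eq0 (negbTE w1) orbF => /eqP w0.
have mem (y' : Ysp) : yW y' = yW y -> yabc y' != 0 ->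
    (@first_proj R @^-1` (@triangle_abc0 R `\` @triangle_center R)) y'.
  move=> EW a0; split=> /=; last by move=> E; move/eqP: a0; apply.
  have [l lE] := yabcE y'.
  rewrite /triangle_abc0 /=; apply/eqP; rewrite -[\val (first_proj y').2]/(yabc y') lE.
  rewrite (prod_I3 j) EW; apply/or3P; constructor 1.
  by rewrite [X in X == 0]mxE w0 mulr0.
have [a0|a0] := eqVneq (yabc y) 0; last by apply: sub_zclosure; exact: mem.
(* On the exceptional locus, scaling out of the zero section keeps W, and hence its vanishing entry,
   fixed. *)
move=> V oV Vy.
have [|t [t0 Vt]] := curve_nbhd0 (morph_scaleY y) oV; first by rewrite scaleY0.
exists (scaleY y t); split=> //; apply: mem => //.
by rewrite /yabc /abc /= scaler_eq0 negb_or realC_neq0 t0 yW_neq0.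
Qed.

End Triangles.

(** * The second blowup in local coordinates *)

Section SecondBlowup.
Variables (R : realType) (j : 'I_3).
Notation C := (R[i]%C).
Notation Ysp := (Ysp R).
Notation UY := (@two_sidesY R j).

(** Replaces the ratio zeta of y by z and keeps the other coordinates; z = t m gives the test
    curves, z = 0 the retraction. *)
Definition parq (y : subspace UY) (z : C) : subspace (@parY R) :=
  @insp _ _ (@parY R)
    ((yB (\val y), (sideY j (\val y), phiY j (\val y))), z)
    (sideY_phiY (val_in y).1).

Lemma mkY_parq (y : subspace UY) : mkY j (parq y (zetaY j (\val y))) = \val y.
Proof. exact: (mkY_coord (val_in y)). Qed.

Lemma zetaY_neqN1 (y : subspace UY) : 1 + zetaY j (\val y) != 0.
Proof.
have := val_in y; rewrite -{1}mkY_parq => /two_sidesY_mkY.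
by [].
Qed.

Lemma morph_mkY_parq (X : rspace R) (f : X -> subspace UY) (z : X -> C) :
  creg (fun x => yB (\val (f x))) -> creg (fun x => sideY j (\val (f x))) ->
  creg (fun x => e2 (phiY j (\val (f x)))) -> creg z ->
  is_morphism (fun x => parq (f x) (z x)).
Proof. by move=> rB rb rp rz; apply: morph_par => //; exact: morph_Rpi. Qed.

Lemma creg_Ycoords : [/\ creg (fun y : subspace UY => yB (\val y)),
  creg (fun y : subspace UY => sideY j (\val y)) &
  creg (fun y : subspace UY => e2 (phiY j (\val y)))].
Proof.
have mv : @is_morphism _ (subspace UY) Ysp (fun y => \val y) by exact: morph_val.
split.
- exact: (creg_comp mv (creg_yB R)).
- exact: (creg_comp mv (creg_yabc R (j + 1))).
- exact: (creg_comp (@morph_phiY R j) (creg_e2 R)).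
Qed.

Lemma second_blowup_local : exists (k : nat) (f : 'I_k.+1 -> Ysp -> R)
  (psi : subspace (@second_proj R @^-1` UY) ->
         subspace (blowup_model (@strict R) UY f)),
  [/\ generate_ideal (@strict R) UY f, is_isomorphism psi &
      forall t, (\val (psi t)).1 = second_proj (\val t)].
Proof.
have rz := creg_zetaY R j.
have oU := @open_two_sidesY R j.
have Zz := @strictE R j.
have [rB rb rp] := creg_Ycoords.
pose S : rspace R := subspace (zeta_model UY (@zetaY R j)).
have US (q : S) : UY (\val q).1 by case: (val_in q).
pose r (q : S) : subspace UY := insp (US q).
have mv : @is_morphism _ S (prod_space Ysp (RP R 1)) (fun q => \val q) by exact: morph_val.
have mr : is_morphism r.
  by apply: morph_sub; exact: (morph_comp (@morph_fst _ Ysp (RP R 1)) mv).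
have invP (q : S) : @parT R (parq (r q) (zetaY j (\val q).1), P1_to_Rpi (\val q).2).
  by split; [exact: (zetaY_neqN1 (r q))|case: (val_in q)].
pose inv (q : S) := mkT j (insp (invP q)).
have [||||||||psi [ipsi epsi]] := @blowup_zeta_local R Ysp (@strict R) _ _
    oU rz Zz _ (triangle_space R) (@second_proj R) (@tri_angle R j) inv.
- move=> x m Ux Zx m0; exists (fun t => mkY j (parq (insp Ux) (t%:C%C * m))); split.
  + apply: (morph_comp (@morph_mkY R j)).
    apply: (@morph_mkY_parq _ (fun _ => insp Ux)); do ?exact: creg_cst.
    apply: cregM; last exact: creg_cst.
    by apply: creg_real; exact: reg_real_line.
  + have := mkY_parq (insp Ux); rewrite ((Zz _ Ux).1 Zx).
    by rewrite rmorph0 mul0r.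
  + by move=> t _; rewrite zetaY_mkY.
- exact: morph_second_proj.
- exact: (@morph_comp _ _ (triangle_space R) (Rpi_space R) _ _
    (@morph_tri_angle R j) (@morph_val _ _ _)).
- exact: tri_angle_zetaY.
- apply: (morph_comp (@morph_mkT R j)); apply: morph_sub; apply: morph_prod.
    apply: (@morph_mkY_parq _ r).
    + exact: (creg_comp mr rB).
    + exact: (creg_comp mr rb).
    + exact: (creg_comp mr rp).
    + exact: (creg_comp mr rz).
  exact: (@morph_comp _ _ (RP R 1) (Rpi_space R) _ _ (@morph_P1_to_Rpi R)
    (morph_comp (@morph_snd _ Ysp (RP R 1)) mv)).
- by move=> q; rewrite second_proj_mkT (mkY_parq (r q)).
- by move=> q; rewrite tri_angle_mkT.
- exact: triangle_local_ext.
exists 1%N, (re_im (@zetaY R j)), psi; split=> //.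
have rP (y : subspace UY) : UY (mkY j (parq y 0)).
  by apply/two_sidesY_mkY; rewrite /pz /= addr0 oner_neq0.
pose r0 (y : subspace UY) : subspace UY := insp (rP y).
apply: (@generate_ideal_zeta _ _ _ _ _ oU rz Zz r0).
- move=> y zy; apply: insp_inj; rewrite -[RHS]mkY_parq zy; exact: erefl.
- by move=> y; rewrite /= zetaY_mkY.
pose S0 := retr_space (re_im (@zetaY R j)) r0.
(* In these coordinates the retraction changes only zeta, whose parts generate the ideal; the other
   coordinates are equal to their pullbacks. *)
apply: (@morph_eq _ S0 _ (fun y : subspace UY => mkY j (parq y (zetaY j (\val y))))).
  exact: mkY_parq.
apply: (morph_comp (@morph_mkY R j)).
apply: (@morph_mkY_parq S0 (fun y => y)).
- exact: (creg_retr_fix _ rB).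
- by apply: (creg_retr_fix _ rb) => y; rewrite /= sideY_mkY.
- by apply: (creg_retr_fix _ rp) => y; rewrite /= phiY_mkY.
- by apply: (creg_retr_zeta oU rz Zz) => y; rewrite /= zetaY_mkY.
Qed.

End SecondBlowup.

Lemma second_blowup (R : realType) : is_blowup (@second_proj R) (@strict R).
Proof.
split; [exact: zclosure_closed|exact: morph_second_proj|move=> y].
have [j Uy] := two_sidesY_cover y.
have [k [f [psi [gi ip ep]]]] := second_blowup_local R j.
by exists (two_sidesY j), k, f, psi; split=> //; exact: open_two_sidesY.
Qed.

Section SixCoordinates.
Variable R : realType.

Definition row_of6 (s : seq R) : 'rV[R]_6 := \row_i nth 0 s i.
Definition coord6 (v : 'rV[R]_6) (k : nat) : R := v 0 (inord k).

Lemma co_row_of6 s k : (k < 6)%N -> coord6 (row_of6 s) k = nth 0 s k.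
Proof. by move=> k6; rewrite /coord6 mxE inordK. Qed.

Lemma row_of6_co (v : 'rV[R]_6) :
  row_of6 [:: coord6 v 0; coord6 v 1; coord6 v 2; coord6 v 3; coord6 v 4; coord6 v 5] = v.
Proof.
apply/rowP => i; rewrite mxE /coord6 -[in RHS](inord_val i).
by case: i => [[|[|[|[|[|[|]]]]]]].
Qed.

Lemma polyfun_co k : polyfun (fun v => coord6 v k).
Proof. exact: polyfun_coord. Qed.

Lemma reg_row_of6 (X : rspace R) (s : X -> seq R) :
  (forall k, (k < 6)%N -> reg (fun x => nth 0 (s x) k)) ->
  forall i, reg (fun x => row_of6 (s x) 0 i).
Proof. by move=> H i; apply: reg_eq (H i (ltn_ord i)) => x; rewrite mxE. Qed.

End SixCoordinates.

(** * Charts of the first blowup *)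

Section YCharts.
Variable R : realType.
Notation C := (R[i]%C).
Notation Ysp := (Ysp R).

Lemma Ysp_separating (y y' : Ysp) :
  (forall f : Ysp -> C, creg f -> f y = f y') -> y = y'.
Proof.
move=> H; apply: Ysp_ext.
- exact: (H _ (creg_yB R)).
- by apply/rowP => k; exact: (H _ (creg_yabc R k)).
- apply: rp_coord_inj => i k.
  have := H _ (creg_real (reg_comp (@morph_ylin R) (reg_rp_coord i k))).
  by move=> [].
Qed.

Variables (j : 'I_3) (b : bool).
Notation UY := (@two_sidesY R j).

(** A single sign choice: [phiY] is the only angle here, while [zetaY] is an ordinary complex
    coordinate. *)
Definition ydom : set Ysp := [set y | UY y /\ 1 + chart_sign R b * e2 (phiY j y) != 0].

Lemma open_ydom : zopen ydom.
Proof.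
apply: (@open_creg_on _ Ysp _ (fun y => 1 + chart_sign R b * e2 (phiY j y))).
  exact: open_two_sidesY.
have re := creg_comp (@morph_phiY R j) (creg_e2 R).
by apply: cregD; [exact: creg_cst|apply: cregM; [exact: creg_cst|exact: re]].
Qed.

Definition ychart (y : Ysp) : 'rV[R]_6 :=
  row_of6 [:: complex.Re (yB y); complex.Im (yB y); mobu b (sideY j y);
    mobn b (e2 (phiY j y)); complex.Re (zetaY j y); complex.Im (zetaY j y)].

Lemma par_in (B z : C) (u n : R) :
  @parY R ((B, (mobz b u n, argpi (mobd b n))), z).
Proof. exact: mob_chart_mob. Qed.

Definition par_of (B z : C) (u n : R) : subspace (@parY R) := insp (par_in B z u n).

Lemma morph_par_of (X : rspace R) (B z : X -> C) (u n : X -> R) :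
  creg B -> creg z -> reg u -> reg n ->
  is_morphism (fun x => par_of (B x) (z x) (u x) (n x)).
Proof.
move=> rB rz ru rn; apply: morph_par => //.
- exact: (cfun_mobz (reg_ring X) b ru rn).
- exact: morph_argpi_mobd.
Qed.

Definition v_B (v : 'rV[R]_6) : C := (coord6 v 0 +i* coord6 v 1)%C.
Definition v_z (v : 'rV[R]_6) : C := (coord6 v 4 +i* coord6 v 5)%C.

Definition yparam (v : 'rV[R]_6) : Ysp :=
  mkY j (par_of (v_B v) (v_z v) (coord6 v 2) (coord6 v 3)).

Lemma complex_eta (z : C) : (complex.Re z +i* complex.Im z)%C = z.
Proof. by case: z. Qed.

Lemma mkY_par_of y (z : C) : ydom y -> z = zetaY j y ->
  mkY j (par_of (yB y) z (mobu b (sideY j y)) (mobn b (e2 (phiY j y)))) = y.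
Proof.
move=> [Uy hy] ->; apply: mkY_coord => //.
- by rewrite /pb /= mob_chart_z //; apply: sideY_phiY; case: Uy.
- by rewrite /pphi /= mob_chart_dir.
Qed.

Lemma reg_ydom (X : rspace R) (f : X -> Ysp) : is_morphism f ->
  (forall x, ydom (f x)) ->
  [/\ creg (fun x => yB (f x)), reg (fun x => mobu b (sideY j (f x))),
      reg (fun x => mobn b (e2 (phiY j (f x)))) & creg (fun x => zetaY j (f x))].
Proof.
move=> mf hf; have US x : UY (f x) by case: (hf x).
pose r x : subspace UY := insp (US x).
have mr : is_morphism r by exact: morph_sub.
have [rB rb _] := creg_Ycoords R j.
split.
- exact: (creg_comp mr rB).
- exact: (reg_mobu b (creg_comp mr rb)).
- apply: (@reg_mobn _ _ b (fun x => phiY j (f x))).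
    exact: (@morph_comp _ _ _ (Rpi_space R) _ _ (@morph_phiY R j) mr).
  by move=> x; case: (hf x).
- exact: (creg_comp mr (creg_zetaY R j)).
Qed.

Lemma ydom_mkY (B z : C) (u n : R) : 1 + z != 0 -> ydom (mkY j (par_of B z u n)).
Proof.
move=> z1; split; first by apply/two_sidesY_mkY.
by rewrite phiY_mkY; exact: mob_chart_dom.
Qed.

Lemma ysmooth_chart : smooth_affine_chart ydom.
Proof.
pose q v := complex.Re ((1 + v_z v) * (1 + v_z v)^*%C).
have qE v : (q v == 0) = (1 + v_z v == 0) by rewrite /q Re_mulJ_eq0.
apply: (@smooth_affine_chart_principal _ _ _ 6 ychart yparam q).
- apply: (fun_norm1p (@polyfun_ring R 6)).
  by split; exact: polyfun_co.
- have mv : @is_morphism _ (subspace ydom) Ysp (fun y => \val y) by exact: morph_val.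
  have [[rB1 rB2] ru rn [rz1 rz2]] := reg_ydom mv (@val_in _ _ _).
  by apply: reg_row_of6 => -[|[|[|[|[|[|]]]]]].
- move=> y hy; have [Uy _] := hy.
  have zE : v_z (ychart y) = zetaY j y by rewrite /v_z !co_row_of6 //= complex_eta.
  split; first by rewrite qE zE (zetaY_neqN1 (insp Uy)).
  rewrite /yparam !(@co_row_of6 _ _ 2, @co_row_of6 _ _ 3) //=.
  have -> : v_B (ychart y) = yB y by rewrite /v_B !co_row_of6 //= complex_eta.
  exact: mkY_par_of.
- move=> v; rewrite qE => z1; split; first exact: ydom_mkY.
  rewrite /ychart yB_mkY sideY_mkY phiY_mkY zetaY_mkY.
  by rewrite /pb /pphi /pz /pB /= mob_chart_u mob_chart_n; exact: row_of6_co.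
- pose Q := subspace [set v : affine_space R 6 | q v != 0].
  have mv : @is_morphism _ Q (affine_space R 6) (fun v => \val v) by exact: morph_val.
  have rc k : reg (fun v : Q => coord6 (\val v) k).
    exact: (reg_comp mv (reg_polyfun (@polyfun_co R k))).
  apply: (morph_comp (@morph_mkY R j)); apply: morph_par_of => //;
    by split; exact: rc.
Qed.

End YCharts.

Lemma smooth_Ysp (R : realType) : smooth_variety (Ysp R).
Proof.
apply: (@smooth_variety_charts _ _ ('I_3 * bool)%type (fun i => @ydom R i.1 i.2)).
- by apply: separated_by_creg; exact: Ysp_separating.
- move=> y; have [j Uj] := two_sidesY_cover y.
  by have [b hb] := mob_chart_cover (phiY j y); exists (j, b).
- by move=> [j b]; split; [exact: open_ydom|exact: ysmooth_chart].
Qed.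

(** * Charts of the space of triangles *)

Section TCharts.
Variable R : realType.
Notation C := (R[i]%C).
Notation T := (triangle_space R).

Lemma separated_triangle_space : separated T.
Proof.
apply: separated_by_creg => t t' H; apply: triangle_ext.
  apply: Ysp_separating => f rf.
  exact: (H _ (creg_comp (@morph_second_proj R) rf)).
move=> k; apply: e2_inj.
exact: (H _ (creg_comp (@morph_txi R k) (creg_e2 R))).
Qed.

Variables (j : 'I_3) (b b' : bool).

(** The second sign [b'] covers the circle added by the second blowup; zeta is now given by the real
    coordinate and slope of that chart. *)
Definition tdom : set T :=
  [set t | ydom j b (second_proj t) /\ 1 + chart_sign R b' * e2 (tri_angle j t) != 0].

Lemma open_tdom : zopen tdom.
Proof.
apply: zopenI; first exact: (open_preim (@morph_second_proj R) (@open_ydom R j b)).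
apply: (@open_creg _ T (fun t => 1 + chart_sign R b' * e2 (tri_angle j t))).
have re := creg_comp (@morph_tri_angle R j) (creg_e2 R).
by apply: cregD; [exact: creg_cst|apply: cregM; [exact: creg_cst|exact: re]].
Qed.

Definition tchart (t : T) : 'rV[R]_6 :=
  let y := second_proj t in
  row_of6 [:: complex.Re (yB y); complex.Im (yB y); mobu b (sideY j y);
    mobn b (e2 (phiY j y)); mobu b' (zetaY j y); mobn b' (e2 (tri_angle j t))].

Definition tz (v : 'rV[R]_6) : C := mobz b' (coord6 v 4) (coord6 v 5).

Definition tpar (v : 'rV[R]_6) : subspace (@parY R) * Rpi R :=
  (par_of b (v_B v) (tz v) (coord6 v 2) (coord6 v 3), argpi (mobd b' (coord6 v 5))).

Lemma parT0 : @parT R (par_of b 0 0 0 0, 0).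
Proof.
split; first by rewrite /pz /= addr0 oner_neq0.
by rewrite [pz _](_ : _ = 0) // rmorph0 mul0r.
Qed.

(* Values at points outside the chart domain are irrelevant. *)
Definition tparam (v : 'rV[R]_6) : T :=
  mkT j (if pselect (@parT R (tpar v)) is left h then insp h else insp parT0).

Lemma tparamE v (h : @parT R (tpar v)) : tparam v = mkT j (insp h).
Proof.
by rewrite /tparam; case: pselect => // h'; congr mkT; apply: insp_inj.
Qed.

Lemma tpar_in v : 1 + tz v != 0 -> @parT R (tpar v).
Proof. by move=> z1; split=> //; exact: mob_chart_mob. Qed.

Lemma tsmooth_chart : smooth_affine_chart tdom.
Proof.
pose q v := complex.Re ((1 + tz v) * (1 + tz v)^*%C).
have qE v : (q v == 0) = (1 + tz v == 0) by rewrite /q Re_mulJ_eq0.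
apply: (@smooth_affine_chart_principal _ _ _ 6 tchart tparam q).
- apply: (fun_norm1p (@polyfun_ring R 6)); apply: (cfun_mobz (@polyfun_ring R 6));
    exact: polyfun_co.
- have mv : @is_morphism _ (subspace tdom) T (fun t => \val t) by exact: morph_val.
  have my := morph_comp (@morph_second_proj R) mv.
  have hy (t : subspace tdom) : ydom j b (second_proj (\val t)) by case: (val_in t).
  have [[rB1 rB2] ru rn rz] := reg_ydom my hy.
  have ru' := reg_mobu b' rz.
  have rn' : reg (fun t : subspace tdom => mobn b' (e2 (tri_angle j (\val t)))).
    apply: (@reg_mobn _ _ b' (fun t : subspace tdom => tri_angle j (\val t))).
      exact: (@morph_comp _ _ T (Rpi_space R) _ _ (@morph_tri_angle R j) mv).
    by move=> t; case: (val_in t).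
  by apply: reg_row_of6 => -[|[|[|[|[|[|]]]]]].
- move=> t [hy ht]; have [Uy _] := hy.
  have zE : tz (tchart t) = zetaY j (second_proj t).
    by rewrite /tz !co_row_of6 //= mob_chart_z //; exact: tri_angle_zetaY.
  have z1 : 1 + tz (tchart t) != 0 by rewrite zE (zetaY_neqN1 (insp Uy)).
  split; first by rewrite qE.
  rewrite (tparamE (tpar_in z1)).
  have E : second_proj (mkT j (insp (tpar_in z1))) = second_proj t.
    rewrite second_proj_mkT /= -[RHS](mkY_par_of hy zE).
    congr (mkY j (par_of _ _ _ _ _)); rewrite ?co_row_of6 //.
    by rewrite /v_B !co_row_of6 //= complex_eta.
  apply: (@triangle_local_ext _ j); rewrite ?E //.
  by rewrite tri_angle_mkT /= !co_row_of6 //= mob_chart_dir.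
- move=> v; rewrite qE => z1; rewrite (tparamE (tpar_in z1)); split.
    split; first by rewrite second_proj_mkT; exact: ydom_mkY.
    by rewrite tri_angle_mkT; exact: mob_chart_dom.
  rewrite /tchart second_proj_mkT tri_angle_mkT yB_mkY sideY_mkY phiY_mkY zetaY_mkY.
  by rewrite /pb /pphi /pz /pB /= !mob_chart_u !mob_chart_n; exact: row_of6_co.
- pose Q := subspace [set v : affine_space R 6 | q v != 0].
  have mv : @is_morphism _ Q (affine_space R 6) (fun v => \val v) by exact: morph_val.
  have rc k : reg (fun v : Q => coord6 (\val v) k).
    exact: (reg_comp mv (reg_polyfun (@polyfun_co R k))).
  have hz (v : Q) : 1 + tz (\val v) != 0 by rewrite -qE; exact: (val_in v).
  apply: (@morph_eq _ _ _ (fun v : Q => mkT j (insp (tpar_in (hz v))))).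
    by move=> v; rewrite (tparamE (tpar_in (hz v))).
  apply: (morph_comp (@morph_mkT R j)); apply: morph_sub; apply: morph_prod.
    apply: morph_par_of => //; first by split; exact: rc.
    exact: (cfun_mobz (reg_ring Q) b' (rc _) (rc _)).
  exact: (morph_argpi_mobd b' (rc 5)).
Qed.

End TCharts.

Lemma smooth_triangle_space (R : realType) : smooth_variety (triangle_space R).
Proof.
apply: (@smooth_variety_charts _ _ ('I_3 * bool * bool)%type
  (fun i => @tdom R i.1.1 i.1.2 i.2)).
- exact: separated_triangle_space.
- move=> t; have [j Uj] := two_sidesY_cover (second_proj t).
  have [b hb] := mob_chart_cover (phiY j (second_proj t)).
  by have [b' hb'] := mob_chart_cover (tri_angle j t); exists (j, b, b').
- by move=> [[j b] b']; split; [exact: open_tdom|exact: tsmooth_chart].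
Qed.

Lemma triangle_space_iterated_blowup (R : realType) :
  triangle_space_is_iterated_blowup R.
Proof.
exists (RVar (smooth_Ysp R)), (@first_proj R), (@second_proj R).
by split; [exact: first_blowup|exact: second_blowup|].
Qed.

Theorem corollary6p1p2 (R : realType) :
  (exists hD : smooth_variety (class_space R),
     class_space_is_blowup R /\
     fine_moduli_space (M := RVar hD) (F := class_families R)
       (tautological_family hD)) /\
  (exists hT : smooth_variety (triangle_space R),
     triangle_space_is_iterated_blowup R /\
     fine_moduli_space (M := RVar hT) (F := triangle_families R)
       (tautological_family hT)).
Proof.
split.
- exists (smooth_class_space R); split; first exact: class_space_blowup.
  exact: fine_moduli_subspace.
- exists (smooth_triangle_space R); split; first exact: triangle_space_iterated_blowup.
  exact: fine_moduli_subspace.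
Qed.
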